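(* Let $\delta > 0$ and $\epsilon_0 > 0$. There exist constants $N_0 = N_0(\delta,\epsilon_0) > 0$ and $c_0 = c_0(\delta) > 0$ such that $$\bigl|F_{k,l}^{m,n,\mathrm{hor}}(s,t) - f_{k,l}^{\zeta(m,n),\mathrm{hor}}(s,t)\bigr| \le c_0\,(1+\log \max\{l,1\})\left\{\frac{\log(m+n)}{m+n}\right\}^{1/3},$$ $$\bigl|F_{k,l}^{m,n,\mathrm{ver}}(s,t) - f_{k,l}^{\zeta(m,n),\mathrm{ver}}(s,t)\bigr| \le c_0\,(1+\log \max\{k,1\})\left\{\frac{\log(m+n)}{m+n}\right\}^{1/3}$$ whenever $(m,n)\in S_\delta\cap\mathbb{Z}_{\ge N_0}^2$, $k\in[m-1]\cup\{0\}$, $l\in[n-1]\cup\{0\}$ with $k,l\le\epsilon_0(m+n)^{2/3}$, $s\in\mathbb{R}^k$ and $t\in\mathbb{R}^l$.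
   Context: Notation $c=c(a,b)$ means that the constant depends only on the listed parameters. $[n]=\{1,\dots,n\}$, $[0]=\emptyset$; $a^+=\max\{a,0\}$. An up-right path is a finite sequence in $\mathbb{Z}^2$ with steps in $\{(1,0),(0,1)\}$; $\Pi_{p,q}^{m,n}$ is the set of up-right paths from $(p,q)$ to $(m,n)$. Let $\{\omega(i,j):i,j\in\mathbb{Z}_{>0}\}$ be independent exponential random variables of rate $1$, and $G_{p,q}(m,n)=\max_{\pi\in\Pi_{p,q}^{m,n}}\sum_{(i,j)\in\pi}\omega(i,j)$ for $(p,q),(m,n)\in\mathbb{Z}_{>0}^2$ ($\max\emptyset=-\infty$). Define increments $B_{i,j}^{\mathrm{hor}}(m,n)=G_{i,j}(m,n)-G_{i+1,j}(m,n)$ and $B_{i,j}^{\mathrm{ver}}(m,n)=G_{i,j}(m,n)-G_{i,j+1}(m,n)$ for $i\in[m]$, $j\in[n]$. For $s=(s_i)_{i\in[k]}\in\mathbb{R}^k$ and $t=(t_j)_{j\in[l]}\in\mathbb{R}^l$ define $F_{k,l}^{m,n,\mathrm{hor}}(s,t)=\mathbf{P}\{B_{i,1}^{\mathrm{hor}}(m,n)>s_i\text{ for }i\in[k]\text{ and }B_{1,j}^{\mathrm{ver}}(m,n)\le t_j\text{ for }j\in[l]\}$, $F_{k,l}^{m,n,\mathrm{ver}}(s,t)=\mathbf{P}\{B_{i,1}^{\mathrm{hor}}(m,n)\le s_i\text{ for }i\in[k]\text{ and }B_{1,j}^{\mathrm{ver}}(m,n)> t_j\text{ for }j\in[l]\}$,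 and, for $z\in(0,1)$, $f_{k,l}^{z,\mathrm{hor}}(s,t)=\prod_{i\in[k]}e^{-s_i^+z}\prod_{j\in[l]}(1-e^{-t_j^+(1-z)})$, $f_{k,l}^{z,\mathrm{ver}}(s,t)=\prod_{i\in[k]}(1-e^{-s_i^+z})\prod_{j\in[l]}e^{-t_j^+(1-z)}$. $S_\delta=\{(x,y)\in\mathbb{R}_{>0}^2:x\ge\delta y,\ y\ge\delta x\}$ and $\zeta(x,y)=\dfrac{\sqrt{x}}{\sqrt{x}+\sqrt{y}}$. *)

(* Defs.v *)
From mathcomp Require Import all_boot all_order all_algebra finmap.
From mathcomp Require Import all_classical all_reals all_analysis.

Set Implicit Arguments.
Unset Strict Implicit.
Unset Printing Implicit Defensive.

Import Order.TTheory GRing.Theory Num.Theory.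
Import numFieldNormedType.Exports.

Local Open Scope classical_set_scope.
Local Open Scope ring_scope.

(* Sites of the quadrant are pairs of natural numbers. All paths considered
   start in Z_{>0}^2, hence stay there: the weights at sites with a zero
   coordinate never play any role. *)
Definition site : Type := (nat * nat)%type.

Definition positive_sites : set site :=
  [set u : site | (0 < u.1)%N /\ (0 < u.2)%N].

Definition up_right_step : rel site :=
  fun u v => (v == (u.1.+1, u.2)) || (v == (u.1, u.2.+1)).

(* A path is the sequence of all its vertices, both endpoints included. *)
Definition up_right_paths (u v : site) : set (seq site) :=
  [set pi | exists s, [/\ pi = u :: s, path up_right_step u s & last u s = v]].

(* Mutual independence of the family (X i)_{i in D}: the product rule holds for
   every finite subfamily. *)
Definition mutually_independent {d : measure_display} {T : measurableType d}
    {R : realType} {P : probability T R} {I : choiceType} (D : set I)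
    (X : I -> {RV P >-> R}) : Prop :=
  forall (J : {fset I}) (A : I -> set R),
    [set` J] `<=` D ->
    (forall i, i \in J -> measurable (A i)) ->
    P (\bigcap_(i in [set` J]) (X i @^-1` A i)) =
    (\prod_(i <- J) P (X i @^-1` A i))%E.

Definition exponential_rv {d : measure_display} {T : measurableType d}
    {R : realType} {P : probability T R} (rate : R) (X : {RV P >-> R}) : Prop :=
  forall A : set R, measurable A -> distribution P X A = exponential_prob rate A.

Definition exponential_weights {d : measure_display} {T : measurableType d}
    {R : realType} {P : probability T R} (w : site -> {RV P >-> R}) : Prop :=
  mutually_independent positive_sites w /\
  (forall u, positive_sites u -> exponential_rv 1 (w u)).

(* The set of paths is finite, so the supremum is a maximum ([last_passage_max]
   below), and the supremum of the empty set is -oo. *)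
Definition last_passage {R : realType} (w : site -> R) (u v : site) : \bar R :=
  ereal_sup [set (\sum_(x <- pi) w x)%:E | pi in up_right_paths u v].

Lemma finite_up_right_paths (u v : site) : finite_set (up_right_paths u v).
Proof.
have [n] := ubnP (v.1 + v.2 - (u.1 + u.2))%N.
elim: n u => // n IHn u; rewrite ltnS => lt_n.
have size_path (s : seq site) x : path up_right_step x s ->
    ((last x s).1 + (last x s).2 = x.1 + x.2 + size s)%N.
  elim: s x => [|y s IHs] x /=; first by rewrite addn0.
  case/andP=> /orP[] /eqP-> /IHs -> /=.
    by rewrite !addSn !addnS.
  by rewrite !addnS !addSn.
have [uv|vu] := ltnP (u.1 + u.2) (v.1 + v.2).
  apply: (@sub_finite_set _ _ ([set [:: u]] `|`
    (cons u @` up_right_paths (u.1.+1, u.2) v `|`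
     cons u @` up_right_paths (u.1, u.2.+1) v))).
    move=> _ [[|y s] [-> /= us lus]]; [by left | right].
    case/andP: us => /orP[] /eqP ey us; [left|right];
      by exists (y :: s) => //; exists s; rewrite -ey.
  rewrite !finite_setU; split; first exact: finite_set1.
  by split; apply: finite_image; apply: IHn => /=;
    rewrite ?addnS ?addSn subnS; apply: leq_trans lt_n; rewrite prednK ?subn_gt0.
apply: (@sub_finite_set _ _ [set [:: u]]); last exact: finite_set1.
move=> _ [s [-> us lus]]; move: (size_path _ _ us); rewrite lus => e.
case: s e {us lus} => [//|y s] /= e.
by move: vu; rewrite e addnS ltnNge leq_addr.
Qed.

Lemma last_passage_max {R : realType} (w : site -> R) (u v : site) :
  up_right_paths u v !=set0 ->
  exists2 pi, up_right_paths u v pi &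
    last_passage w u v = (\sum_(x <- pi) w x)%:E /\
    forall rho, up_right_paths u v rho ->
      \sum_(x <- rho) w x <= \sum_(x <- pi) w x.
Proof.
move=> [p0 p0uv]; set f := fun p : seq site => \sum_(x <- p) w x.
have /finite_seqP[s es] := finite_up_right_paths u v.
have p0s : p0 \in s by move: p0uv; rewrite es.
have [p ps pmax] : exists2 p, p \in s & forall q, q \in s -> f q <= f p.
  have n0 : (0 < size s)%N by case: (s) p0s.
  pose i0 := Ordinal n0.
  case: (@Order.TotalTheory.arg_maxP _ _ 'I_(size s) i0 xpredT
    (fun i => f (nth [::] s i)) isT) => i _ imax.
  exists (nth [::] s i); first exact: mem_nth.
  by move=> q /(nthP [::])[j js <-]; exact: (imax (Ordinal js) isT).
have puv : up_right_paths u v p by rewrite es.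
have pmax' q : up_right_paths u v q -> f q <= f p by rewrite es; exact: pmax.
exists p => //; split=> //; apply/eqP; rewrite eq_le; apply/andP; split.
  by apply: ge_ereal_sup => _ [q quv <-]; rewrite lee_fin pmax'.
by apply: ereal_sup_ubound; exists p.
Qed.

Definition hor_increment {R : realType} (w : site -> R) (i j m n : nat)
    : \bar R :=
  (last_passage w (i, j) (m, n) - last_passage w (i.+1, j) (m, n))%E.

Definition ver_increment {R : realType} (w : site -> R) (i j m n : nat)
    : \bar R :=
  (last_passage w (i, j) (m, n) - last_passage w (i, j.+1) (m, n))%E.

(* 'I_k = {0, ..., k - 1} stands for [k] = {1, ..., k}: the coordinate s i of
   s in R^k goes with the increment of index i.+1. *)
Definition F_hor {d : measure_display} {T : measurableType d} {R : realType}
    {P : probability T R} (w : site -> {RV P >-> R}) (m n k l : nat)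
    (s : 'I_k -> R) (t : 'I_l -> R) : R :=
  fine (P [set x : T |
    (forall i : 'I_k,
       ((s i)%:E < hor_increment (fun u => w u x) i.+1 1 m n)%E) /\
    (forall j : 'I_l,
       (ver_increment (fun u => w u x) 1 j.+1 m n <= (t j)%:E)%E)]).

Definition F_ver {d : measure_display} {T : measurableType d} {R : realType}
    {P : probability T R} (w : site -> {RV P >-> R}) (m n k l : nat)
    (s : 'I_k -> R) (t : 'I_l -> R) : R :=
  fine (P [set x : T |
    (forall i : 'I_k,
       (hor_increment (fun u => w u x) i.+1 1 m n <= (s i)%:E)%E) /\
    (forall j : 'I_l,
       ((t j)%:E < ver_increment (fun u => w u x) 1 j.+1 m n)%E)]).

Definition pos_part {R : realType} (a : R) : R := Num.max a 0.

Definition f_hor {R : realType} (z : R) (k l : nat)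
    (s : 'I_k -> R) (t : 'I_l -> R) : R :=
  (\prod_(i < k) expR (- pos_part (s i) * z)) *
  (\prod_(j < l) (1 - expR (- pos_part (t j) * (1 - z)))).

Definition f_ver {R : realType} (z : R) (k l : nat)
    (s : 'I_k -> R) (t : 'I_l -> R) : R :=
  (\prod_(i < k) (1 - expR (- pos_part (s i) * z))) *
  (\prod_(j < l) expR (- pos_part (t j) * (1 - z))).

Definition cone {R : realType} (delta : R) : set (R * R) :=
  [set p | [/\ 0 < p.1, 0 < p.2, delta * p.2 <= p.1 & delta * p.1 <= p.2]].

Definition zeta {R : realType} (x y : R) : R :=
  Num.sqrt x / (Num.sqrt x + Num.sqrt y).

(* Main.v *)
From HB Require Import structures.
Require Import Defs.
From mathcomp Require Import all_boot all_order all_algebra finmap.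
From mathcomp Require Import all_classical all_reals all_analysis.
From mathcomp Require Import measurable_realfun.
From mathcomp Require Import ring lra zify.
Set Implicit Arguments.
Unset Strict Implicit.
Unset Printing Implicit Defensive.

Import Order.TTheory GRing.Theory Num.Theory.
Import numFieldNormedType.Exports.

Local Open Scope classical_set_scope.
Local Open Scope ring_scope.

(** Reversing the directions turns the increments at the lower left corner into
increments, near the far corner, of a last passage time started at the origin
([last_passage_lpp]); [bulk] denotes it.  Add to the quadrant a horizontal axis
with weights Exp(z) and a vertical axis with weights Exp(1 - z).  In the enlarged
model [lpp] the increments along the far sides of any rectangle are independent,
Exp(z) horizontally and Exp(1 - z) vertically, so that the probability in
question is exactly [f_hor z] ([stationary_law]).  This is the Burke property: a
cell maps its incoming increments (I, J) and its weight W to the outgoing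
increments (W + (I - J)^+, W + (J - I)^+), and this map preserves the law of
independent exponential variables ([int1_flip]), because the minimum of I and J is
Exp(1) and independent of the rest.

The two models are coupled by using the same bulk weights.  A maximal path of the
enlarged model leaves the origin along one of the axes; [via_hor] and [via_ver]
are the last passage times with a prescribed axis.  Since the cell map is
increasing in the increment of its own direction and decreasing in the other one,
horizontal increments are ordered as [via_ver], [bulk], [via_hor] and vertical ones
in the opposite order ([increments_compare]).  In particular [via_hor] - [via_ver]
is monotone, so that one inequality between [via_hor] and [via_ver] at one corner
compares all the increments of interest at once ([exit_hor], [exit_ver]).  Hence,
for all z and z', F_hor is at most f_hor z plus the probability of a vertical exit
at (m - k, n), and at least f_hor z' minus that of a horizontal exit at (m, n - l)
([F_hor_le], [F_hor_ge]).

At the critical value zeta = zeta(m, n) both exits are possible; below zeta the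
vertical exit becomes unlikely.  To see it, note that the Burke property and an
exponential change of measure evaluate the Laplace transform of the last passage
time with rates (z, 1 - v) in closed form ([mgf_stationary]).  For z < u < v and x
the mean at u, a vertical exit forces either the paths through the vertical axis to
exceed x, or all paths to stay below x, after the vertical rate has been lowered to
1 - u.  Both are estimated by the exponential Markov inequality ([exit_ver_bound]).
The exponents are the gap between a strictly concave function and its tangent at u;
at distance rho below zeta its curvature is at least (m + n) rho, which gives the
bound 2 exp (- (m + n) rho^3 / 4) for the spacing rho of z, u, v, zeta
([exit_value_le]).  Moving the corner by k <= eps0 (m + n)^(2/3) does not matter,
since k is small against (m + n) rho.

With N = m + n, r^3 = ln N / N and rho = 2 r, the exits have probability at most
2 N^(-2), and z = zeta - 6 r, z' = zeta + 6 r.  It remains to replace z and z' by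
zeta in f_hor.  The product of the tails changes by O(r) whatever k is; in the
product of l distribution functions each factor changes by O(r) y exp(- y), which
is compared to exp(- y) for y <= 2 ln l and is at most 1 / l beyond, whence the
logarithm ([prod_1expR_sub_le]).  The estimate for F_ver is that for F_hor after
transposing the weights. *)

(** * Configurations and iterated exponential integrals *)

Section exponential_integral.
Context {R : realType}.
Implicit Types (r : R) (f : R -> \bar R).
Local Notation mu := (@lebesgue_measure R).

Definition expd r (x : R) : R := exponential_pdf r x.

Lemma measurable_expd r : measurable_fun [set: R] (EFin \o expd r).
Proof. by apply/measurable_EFinP; exact: measurable_exponential_pdf. Qed.

Import HBNNSimple.

(** The law of a weight is known on measurable sets; approximation by simple
functions yields its density. *)
Lemma integral_exponential_prob (nu : probability R R) r f :
  0 < r -> (forall A, measurable A -> nu A = exponential_prob r A) ->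
  measurable_fun [set: R] f -> (forall x, 0 <= f x)%E ->
  (\int[nu]_x f x = \int[mu]_x (f x * (expd r x)%:E))%E.
Proof.
move=> r0 nuE mf f0.
have pdf0 x : (0 <= (expd r x)%:E)%E.
  by rewrite lee_fin exponential_pdf_ge0// ltW.
have mpdf := measurable_expd r.
pose f_ := nnsfun_approx measurableT mf.
have mI n y : measurable_fun [set: R] (fun x : R => y * \1_(f_ n @^-1` [set y]) x).
  by apply: measurable_funM => //; exact: measurable_indic.
have mf_ n : measurable_fun [set: R] (fun x : R => (f_ n x)%:E).
  by apply/measurable_EFinP.
have ndf x m n : (m <= n)%N -> f_ m x <= f_ n x.
  by move=> mn; exact/lefP/nd_nnsfun_approx.
have f_simple n : (\int[nu]_x (f_ n x)%:E =
    \int[mu]_x ((f_ n x)%:E * (expd r x)%:E))%E.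
  under eq_integral do rewrite fimfunE -fsumEFin//.
  rewrite ge0_integral_fsum//; last 2 first.
    by move=> y; apply/measurable_EFinP; exact: mI.
    by move=> y x _; rewrite EFinM nnfun_muleindic_ge0.
  under [RHS]eq_integral.
    move=> x xD; rewrite fimfunE -fsumEFin// ge0_mule_fsuml; last first.
      by move=> y; rewrite EFinM nnfun_muleindic_ge0.
    over.
  rewrite [RHS]ge0_integral_fsum//; last 2 first.
    move=> y; apply: emeasurable_funM => //.
    by apply/measurable_EFinP; exact: mI.
    by move=> y x _; rewrite EFinM mule_ge0// nnfun_muleindic_ge0.
  apply: eq_fsbigr => y yf.
  have y0 : 0 <= y.
    by move: yf; rewrite inE /= => -[x _ <-].
  have mA : measurable (f_ n @^-1` [set y]) by [].
  under [LHS]eq_integral do rewrite EFinM.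
  rewrite ge0_integralZl//; last first.
    by apply/measurable_EFinP; exact: measurable_indic.
  rewrite integral_indic//= setIT nuE// /exponential_prob.
  rewrite -[(\int[mu]_(x in f_ n @^-1` [set y]) _)%E]/
    (\int[mu]_(x in f_ n @^-1` [set y]) (expd r x)%:E)%E.
  rewrite integral_mkcond -ge0_integralZl//; last 2 first.
    by apply/(measurable_restrictT _ _).1 => //; exact: measurable_funTS.
    by move=> x _; rewrite patchE; case: ifP.
  apply: eq_integral => x _; rewrite patchE indicE.
  by case: ifP => _; rewrite ?(mulr1, mulr0) ?mule0 ?mul0e.
transitivity (lim (\int[nu]_x (f_ n x)%:E @[n --> \oo])%E).
  rewrite -monotone_convergence//=.
  - apply: eq_integral => ? /[!inE] xD; apply/esym/cvg_lim => //=.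
    exact: cvg_nnsfun_approx.
  - by move=> n ? _; rewrite lee_fin.
  - by move=> x _ m n mn; rewrite lee_fin; exact: ndf.
under [in LHS]eq_fun do rewrite f_simple.
rewrite -monotone_convergence//=.
- apply: eq_integral => x /[!inE] xD; apply/cvg_lim => //=.
  apply: cvgeZr => //; exact: cvg_nnsfun_approx.
- by move=> n; apply: emeasurable_funM => //; exact: mf_.
- by move=> n x _; rewrite mule_ge0// lee_fin.
- by move=> x _ m n mn; rewrite lee_wpmul2r// lee_fin; exact: ndf.
Qed.

End exponential_integral.

Section configurations.
Context {R : realType}.
Local Notation mu := (@lebesgue_measure R).

(** Configurations carry the sigma-algebra generated by the coordinates.  No
measure on the whole space is needed: all functions considered depend on finitely
many sites, which are integrated one after the other. *)
Definition coordinate_preimages : set (set (site -> R)) :=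
  [set A | exists i : site, exists2 B : set R,
     measurable B & A = (fun c => c i) @^-1` B].

Definition cfg := g_sigma_algebraType coordinate_preimages.

Lemma measurable_coord (i : site) : measurable_fun [set: cfg] (fun c : cfg => c i : R).
Proof.
by move=> _ B mB; rewrite setTI; apply: sub_sigma_algebra; exists i, B.
Qed.

Lemma measurable_cfg d (T : measurableType d) (f : T -> cfg) :
  (forall i, measurable_fun [set: T] (fun x => f x i : R)) -> measurable_fun [set: T] f.
Proof.
move=> mf; apply: (@measurability _ _ _ cfg _ _ coordinate_preimages) => //.
move=> _ [_ [i [B mB ->]] <-].
by have := mf i measurableT B mB.
Qed.

Definition upd (c : cfg) (i : site) (x : R) : cfg :=
  fun j => if j == i then x else c j.

Lemma updC c i j x y : i != j -> upd (upd c i x) j y = upd (upd c j y) i x.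
Proof.
move=> ij; apply/funext => k; rewrite /upd.
by case: (eqVneq k j) => [->|//]; rewrite eq_sym (negbTE ij).
Qed.

Lemma upd_upd c i x y : upd (upd c i x) i y = upd c i y.
Proof. by apply/funext => k; rewrite /upd; case: (k == i). Qed.

Lemma measurable_upd d (T : measurableType d) (f : T -> cfg) (g : T -> R) i :
  measurable_fun setT f -> measurable_fun setT g ->
  measurable_fun setT (fun x => upd (f x) i (g x)).
Proof.
move=> mf mg; apply: measurable_cfg => j; rewrite /upd.
case: (j == i) => //.
exact: (measurableT_comp (measurable_coord j) mf).
Qed.

(** Nonnegativity gives Tonelli and monotonicity without integrability conditions. *)
Definition integrand (f : cfg -> \bar R) :=
  measurable_fun [set: cfg] f /\ forall c, (0 <= f c)%E.

(** The result is again a function of the whole configuration, constant in the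
coordinate i, so that integrations over several sites compose without product
types. *)
Definition int1 (i : site) (r : R) (f : cfg -> \bar R) : cfg -> \bar R :=
  fun c => (\int[mu]_x (f (upd c i x) * (expd r x)%:E))%E.

Lemma measurable_comp_upd (f : cfg -> \bar R) c i :
  measurable_fun setT f -> measurable_fun [set: R] (fun x => f (upd c i x)).
Proof.
move=> mf; apply: measurableT_comp => //.
by apply: measurable_upd => //; exact: measurable_cst.
Qed.

Section int1_theory.
Variables (r : R) (r0 : 0 < r).
Implicit Types (f g : cfg -> \bar R) (c : cfg) (i j : site).

Lemma expd_ge0 x : (0 <= (expd r x)%:E)%E.
Proof. by rewrite lee_fin exponential_pdf_ge0// ltW. Qed.

Let mexpd : measurable_fun [set: R] (fun x => (expd r x)%:E) := measurable_expd r.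

Lemma integral_expd : (\int[mu]_x (expd r x)%:E = 1)%E.
Proof. exact: integral_exponential_pdf. Qed.

Lemma int1_measurable f c i : measurable_fun setT f ->
  measurable_fun [set: R] (fun x => f (upd c i x) * (expd r x)%:E)%E.
Proof. by move=> mf; apply: emeasurable_funM => //; exact: measurable_comp_upd. Qed.

Lemma int1_pos f c i x : integrand f -> (0 <= f (upd c i x) * (expd r x)%:E)%E.
Proof. by move=> gf; rewrite mule_ge0// ?gf.2// expd_ge0. Qed.

Lemma integrand_int1 i f : integrand f -> integrand (int1 i r f).
Proof.
move=> gf; split; last first.
  by move=> c; apply: integral_ge0 => x _; exact: int1_pos.
pose F (p : cfg * R) := (f (upd p.1 i p.2) * (expd r p.2)%:E)%E.
apply: (@measurable_fun_fubini_tonelli_F _ _ cfg (measurableTypeR R) R mu F).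
- apply: emeasurable_funM; last exact: measurableT_comp mexpd measurable_snd.
  apply: measurableT_comp; first exact: gf.1.
  by apply: measurable_upd; [exact: measurable_fst|exact: measurable_snd].
- by move=> p; rewrite /F mule_ge0// ?gf.2// expd_ge0.
Qed.

Lemma int1_indep i f : integrand f -> (forall c x, f (upd c i x) = f c) -> int1 i r f = f.
Proof.
move=> gf fi; apply/funext => c; rewrite /int1.
under eq_integral do rewrite fi.
by rewrite ge0_integralZl ?integral_expd ?mule1//; [move=> x _; exact: expd_ge0 | exact: gf.2].
Qed.

Lemma int1_le i f g c : integrand f -> integrand g -> (forall c, f c <= g c)%E ->
  (int1 i r f c <= int1 i r g c)%E.
Proof.
move=> gf gg fg; apply: ge0_le_integral => //.
- by move=> x _; exact: int1_pos.
- exact: int1_measurable gf.1.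
- exact: int1_measurable gg.1.
- by move=> x _; rewrite lee_wpmul2r// expd_ge0.
Qed.

Lemma int1D i f g : integrand f -> integrand g ->
  int1 i r (fun c => f c + g c)%E = (fun c => int1 i r f c + int1 i r g c)%E.
Proof.
move=> gf gg; apply/funext => c; rewrite /int1.
under eq_integral do rewrite ge0_muleDl ?gf.2// ?gg.2//.
rewrite ge0_integralD//.
- by move=> x _; exact: int1_pos.
- exact: int1_measurable gf.1.
- by move=> x _; exact: int1_pos.
- exact: int1_measurable gg.1.
Qed.

Lemma int1Z i f (k : cfg -> R) : integrand f -> (forall c, 0 <= k c) ->
    (forall c x, k (upd c i x) = k c) ->
  int1 i r (fun c => (k c)%:E * f c)%E = (fun c => (k c)%:E * int1 i r f c)%E.
Proof.
move=> gf k0 ki; apply/funext => c; rewrite /int1.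
under eq_integral do rewrite ki -muleA.
rewrite ge0_integralZl//.
- exact: int1_measurable gf.1.
- by move=> x _; exact: int1_pos.
- by rewrite lee_fin.
Qed.

Lemma int1_mulr i f c (k : \bar R) : integrand f -> (0 <= k)%E ->
  (int1 i r f c * k = \int[mu]_x (f (upd c i x) * (expd r x)%:E * k))%E.
Proof.
move=> gf k0; apply/esym/ge0_integralZr => //; first exact: int1_measurable gf.1.
by move=> x _; exact: int1_pos.
Qed.

End int1_theory.

Lemma int1C r1 r2 i j f : 0 < r1 -> 0 < r2 -> i != j -> integrand f ->
  int1 i r1 (int1 j r2 f) = int1 j r2 (int1 i r1 f).
Proof.
move=> r10 r20 ij gf; apply/funext => c.
pose F (p : R * R) := (f (upd (upd c i p.1) j p.2) * (expd r1 p.1)%:E * (expd r2 p.2)%:E)%E.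
have mF : measurable_fun setT F.
  apply: emeasurable_funM; last exact: measurableT_comp (measurable_expd r2) measurable_snd.
  apply: emeasurable_funM; last exact: measurableT_comp (measurable_expd r1) measurable_fst.
  apply: measurableT_comp; first exact: gf.1.
  apply: measurable_upd; last exact: measurable_snd.
  by apply: measurable_upd; [exact: measurable_cst|exact: measurable_fst].
have F0 p : (0 <= F p)%E by rewrite !mule_ge0// ?gf.2// expd_ge0.
transitivity (\int[mu]_x \int[mu]_y F (x, y))%E.
  rewrite {1}/int1; apply: eq_integral => x _.
  rewrite (int1_mulr r20 j (upd c i x) gf (expd_ge0 r10 x)).
  by apply: eq_integral => y _; rewrite /F/= muleAC.
rewrite (@fubini_tonelli _ _ (measurableTypeR R) (measurableTypeR R) R mu mu F)//.
rewrite {1}/int1; apply: eq_integral => y _.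
rewrite (int1_mulr r10 i (upd c j y) gf (expd_ge0 r20 y)).
by apply: eq_integral => x _; rewrite /F/= updC.
Qed.

(** This plays the part of a finite product measure: by [expect_catC] the order of
the sites does not matter. *)
Definition expect (rate : site -> R) (s : seq site) (f : cfg -> \bar R) :=
  foldr (fun i => int1 i (rate i)) f s.

Section expect_theory.
Variable (rate : site -> R).
Hypothesis rate0 : forall i, 0 < rate i.
Implicit Types (f g : cfg -> \bar R) (c : cfg) (i j : site) (s : seq site).

Lemma integrand_expect s f : integrand f -> integrand (expect rate s f).
Proof. by move=> gf; elim: s => //= i s; exact: integrand_int1. Qed.

Lemma expect_le s f g c : integrand f -> integrand g -> (forall c, f c <= g c)%E ->
  (expect rate s f c <= expect rate s g c)%E.
Proof.
move=> gf gg fg; elim: s c => //= i s IH c.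
by apply: int1_le => //; exact: integrand_expect.
Qed.

Lemma expectD s f g : integrand f -> integrand g ->
  expect rate s (fun c => f c + g c)%E = (fun c => expect rate s f c + expect rate s g c)%E.
Proof.
move=> gf gg; elim: s => //= i s IH.
by rewrite IH int1D//; exact: integrand_expect.
Qed.

Lemma expectZ s f (k : R) : integrand f -> 0 <= k ->
  expect rate s (fun c => k%:E * f c)%E = (fun c => k%:E * expect rate s f c)%E.
Proof.
move=> gf k0; elim: s => //= i s IH.
by rewrite IH int1Z//; exact: integrand_expect.
Qed.

Lemma expect_cat s1 s2 f : expect rate (s1 ++ s2) f = expect rate s1 (expect rate s2 f).
Proof. by rewrite /expect foldr_cat. Qed.

Lemma expect_indep s f : integrand f ->
  (forall i c x, i \in s -> f (upd c i x) = f c) -> expect rate s f = f.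
Proof.
move=> gf; elim: s => //= i s IH fi.
rewrite IH; first by apply: int1_indep => // c x; apply: fi; rewrite mem_head.
by move=> j c x js; apply: fi; rewrite inE js orbT.
Qed.

Lemma expect_catC s1 s2 f : integrand f ->
  expect rate (s1 ++ s2) f = expect rate (s2 ++ s1) f.
Proof.
have comm1 i s g : integrand g -> expect rate (i :: s) g = expect rate (rcons s i) g.
  move=> gg; elim: s => [//|j s IH]; rewrite rcons_cons.
  rewrite -[expect rate (j :: rcons s i) g]/(int1 j (rate j) (expect rate (rcons s i) g)).
  rewrite -IH; have [->//|ij] := eqVneq i j.
  exact: int1C (integrand_expect _ gg).
move=> gf; elim: s1 s2 => [|i s1 IH] s2; first by rewrite cats0.
by rewrite cat_cons comm1// rcons_cat IH cat_rcons.
Qed.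

End expect_theory.

End configurations.

(** * One-variable exponential integrals *)

Section one_variable.
Context {R : realType}.
Local Notation mu := (@lebesgue_measure R).
Implicit Types (f : R -> \bar R) (r t x : R).

Lemma measurable_indicator d (T : measurableType d) (b : T -> bool) :
  measurable_fun [set: T] b -> measurable_fun [set: T] (fun y => (b y)%:R : R).
Proof.
move=> mb; apply: (@measurableT_comp _ _ _ _ _ _ (fun b : bool => b%:R : R)) => //.
Qed.

Lemma measurable_shift t : measurable_fun [set: R] (fun x : R => x + t).
Proof. by apply: measurable_funD. Qed.

Lemma integral_shift f t : measurable_fun [set: R] f -> (forall x, 0 <= f x)%E ->
  (\int[mu]_x f (x + t)%R = \int[mu]_x f x)%E.
Proof.
move=> mf f0.
have mg : @measurable_fun _ _ (measurableTypeR R) (measurableTypeR R) setT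
    (fun x => x + t) by exact: measurable_shift.
pose g : {mfun measurableTypeR R >-> measurableTypeR R} :=
  HB.pack (fun x : measurableTypeR R => x + t : measurableTypeR R)
    (isMeasurableFun.Build _ _ _ _ _ mg).
have muE A : measurable A -> mu A = pushforward mu g A.
  move=> mA; apply: (@lebesgue_measure_unique R (pushforward mu g)) => //.
  move=> _ [[a b]] _ <-; rewrite /= /pushforward.
  have -> : (fun x : R => x + t) @^-1` `]a, b] = `]a - t, b - t]%classic.
    by apply/seteqP; split=> x /=; rewrite !in_itv/= ltrBlDr lerBrDr.
  by rewrite !lebesgue_measure_itv/= !lte_fin ltrD2r; case: ifP => // _; rewrite -!EFinB; congr EFin; ring.
have -> : (\int[mu]_x f x = \int[pushforward mu g]_x f x)%E.
  by apply: eq_measure_integral => A mA _; exact: muE.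
by rewrite ge0_integral_pushforward//= ?preimage_setT.
Qed.

Lemma expdE r x : 0 <= x -> expd r x = r * expR (- r * x).
Proof. exact: exponential_pdfE. Qed.

Lemma expd_lt0 r x : x < 0 -> expd r x = 0.
Proof. exact: lt0_exponential_pdf. Qed.

(** Memorylessness: beyond t the density is a multiple of the density shifted by t. *)
Lemma integral_expd_ge f r t : 0 < r -> 0 <= t ->
    measurable_fun [set: R] f -> (forall x, 0 <= f x)%E ->
  (\int[mu]_x (f x * (expd r x * (t <= x)%R%:R)%:E) =
   (expR (- r * t))%:E * \int[mu]_x (f (x + t)%R * (expd r x)%:E))%E.
Proof.
move=> r0 t0 mf f0.
have mt : measurable_fun [set: R] (fun x : R => (expd r x * (t <= x)%R%:R)%:E).
  apply/measurable_EFinP; apply: measurable_funM.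
    by apply/measurable_EFinP; exact: measurable_expd.
  apply: measurable_indicator; exact: measurable_fun_ler.
rewrite -(@integral_shift (fun x => f x * (expd r x * (t <= x)%R%:R)%:E)%E t).
- rewrite -ge0_integralZl//.
  + apply: eq_integral => x _; rewrite muleCA; congr (_ * _)%E.
    rewrite -EFinM; congr EFin; rewrite lerDr.
    have [x0|x0] := leP 0 x; last by rewrite (expd_lt0 _ x0)/= !mulr0.
    rewrite /= mulr1 !expdE//; last exact: addr_ge0.
    by rewrite mulrDr expRD mulrC; ring.
  + apply: emeasurable_funM; last exact: measurable_expd.
    by apply: measurableT_comp => //; exact: measurable_shift.
  + by move=> x _; rewrite mule_ge0// expd_ge0.
- by apply: emeasurable_funM.
- move=> x; rewrite mule_ge0// lee_fin mulr_ge0//.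
  by rewrite -lee_fin expd_ge0.
Qed.

Lemma integral_expd_gt f r t : 0 < r -> 0 <= t ->
    measurable_fun [set: R] f -> (forall x, 0 <= f x)%E ->
  (\int[mu]_x (f x * (expd r x * (t < x)%R%:R)%:E) =
   (expR (- r * t))%:E * \int[mu]_x (f (x + t)%R * (expd r x)%:E))%E.
Proof.
move=> r0 t0 mf f0; rewrite -integral_expd_ge//.
have mI (b : bool) : measurable_fun [set: R]
    (fun x : R => (expd r x * (if b then t < x else t <= x)%R%:R)%:E).
  apply/measurable_EFinP; apply: measurable_funM.
    by apply/measurable_EFinP; exact: measurable_expd.
  case: b.
    apply: measurable_indicator; exact: measurable_fun_ltr.
  apply: measurable_indicator; exact: measurable_fun_ler.
apply: ae_eq_integral => //.
- by apply: emeasurable_funM => //; exact: (mI true).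
- by apply: emeasurable_funM => //; exact: (mI false).
- exists [set t]; split => //; first exact: lebesgue_measure_set1.
  move=> x /= /not_implyP[_ xt]; apply: contrapT => /eqP nxt; apply: xt.
  by rewrite lt_def nxt.
Qed.

Lemma integral_expd_tail r t : 0 < r ->
  (\int[mu]_x ((t < x)%R%:R%:E * (expd r x)%:E) = (expR (- pos_part t * r))%:E)%E.
Proof.
move=> r0; rewrite /pos_part; have [t0|t0] := leP t 0.
- rewrite oppr0 mul0r expR0 -(integral_expd r0).
  have tt : t <= 0 := t0.
  transitivity (\int[mu]_x (1 * (expd r x * (0 < x)%R%:R)%:E))%E; last first.
    rewrite (integral_expd_gt (f := fun => 1%E))// mulr0 expR0 mul1e.
    by apply: eq_integral => x _; rewrite mul1e.
  have mI (s : R) : measurable_fun [set: R] (fun x : R => ((s < x)%R%:R : R)%:E).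
    apply/measurable_EFinP.
    apply: measurable_indicator; exact: measurable_fun_ltr.
  apply: ae_eq_integral => //.
  + exact: (emeasurable_funM (mI t) (measurable_expd r)).
  + under eq_fun do rewrite mul1e EFinM.
    exact: (emeasurable_funM (measurable_expd r) (mI 0)).
  + exists [set 0]; split => //; first exact: lebesgue_measure_set1.
    move=> x /= /not_implyP[_ xt]; apply: contrapT => /eqP nxt; apply: xt.
    have [x0|x0|x0] := ltgtP 0 x.
    * by rewrite (le_lt_trans tt x0) mul1e mulr1 mul1e.
    * by rewrite expd_lt0// mul0r !mule0.
    * by rewrite x0 eqxx in nxt.
- transitivity (\int[mu]_x (1 * (expd r x * (t < x)%R%:R)%:E))%E.
    by apply: eq_integral => x _; rewrite mul1e mulrC EFinM.
  rewrite (integral_expd_gt (f := fun => 1%E))//; last exact: ltW.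
  under eq_integral do rewrite mul1e.
  by rewrite integral_expd// mule1 mulNr mulrC -mulNr.
Qed.

Lemma expd_tilt r a x : 0 < r + a ->
  expR (- (a * x)) * expd r x = r / (r + a) * expd (r + a) x.
Proof.
move=> ra0; have [x0|x0] := leP 0 x; last by rewrite !expd_lt0// !mulr0.
rewrite !expdE// [RHS]mulrA divfK ?gt_eqF// mulrCA -expRD.
by congr (_ * expR _); ring.
Qed.

(** For r < s the quotient of the densities is monotone on the half-line, so they cross
once, at ln (s / r) / (s - r). *)
Lemma expd_crossing r s : 0 < r -> r <= s ->
  exists2 a : R, 0 <= a & forall x, (x <= a -> expd r x <= expd s x) /\
                       (a <= x -> expd s x <= expd r x).
Proof.
move=> r0; rewrite le_eqVlt => /orP[/eqP<-|rs]; first by exists 0.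
have s0 : 0 < s := lt_trans r0 rs.
have sr0 : 0 < s - r by rewrite subr_gt0.
have a0 : 0 <= ln (s / r) / (s - r).
  by rewrite divr_ge0 ?(ltW sr0)// ln_ge0// ler_pdivlMr// mul1r ltW.
exists (ln (s / r) / (s - r)) => // x.
have [x0|x0] := leP 0 x; last by rewrite !expd_lt0//.
rewrite !expdE//.
have E1 : (s * expR (- s * x) <= r * expR (- r * x)) = (ln (s / r) / (s - r) <= x).
  rewrite ler_pdivrMr// -[RHS]ler_expR lnK ?posrE ?divr_gt0// [RHS]ler_pdivrMr//.
  have -> : - r * x = x * (s - r) + - s * x by ring.
  by rewrite expRD mulrA ler_pM2r ?expR_gt0// mulrC.
have E2 : (r * expR (- r * x) <= s * expR (- s * x)) = (x <= ln (s / r) / (s - r)).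
  rewrite ler_pdivlMr// -[RHS]ler_expR lnK ?posrE ?divr_gt0// [RHS]ler_pdivlMr//.
  have -> : - r * x = x * (s - r) + - s * x by ring.
  by rewrite expRD mulrA ler_pM2r ?expR_gt0// mulrC.
by rewrite E1 E2.
Qed.

(** With a the crossing point of the densities, (f x - f a) * (expd r x - expd s x)
is nonnegative for all x.  The proof moves the negative terms to the other side,
so that only nonnegative functions are integrated. *)
Lemma integral_expd_le_rate (f : R -> R) r s : 0 < r -> r <= s ->
    measurable_fun [set: R] f -> (forall x, 0 <= f x) ->
    (forall x y, x <= y -> f x <= f y) ->
  (\int[mu]_x ((f x)%:E * (expd s x)%:E) <= \int[mu]_x ((f x)%:E * (expd r x)%:E))%E.
Proof.
move=> r0 rs mf f0 fnd; have s0 : 0 < s := lt_le_trans r0 rs.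
have [a a0 cross] := expd_crossing r0 rs.
have mfe : measurable_fun [set: R] (fun x => (f x)%:E) by apply/measurable_EFinP.
have mt (b q : R) : measurable_fun [set: R] (fun x => b%:E * (expd q x)%:E)%E.
  by apply: emeasurable_funM => //; exact: measurable_expd.
have mfq q : measurable_fun [set: R] (fun x => (f x)%:E * (expd q x)%:E)%E.
  by apply: emeasurable_funM => //; exact: measurable_expd.
have f0q q x : 0 < q -> (0 <= (f x)%:E * (expd q x)%:E)%E.
  by move=> q0; rewrite mule_ge0 ?lee_fin//; exact: expd_ge0.
have a0q q x : 0 < q -> (0 <= (f a)%:E * (expd q x)%:E)%E.
  by move=> q0; rewrite mule_ge0 ?lee_fin//; exact: expd_ge0.
have K p q : 0 < p -> 0 < q -> (\int[mu]_x ((f x)%:E * (expd p x)%:E) + (f a)%:E =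
    \int[mu]_x ((f x)%:E * (expd p x)%:E + (f a)%:E * (expd q x)%:E))%E.
  move=> p0 q0; have -> : (\int[mu]_x ((f x)%:E * (expd p x)%:E + (f a)%:E * (expd q x)%:E) =
      \int[mu]_x ((f x)%:E * (expd p x)%:E) + \int[mu]_x ((f a)%:E * (expd q x)%:E))%E.
    apply: ge0_integralD => //; first by move=> x _; exact: f0q.
      exact: mfq.
      by move=> x _; exact: a0q.
      exact: mt.
  congr (_ + _)%E; rewrite ge0_integralZl ?lee_fin//; last 2 first.
    exact: measurable_expd.
    by move=> x _; exact: expd_ge0.
  by rewrite integral_expd// mule1.
have Ks := K s r s0 r0; have Kr := K r s r0 s0.
suff : (\int[mu]_x ((f x)%:E * (expd s x)%:E) + (f a)%:E <=
        \int[mu]_x ((f x)%:E * (expd r x)%:E) + (f a)%:E)%E by rewrite leeD2rE.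
rewrite Ks Kr; apply: ge0_le_integral.
- exact: measurableT.
- by move=> x _; rewrite adde_ge0// ?f0q// a0q.
- exact: (emeasurable_funD (mfq s) (mt _ r)).
- exact: (emeasurable_funD (mfq r) (mt _ s)).
- move=> x _; rewrite -!EFinM -!EFinD lee_fin.
  rewrite -subr_ge0 [X in 0 <= X](_ : _ = (f x - f a) * (expd r x - expd s x)); last by ring.
  have [xa|ax] := leP x a.
    by rewrite mulr_le0// subr_le0 ?fnd//; apply: (cross x).1.
  by rewrite mulr_ge0// subr_ge0 ?fnd ?(ltW ax)//; apply: (cross x).2; exact: ltW.
Qed.

End one_variable.

(** * The corner flip *)

Section burke.
Context {R : realType}.
Local Notation mu := (@lebesgue_measure R).
Local Notation cfg := (@cfg R).
Implicit Types (f g : cfg -> \bar R) (c : cfg) (i j k : site) (r t x : R).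

Lemma updE c i x : upd c i x i = x.
Proof. by rewrite /upd eqxx. Qed.

Lemma upd_neq c i j x : j != i -> upd c i x j = c j.
Proof. by rewrite /upd => /negbTE ->. Qed.

Lemma integrand_comp f (h : cfg -> cfg) : integrand f -> measurable_fun [set: cfg] h ->
  integrand (f \o h).
Proof. by move=> [mf f0] mh; split=> [|c]; [exact: measurableT_comp|exact: f0]. Qed.

Lemma integrand_indicM f (b : cfg -> bool) : integrand f -> measurable_fun [set: cfg] b ->
  integrand (fun c => f c * (b c)%:R%:E)%E.
Proof.
move=> [mf f0] mb; split=> [|c]; last by rewrite mule_ge0.
by apply: emeasurable_funM => //; apply/measurable_EFinP/measurable_indicator.
Qed.

Lemma eq_int1 i r f g c : (forall x, 0 <= x -> f (upd c i x) = g (upd c i x)) ->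
  int1 i r f c = int1 i r g c.
Proof.
move=> fg; apply: eq_integral => x _.
by have [x0|x0] := leP 0 x; [rewrite fg | rewrite expd_lt0// !mule0].
Qed.

(** The level beyond which memorylessness is used is another coordinate of the
configuration: given c j <= c i, the excess of c i over c j is exponential. *)
Lemma int1_memoryless_ge i j r f c : 0 < r -> i != j -> 0 <= c j -> integrand f ->
  int1 i r (fun c => f c * (c j <= c i)%R%:R%:E)%E c =
  ((expR (- r * c j))%:E * int1 i r (fun c => f (upd c i (c i + c j)%R)) c)%E.
Proof.
move=> r0 ij cj gf.
have := @integral_expd_ge _ (fun x => f (upd c i x)) r (c j) r0 cj
  (measurable_comp_upd c i gf.1) (fun x => gf.2 _).
rewrite /int1 => E; transitivity
  (\int[mu]_x (f (upd c i x) * (expd r x * (c j <= x)%R%:R)%:E))%E.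
  apply: eq_integral => x _.
  by rewrite updE upd_neq 1?eq_sym// EFinM -!muleA [X in (_ * X)%E]muleC.
rewrite E; congr (_ * _)%E; apply: eq_integral => x _.
by rewrite updE upd_neq 1?eq_sym// upd_upd.
Qed.

Lemma int1_memoryless_gt i j r f c : 0 < r -> i != j -> 0 <= c j -> integrand f ->
  int1 i r (fun c => f c * (c j < c i)%R%:R%:E)%E c =
  ((expR (- r * c j))%:E * int1 i r (fun c => f (upd c i (c i + c j)%R)) c)%E.
Proof.
move=> r0 ij cj gf.
have := @integral_expd_gt _ (fun x => f (upd c i x)) r (c j) r0 cj
  (measurable_comp_upd c i gf.1) (fun x => gf.2 _).
rewrite /int1 => E; transitivity
  (\int[mu]_x (f (upd c i x) * (expd r x * (c j < x)%R%:R)%:E))%E.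
  apply: eq_integral => x _.
  by rewrite updE upd_neq 1?eq_sym// EFinM -!muleA [X in (_ * X)%E]muleC.
rewrite E; congr (_ * _)%E; apply: eq_integral => x _.
by rewrite updE upd_neq 1?eq_sym// upd_upd.
Qed.

Lemma int1_tilt i r a f c : 0 < r -> 0 < r + a -> integrand f ->
  int1 i r (fun c => (expR (- (a * c i)))%:E * f c)%E c =
  ((r / (r + a))%:E * int1 i (r + a) f c)%E.
Proof.
move=> r0 ra0 gf; rewrite /int1 -ge0_integralZl//; last 3 first.
- exact: int1_measurable gf.1.
- by move=> x _; apply: int1_pos.
- by rewrite lee_fin divr_ge0// ltW.
apply: eq_integral => x _.
by rewrite updE muleAC muleC -EFinM expd_tilt// EFinM muleA [RHS]muleCA muleA.
Qed.

Definition shiftby i j c : cfg := upd c i (c i + c j).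

Lemma measurable_shiftby i j : measurable_fun [set: cfg] (shiftby i j).
Proof.
apply: measurable_upd => //.
by apply: measurable_funD; exact: measurable_coord.
Qed.

(** For independent X ~ Exp(a) at i and Y ~ Exp(b) at j with a + b = 1, the minimum
is Exp(1), is attained by Y with probability b, and given this the excess X - Y is
again Exp(a) and independent of it; and symmetrically.  Each summand stores the
minimum and the excess in the two slots, and [shiftby] restores X and Y. *)
Lemma int1_split i j a b f : 0 < a -> 0 < b -> a + b = 1 -> i != j -> integrand f ->
  int1 i a (int1 j b f) = fun c =>
  (b%:E * int1 j 1 (int1 i a (f \o shiftby i j)) c +
   a%:E * int1 i 1 (int1 j b (f \o shiftby j i)) c)%E.
Proof.
move=> a0 b0 ab ij gf.
have ji : j != i by rewrite eq_sym.
pose f1 c := (f c * (c j <= c i)%R%:R%:E)%E.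
pose f2 c := (f c * (c i < c j)%R%:R%:E)%E.
have g1 : integrand f1.
  by apply: integrand_indicM => //; apply: measurable_fun_ler; exact: measurable_coord.
have g2 : integrand f2.
  by apply: integrand_indicM => //; apply: measurable_fun_ltr; exact: measurable_coord.
have fE : f = (fun c => f1 c + f2 c)%E.
  apply/funext => c; rewrite /f1 /f2 ltNge; case: (_ <= _) => /=.
    by rewrite mule1 mule0 adde0.
  by rewrite mule1 mule0 add0e.
have gs i' j' : integrand (f \o shiftby i' j').
  by apply: integrand_comp => //; exact: measurable_shiftby.
rewrite [in LHS]fE (int1D b0 j g1 g2) (int1D a0)//; [|exact: integrand_int1..].
apply/funext => c; congr (_ + _)%E.
  rewrite (int1C a0 b0 ij g1).
  transitivity (int1 j b (fun c => (expR (- (a * c j)))%:E * int1 i a (f \o shiftby i j) c)%E c).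
    apply: eq_int1 => x x0; rewrite /f1 int1_memoryless_ge ?updE//.
    by rewrite mulNr.
  have ba1 : b + a = 1 by rewrite addrC.
  have ba0 : 0 < b + a by rewrite ba1.
  have := @int1_tilt j b a _ c b0 ba0 (integrand_int1 a0 i (gs i j)).
  by rewrite ba1 divr1.
transitivity (int1 i a (fun c => (expR (- (b * c i)))%:E * int1 j b (f \o shiftby j i) c)%E c).
  apply: eq_int1 => x x0; rewrite /f2 int1_memoryless_gt ?updE//.
  by rewrite mulNr.
have ab0 : 0 < a + b by rewrite ab.
have := @int1_tilt i a b _ c a0 ab0 (integrand_int1 b0 j (gs j i)).
by rewrite ab divr1.
Qed.

(** The cell map of the last passage recursion ([hor_rec], [ver_rec]): i and j hold
the incoming horizontal and vertical increments, k the weight of the cell. *)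
Definition flip i j k c : cfg :=
  upd (upd c i (c k + Num.max (c i - c j) 0)) j (c k + Num.max (c j - c i) 0).

Lemma measurable_flip i j k : measurable_fun [set: cfg] (flip i j k).
Proof.
have mc := @measurable_coord R.
have mm i' j' : measurable_fun [set: cfg] (fun c : cfg => c k + Num.max (c i' - c j') 0).
  apply: measurable_funD => //; apply: measurable_maxr => //.
  exact: measurable_funB.
by do 2?apply: measurable_upd.
Qed.

(** Local Burke property.  By [int1_split] the pair (I, J) consists of a minimum of
law Exp(1) and an excess on a random side.  The flip replaces the minimum by the
weight of the cell, which is independent and has the same law, and keeps the side
and the excess. *)
Lemma int1_flip i j k a b f : 0 < a -> 0 < b -> a + b = 1 ->
    i != j -> i != k -> j != k -> integrand f ->
    (forall c x, f (upd c k x) = f c) ->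
  int1 i a (int1 j b (int1 k 1 (f \o flip i j k))) = int1 i a (int1 j b f).
Proof.
move=> a0 b0 ab ij ik jk gf fk.
have [ji ki kj] : [/\ j != i, k != i & k != j] by rewrite ![_ == i]eq_sym [k == _]eq_sym.
have gflip : integrand (f \o flip i j k) by apply: integrand_comp => //; exact: measurable_flip.
have o0 : 0 < 1 :> R by [].
rewrite (int1_split a0 b0 ab ij gf) (int1_split a0 b0 ab ij (integrand_int1 o0 k gflip)).
(* the case where the coordinate at p is the larger one: the minimum, stored at q,
   is exchanged with the weight at k *)
have swap p q (r : R) c : p != q -> p != k -> q != k -> 0 < r ->
    (forall c, 0 <= c p -> flip i j k (shiftby p q c) =
       upd (upd c p (c k + c p)) q (c k)) ->
    int1 q 1 (int1 p r (int1 k 1 (f \o flip i j k) \o shiftby p q)) c =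
    int1 q 1 (int1 p r (f \o shiftby p q)) c.
  move=> pq pk qk r0 flipE.
  have [qp kp kq] : [/\ q != p, k != p & k != q] by rewrite ![_ == p]eq_sym [k == _]eq_sym.
  have N := (negbTE pq, negbTE pk, negbTE qk, negbTE qp, negbTE kp, negbTE kq).
  pose h c := f (upd (upd c p (c k + c p)) q (c k)).
  have gh : integrand h.
    have mc := @measurable_coord R.
    apply: (@integrand_comp f (fun c => upd (upd c p (c k + c p)) q (c k))) => //.
    apply: measurable_upd => //; apply: measurable_upd => //.
    exact: measurable_funD.
  have E1 : int1 p r (int1 k 1 (f \o flip i j k) \o shiftby p q) = int1 k 1 (int1 p r h).
    rewrite -(int1C r0 o0 pk gh); apply/funext => c'; apply: eq_int1 => x x0 /=.
    rewrite /int1; apply: eq_integral => y _; congr (f _ * _)%E.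
    have -> : upd (shiftby p q (upd c' p x)) k y = shiftby p q (upd (upd c' p x) k y).
      apply/funext => v; rewrite /shiftby /upd ?eqxx ?N.
      by case: (eqVneq v k) => [->|_]; rewrite ?eqxx ?N.
    by rewrite flipE//; rewrite /upd ?N ?eqxx.
  have gG : integrand (int1 k 1 (int1 p r h)) by exact: (integrand_int1 o0 k (integrand_int1 r0 p gh)).
  have iG c' y : int1 k 1 (int1 p r h) (upd c' q y) = int1 k 1 (int1 p r h) c'.
    rewrite /int1; apply: eq_integral => x _; congr (_ * _)%E.
    apply: eq_integral => z _; congr (f _ * _)%E.
    apply/funext => v; rewrite /upd ?eqxx ?N.
    by case: (v == q) => //; case: (v == p).
  rewrite E1 (int1_indep o0 gG iG).
  rewrite /int1; apply: eq_integral => x _; congr (_ * _)%E.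
  apply: eq_integral => z _; congr (_ * _)%E.
  rewrite /h /= /shiftby -(fk (upd (upd (upd c q x) p z) p _) x); congr f.
  apply/funext => v; rewrite /upd ?eqxx ?N.
  case: (eqVneq v p) => [->|vp]; first by rewrite ?N addrC.
  case: (eqVneq v q) => [->|vq]; first by rewrite ?N.
  by case: (eqVneq v k).
have N := (negbTE ij, negbTE ik, negbTE jk, negbTE ji, negbTE ki, negbTE kj).
have H1 c : 0 <= c i ->
    flip i j k (shiftby i j c) = upd (upd c i (c k + c i)) j (c k).
  move=> c0; apply/funext => v; rewrite /flip /shiftby /upd ?eqxx ?N addrK.
  have -> : c j - (c i + c j) = - c i by ring.
  have -> : Num.max (- c i) 0 = 0 by rewrite max_r// oppr_le0.
  have -> : Num.max (c i) 0 = c i by rewrite max_l.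
  rewrite addr0.
  by case: (v == j) => //; case: (v == i).
have H2 c : 0 <= c j ->
    flip i j k (shiftby j i c) = upd (upd c j (c k + c j)) i (c k).
  move=> c0; apply/funext => v; rewrite /flip /shiftby /upd ?eqxx ?N addrK.
  have -> : c i - (c j + c i) = - c j by ring.
  have -> : Num.max (- c j) 0 = 0 by rewrite max_r// oppr_le0.
  have -> : Num.max (c j) 0 = c j by rewrite max_l.
  rewrite addr0.
  by case: (eqVneq v j) => [->|_]; [rewrite ?N|case: (v == i)].
apply/funext => c.
by rewrite (swap i j a c ij ik jk a0 H1) (swap j i b c ji jk ik b0 H2).
Qed.

End burke.

(** * Last passage recursion and exit points *)

Section last_passage_recursion.
Context {R : realType}.
Implicit Types (w : site -> R) (x y a b : nat) (A B C : nat -> nat -> R).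

(** Last passage times from the origin.  The inner recursion runs up a column, as each
of the two predecessors of a site lowers only one coordinate. *)
Fixpoint lpp w (x : nat) : nat -> R :=
  match x with
  | 0 => fix col y := match y with
      | 0 => w (0, 0)%N
      | y'.+1 => col y' + w (0, y'.+1)%N end
  | x'.+1 => fix col y := match y with
      | 0 => lpp w x' 0 + w (x'.+1, 0)%N
      | y'.+1 => Num.max (lpp w x' y'.+1) (col y') + w (x'.+1, y'.+1) end
  end.

Lemma lpp00 w : lpp w 0 0 = w (0, 0)%N. Proof. by []. Qed.
Lemma lpp0S w y : lpp w 0 y.+1 = lpp w 0 y + w (0, y.+1)%N. Proof. by []. Qed.
Lemma lppS0 w x : lpp w x.+1 0 = lpp w x 0 + w (x.+1, 0)%N. Proof. by []. Qed.
Lemma lppSS w x y :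
  lpp w x.+1 y.+1 = Num.max (lpp w x y.+1) (lpp w x.+1 y) + w (x.+1, y.+1).
Proof. by []. Qed.

Arguments lpp : simpl never.

Definition hor A x y := A x.+1 y - A x y.
Definition ver A x y := A x y.+1 - A x y.

(** The values on the axes are left free: [bulk], [via_hor] and [via_ver] are three
solutions of the same recursion, to be compared. *)
Definition lpp_rec w A := forall x y,
  A x.+1 y.+1 = Num.max (A x y.+1) (A x.+1 y) + w (x.+1, y.+1).

Lemma hor_rec w A x y : lpp_rec w A ->
  hor A x y.+1 = w (x.+1, y.+1) + Num.max (hor A x y - ver A x y) 0.
Proof.
move=> rA; rewrite /hor /ver rA [RHS]addrC -addrAC; congr (_ + _).
have -> : A x.+1 y - A x y - (A x y.+1 - A x y) = A x.+1 y - A x y.+1 by ring.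
have [h|h] := leP (A x.+1 y) (A x y.+1); first by rewrite subrr max_r// subr_le0.
by rewrite max_l// subr_ge0 ltW.
Qed.

Lemma ver_rec w A x y : lpp_rec w A ->
  ver A x.+1 y = w (x.+1, y.+1) + Num.max (ver A x y - hor A x y) 0.
Proof.
move=> rA; rewrite /hor /ver rA [RHS]addrC -addrAC; congr (_ + _).
have -> : A x y.+1 - A x y - (A x.+1 y - A x y) = A x y.+1 - A x.+1 y by ring.
have [h|h] := leP (A x.+1 y) (A x y.+1); first by rewrite max_l// subr_ge0.
by rewrite subrr max_r// subr_le0 ltW.
Qed.

(** Each cell is nondecreasing in the incoming increment of its own direction and
nonincreasing in the other, so that opposite orders of the horizontal and vertical
increments propagate from the axes. *)
Lemma increments_compare w A B : lpp_rec w A -> lpp_rec w B ->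
    (forall x, hor A x 0 <= hor B x 0) -> (forall y, ver B 0 y <= ver A 0 y) ->
  forall x y, hor A x y <= hor B x y /\ ver B x y <= ver A x y.
Proof.
move=> rA rB hAB vAB.
suff H x y : (forall a, hor A a y <= hor B a y) -> ver B x y <= ver A x y.
  suff K y x : hor A x y <= hor B x y by move=> x y; split=> //; apply: H.
  elim: y x => [//|y IH] x; rewrite (hor_rec _ _ rA) (hor_rec _ _ rB) lerD2l.
  by rewrite ge_max !le_max lexx orbT andbT lerB// H.
move=> hy; elim: x => [//|x IH]; rewrite (ver_rec _ _ rA) (ver_rec _ _ rB) lerD2l.
by rewrite ge_max !le_max lexx orbT andbT lerB.
Qed.

Definition shift a b w : site -> R := fun u => w (u.1 + a, u.2 + b)%N.

(** Suppressing the column x = 0 forces paths to start along the horizontal axis,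
suppressing the row y = 0 along the vertical one.  The arguments (x, y) are
coordinates of the bulk, whose first cell is (1, 1). *)
Definition bulk w x y := lpp (shift 1 1 w) x y.
Definition via_hor w x y := lpp (shift 1 0 w) x y.+1.
Definition via_ver w x y := lpp (shift 0 1 w) x.+1 y.

Lemma lpp_exit w x y :
  lpp w x.+1 y.+1 = w (0, 0)%N + Num.max (via_hor w x y) (via_ver w x y).
Proof.
rewrite /via_hor /via_ver.
have h0 a : lpp w a.+1 0 = w (0, 0)%N + lpp (shift 1 0 w) a 0.
  elim: a => [|a IH]; first by [].
  by rewrite lppS0 IH -addrA; congr (_ + (_ + w _)); rewrite addn1.
have v0 b : lpp w 0 b.+1 = w (0, 0)%N + lpp (shift 0 1 w) 0 b.
  elim: b => [|b IH]; first by [].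
  by rewrite lpp0S IH -addrA; congr (_ + (_ + w _)); rewrite addn1.
have maxD (a b c d : R) : Num.max (a + b) (a + c) + d = a + (Num.max b c + d).
  by rewrite -addr_maxr addrA.
elim: x y => [|x IHx]; elim=> [|y IHy].
- rewrite lppSS h0 v0 maxD; congr (_ + _).
  rewrite [lpp (shift 1 0 w) 0 1]lpp0S [lpp (shift 0 1 w) 1 0]lppS0.
  by rewrite /shift /= !addn1 !addn0 -addr_maxl maxC.
- rewrite lppSS v0 IHy maxD; congr (_ + _).
  rewrite [lpp (shift 1 0 w) 0 y.+2]lpp0S [lpp (shift 0 1 w) 1 y.+1]lppSS.
  by rewrite /shift /= !addn1 !addn0 -addr_maxl maxCA.
- rewrite lppSS h0 IHx maxD; congr (_ + _).
  rewrite [lpp (shift 1 0 w) x.+1 1]lppSS [lpp (shift 0 1 w) x.+2 0]lppS0.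
  by rewrite /shift /= !addn1 !addn0 -addr_maxl maxAC.
- rewrite lppSS IHx IHy maxD; congr (_ + _).
  rewrite [lpp (shift 1 0 w) x.+1 y.+2]lppSS [lpp (shift 0 1 w) x.+2 y.+1]lppSS.
  by rewrite /shift /= !addn1 !addn0 -addr_maxl maxACA.
Qed.

Lemma bulk_rec w : lpp_rec (shift 1 1 w) (bulk w).
Proof. by []. Qed.

Lemma via_hor_rec w : lpp_rec (shift 1 1 w) (via_hor w).
Proof. by move=> x y; rewrite /via_hor lppSS /shift /= !addn1 !addn0. Qed.

Lemma via_ver_rec w : lpp_rec (shift 1 1 w) (via_ver w).
Proof. by move=> x y; rewrite /via_ver lppSS /shift /= !addn1 !addn0. Qed.

Let addrKl (r s : R) : r + s - r = s. Proof. by rewrite addrC addKr. Qed.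

(** Inside the bulk both functions obey the same recursion; on the first row, the
horizontal axis below can only enlarge horizontal increments. *)
Lemma via_hor_bulk w x y :
  hor (bulk w) x y <= hor (via_hor w) x y /\ ver (via_hor w) x y <= ver (bulk w) x y.
Proof.
apply: (increments_compare (bulk_rec w) (via_hor_rec w)) => [a|b].
  have rL : lpp_rec (shift 1 0 w) (lpp (shift 1 0 w)) by [].
  rewrite -[hor (via_hor w) a 0]/(hor (lpp (shift 1 0 w)) a 1) (hor_rec _ _ rL).
  rewrite /hor /bulk lppS0 addrAC subrr add0r /shift /= addn1 addn0 lerDl.
  by rewrite le_max lexx orbT.
by rewrite /ver /bulk /via_hor !lpp0S !addrKl /shift /= !addn1 !addn0.
Qed.

Lemma via_ver_bulk w x y :
  hor (via_ver w) x y <= hor (bulk w) x y /\ ver (bulk w) x y <= ver (via_ver w) x y.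
Proof.
apply: (increments_compare (via_ver_rec w) (bulk_rec w)) => [a|b].
  by rewrite /hor /bulk /via_ver !lppS0 !addrKl /shift /= !addn1 !addn0.
have rL : lpp_rec (shift 0 1 w) (lpp (shift 0 1 w)) by [].
rewrite -[ver (via_ver w) 0 b]/(ver (lpp (shift 0 1 w)) 1 b) (ver_rec _ _ rL).
rewrite /ver /bulk lpp0S addrAC subrr add0r /shift /= addn1 addn0 lerDl.
by rewrite le_max lexx orbT.
Qed.

(** A step to the right adds at most as much to [via_ver] as to [bulk], and to [bulk]
as to [via_hor]; upwards it is the other way round. *)
Lemma exit_monotone w a b x y : (a <= x)%N -> (y <= b)%N ->
  via_hor w a b - via_ver w a b <= via_hor w x y - via_ver w x y.
Proof.
move=> ax yb; apply: (@le_trans _ _ (via_hor w x b - via_ver w x b)).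
  rewrite -(subnK ax) addnC; elim: (x - a)%N => [|d IH]; first by rewrite addn0.
  apply: le_trans IH _; rewrite addnS.
  have [h1 _] := via_hor_bulk w (a + d) b; have [h2 _] := via_ver_bulk w (a + d) b.
  by move: (le_trans h2 h1); rewrite /hor; lra.
rewrite -(subnK yb) addnC; elim: (b - y)%N => [|d IH]; first by rewrite addn0.
apply: le_trans IH; rewrite addnS.
have [_ h1] := via_hor_bulk w x (y + d); have [_ h2] := via_ver_bulk w x (y + d).
by move: (le_trans h1 h2); rewrite /ver; lra.
Qed.

(** By [exit_monotone] the horizontal exit at (a, b) persists to the right and below,
where [lpp] then has the increments of [via_hor]. *)
Lemma exit_hor w a b : via_ver w a b <= via_hor w a b ->
  (forall x y, (a <= x)%N -> (y <= b)%N ->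
     hor (bulk w) x y <= hor (lpp w) x.+1 y.+1) /\
  (forall x y, (a <= x)%N -> (y.+1 <= b)%N ->
     ver (lpp w) x.+1 y.+1 <= ver (bulk w) x y).
Proof.
move=> ab.
have E x y : (a <= x)%N -> (y <= b)%N -> lpp w x.+1 y.+1 = w (0, 0)%N + via_hor w x y.
  move=> ax yb; rewrite lpp_exit max_l// -subr_ge0.
  by apply: le_trans (exit_monotone w ax yb); rewrite subr_ge0.
have D (r s t : R) : (r + s) - (r + t) = s - t by ring.
split=> x y ax yb.
  rewrite /(hor (lpp w)) !E// ?D ?(leqW ax)//.
  exact: (via_hor_bulk w x y).1.
rewrite /(ver (lpp w)) !E// ?D ?(ltnW yb)//.
exact: (via_hor_bulk w x y).2.
Qed.

Lemma exit_ver w a b : via_hor w a b <= via_ver w a b ->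
  (forall x y, (x.+1 <= a)%N -> (b <= y)%N ->
     hor (lpp w) x.+1 y.+1 <= hor (bulk w) x y) /\
  (forall x y, (x <= a)%N -> (b <= y)%N ->
     ver (bulk w) x y <= ver (lpp w) x.+1 y.+1).
Proof.
move=> ab.
have E x y : (x <= a)%N -> (b <= y)%N -> lpp w x.+1 y.+1 = w (0, 0)%N + via_ver w x y.
  move=> ax yb; rewrite lpp_exit max_r// -subr_le0.
  by apply: le_trans (exit_monotone w ax yb) _; rewrite subr_le0.
have D (r s t : R) : (r + s) - (r + t) = s - t by ring.
split=> x y ax yb.
  rewrite /(hor (lpp w)) !E// ?D ?(ltnW ax)//.
  exact: (via_ver_bulk w x y).1.
rewrite /(ver (lpp w)) !E// ?D ?(leqW yb)//.
exact: (via_ver_bulk w x y).2.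
Qed.

(** All paths have the same endpoint (m, n), which becomes the origin when directions
are reversed. *)
Lemma last_passage_lpp w m n i j : (i <= m)%N -> (j <= n)%N ->
  last_passage w (i, j) (m, n) =
  (lpp (fun u => w (m - u.1, n - u.2)%N) (m - i) (n - j))%:E.
Proof.
set v := fun u : site => _.
have ub s u : path up_right_step u s -> last u s = (m, n) ->
    [/\ (u.1 <= m)%N, (u.2 <= n)%N &
    \sum_(x <- u :: s) w x <= lpp v (m - u.1) (n - u.2)].
  elim: s u => [|u' s IH] u /=.
    by move=> _ ->; rewrite !leqnn !subnn big_seq1 lpp00 /v /= !subn0; split.
  case/andP=> st ps ls; have [um un le] := IH u' ps ls.
  rewrite big_cons; case/orP: st => /eqP eu; rewrite eu /= in um un le.
    have -> : (m - u.1 = (m - u.1.+1).+1)%N by rewrite subnSK.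
    split=> //; first exact: ltnW.
    have wv b : v ((m - u.1.+1).+1, b) = w (u.1, n - b)%N.
      by rewrite /v /= subnSK// subKn// ltnW.
    case E : (n - u.2)%N => [|b].
      rewrite lppS0 wv subn0 addrC; have -> : n = u.2 by apply/eqP; rewrite eqn_leq un andbT -subn_eq0 E.
      by rewrite -surjective_pairing lerD2r; move: le; rewrite eu E.
    rewrite lppSS wv -E subKn// addrC -surjective_pairing lerD2r le_max.
    by move: le; rewrite eu E => ->.
  have -> : (n - u.2 = (n - u.2.+1).+1)%N by rewrite subnSK.
  split=> //; first exact: ltnW.
  have wv b : v (b, (n - u.2.+1).+1) = w (m - b, u.2)%N.
    by rewrite /v /= subnSK// subKn// ltnW.
  case E : (m - u.1)%N => [|b].
    rewrite lpp0S wv subn0 addrC; have -> : m = u.1 by apply/eqP; rewrite eqn_leq um andbT -subn_eq0 E.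
    by rewrite -surjective_pairing lerD2r; move: le; rewrite eu E.
  rewrite lppSS wv -E subKn// addrC -surjective_pairing lerD2r le_max.
  by move: le; rewrite eu E => ->; rewrite orbT.
have att a b : (a <= m)%N -> (b <= n)%N -> exists s,
    [/\ path up_right_step (m - a, n - b)%N s, last (m - a, n - b)%N s = (m, n) &
      \sum_(x <- (m - a, n - b)%N :: s) w x = lpp v a b].
  have stepH a' b' : (a' < m)%N -> up_right_step (m - a'.+1, b')%N (m - a', b')%N.
    by move=> am; rewrite /up_right_step /= subnSK// eqxx.
  have stepV a' b' : (b' < n)%N -> up_right_step (a', n - b'.+1)%N (a', n - b')%N.
    by move=> bn; rewrite /up_right_step /= subnSK// eqxx orbT.
  elim: a b => [|a IHa]; elim=> [|b IHb] am bn.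
  - by exists [::]; rewrite !subn0 big_seq1 /= lpp00 /v /= !subn0.
  - have [s [ps ls es]] := IHb am (ltnW bn).
    exists ((m - 0, n - b)%N :: s); split=> //=; first by rewrite stepV.
    by rewrite big_cons es lpp0S addrC.
  - have [s [ps ls es]] := IHa 0%N (ltnW am) bn.
    exists ((m - a, n - 0)%N :: s); split=> //=; first by rewrite stepH.
    by rewrite big_cons es lppS0 addrC.
  - rewrite lppSS; case: (leP (lpp v a b.+1) (lpp v a.+1 b)) => _.
    + have [s [ps ls es]] := IHb am (ltnW bn).
      exists ((m - a.+1, n - b)%N :: s); split=> //=; first by rewrite stepV.
      by rewrite big_cons es addrC.
    + have [s [ps ls es]] := IHa b.+1 (ltnW am) bn.
      exists ((m - a, n - b.+1)%N :: s); split=> //=; first by rewrite stepH.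
      by rewrite big_cons es addrC.
move=> im jn; apply/eqP; rewrite eq_le; apply/andP; split.
  apply: ge_ereal_sup => _ [_ [s [-> ps ls]] <-]; rewrite lee_fin.
  by have [] := ub s _ ps ls.
apply: ereal_sup_ubound.
have [s [ps ls es]] := att _ _ (leq_subr i m) (leq_subr j n).
rewrite !subKn// in ps ls es.
by exists ((i, j) :: s); [exists s | rewrite es].
Qed.

End last_passage_recursion.

(** * Burke property of the grid and Laplace transform of the last passage time *)

Section stationary_grid.
Context {R : realType}.
Local Notation mu := (@lebesgue_measure R).
Local Notation cfg := (@cfg R).
Implicit Types (f g h : cfg -> \bar R) (c : cfg) (i j k u : site) (rate : site -> R) (s D : seq site).

Definition indep_of f i := forall c x, f (upd c i x) = f c.

Lemma int1_indep_of i j r f : i != j -> indep_of f i -> indep_of (int1 j r f) i.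
Proof.
move=> ij fi c x; apply: eq_integral => y _; congr (_ * _)%E.
by rewrite updC// fi.
Qed.

Lemma int1_indep_self i r f : indep_of (int1 i r f) i.
Proof. by move=> c x; apply: eq_integral => y _; rewrite upd_upd. Qed.

Lemma expect_indep_of rate s f i : (i \notin s -> indep_of f i) ->
  indep_of (expect rate s f) i.
Proof.
elim: s => [|j s IH] /= fi; first exact: fi.
have [->|ij] := eqVneq i j; first exact: int1_indep_self.
apply: int1_indep_of => //; apply: IH => js; apply: fi.
by rewrite inE negb_or ij.
Qed.

(** Any site of the list can be integrated first. *)
Lemma expect_pull rate s i : (forall u, 0 < rate u) -> i \in s -> exists s',
  (forall j, j \in s -> j != i -> j \in s') /\
  forall f, integrand f -> expect rate s f = expect rate s' (int1 i (rate i) f).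
Proof.
move=> r0 /path.splitPr[s1 s2]; exists (s1 ++ s2); split.
  by move=> j; rewrite !mem_cat inE => /or3P[->//|->//|->]; rewrite orbT.
move=> f gf; rewrite expect_cat -cat1s (expect_catC r0 _ _ gf).
by rewrite expect_cat -expect_cat.
Qed.

Lemma eq_expect rate rate' s f : {in s, rate =1 rate'} ->
  expect rate s f = expect rate' s f.
Proof.
elim: s => [//|i s IH] e; rewrite /= IH.
  by rewrite (e i (mem_head _ _)).
by move=> j js; apply: e; rewrite inE js orbT.
Qed.

Lemma expect_factor rate s (k : cfg -> R) f : (forall u, 0 < rate u) -> integrand f ->
    (forall c, 0 <= k c) -> (forall i, i \in s -> forall c x, k (upd c i x) = k c) ->
  expect rate s (fun c => (k c)%:E * f c)%E = (fun c => (k c)%:E * expect rate s f c)%E.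
Proof.
move=> r0 gf k0; elim: s => //= i s IH ki.
rewrite IH; last by move=> j js; apply: ki; rewrite inE js orbT.
by rewrite (int1Z (r0 i) (integrand_expect r0 s gf) k0 (ki i (mem_head _ _))).
Qed.

(** At each site of D the factor expR (- a * x) turns Exp(r) into Exp(r + a), up to
the constant r / (r + a). *)
Lemma expect_tilt D s (r a : R) rate rate' h : uniq D -> {in D, forall i, i \notin s} ->
    0 < r -> 0 < r + a -> (forall u, 0 < rate u) -> (forall u, 0 < rate' u) ->
    {in s, rate =1 rate'} -> {in D, forall i, rate i = r} -> {in D, forall i, rate' i = r + a} ->
    integrand h ->
  expect rate (D ++ s) (fun c => (expR (- (a * \sum_(i <- D) c i)))%:E * h c)%E =
  (fun c => ((r / (r + a)) ^+ size D)%:E * expect rate' (D ++ s) h c)%E.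
Proof.
move=> uD Ds r0 ra0 rp rp' ss Dr Dr' gh; rewrite expect_cat expect_factor//; last first.
  move=> i is_ c x; congr (expR (- (a * _))); apply: eq_big_seq => j jD.
  by rewrite upd_neq//; apply: contraNneq (Ds j jD) => ->.
rewrite expect_cat (eq_expect _ ss).
have : integrand (expect rate' s h) by exact: integrand_expect.
move: (expect rate' s h) => {}h {}gh.
elim: D h gh uD Dr Dr' {Ds} => [|i D IH] h gh /=.
  by move=> _ _ _; apply/funext => c; rewrite big_nil mulr0 oppr0 expR0 !mul1e.
move=> /andP[iD uD] Dr Dr'.
have -> : (fun c => (expR (- (a * \sum_(i0 <- i :: D) c i0)))%:E * h c)%E =
    (fun c => (expR (- (a * c i)))%:E * ((expR (- (a * \sum_(i0 <- D) c i0)))%:E * h c))%E.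
  apply/funext => c; rewrite big_cons muleA -EFinM -expRD; congr ((expR _)%:E * _)%E; ring.
have mc := @measurable_coord R.
have g1 : integrand (fun c => (expR (- (a * \sum_(i0 <- D) c i0)))%:E * h c)%E.
  split; last by move=> c; rewrite mule_ge0 ?lee_fin ?expR_ge0// gh.2.
  apply: emeasurable_funM; last exact: gh.1.
  apply/measurable_EFinP; apply: measurableT_comp => //.
  apply: measurableT_comp => //; apply: measurable_funM => //.
  by apply: measurable_sum => u; exact: mc.
rewrite (expect_factor rp g1) ; last 2 first.
- by move=> c; exact: expR_ge0.
- by move=> j jD c x; rewrite upd_neq//; apply: contraNneq iD => ->.
rewrite IH//; last 2 first.
- by move=> j jD; apply: Dr; rewrite inE jD orbT.
- by move=> j jD; apply: Dr'; rewrite inE jD orbT.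
have gE := integrand_expect rp' D gh.
have q0 : 0 <= (r / (r + a)) ^+ size D by rewrite exprn_ge0// divr_ge0// ltW.
rewrite (Dr i (mem_head _ _)) (Dr' i (mem_head _ _)).
apply/funext => c.
have g2 : integrand (fun c => ((r / (r + a)) ^+ size D)%:E * expect rate' D h c)%E.
  split; last by move=> c'; rewrite mule_ge0// gE.2.
  by apply: measurable_funeM; exact: gE.1.
rewrite (@int1_tilt _ i r a _ c r0 ra0 g2).
rewrite (int1Z ra0 gE (k := fun=> _))//.
by rewrite muleA -EFinM exprS.
Qed.

Lemma expect_prod (A : eqType) rate (l : seq A) (sigma : A -> site) (g : A -> R -> R) :
    uniq (map sigma l) -> (forall u, 0 < rate u) ->
    (forall a, measurable_fun [set: R] (g a)) -> (forall a x, 0 <= g a x) ->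
    (forall a, \int[mu]_x ((g a x)%:E * (expd (rate (sigma a)) x)%:E) \is a fin_num)%E ->
  expect rate (map sigma l) (fun c => (\prod_(a <- l) g a (c (sigma a)))%:E) =
  cst (\prod_(a <- l) fine (\int[mu]_x ((g a x)%:E * (expd (rate (sigma a)) x)%:E)))%:E.
Proof.
move=> uD rp mg g0 gfin; have mc := @measurable_coord R.
have gP l' : integrand (fun c => (\prod_(a <- l') g a (c (sigma a)))%:E).
  split; last by move=> c; rewrite lee_fin prodr_ge0.
  apply/measurable_EFinP; apply: measurable_prod => a _.
  exact: (measurableT_comp (mg a) (mc (sigma a))).
elim: l uD => [|a l IH] /=; first by move=> _; apply/funext => c; rewrite !big_nil.
move=> /andP[al ul].
have -> : (fun c => (\prod_(b <- a :: l) g b (c (sigma b)))%:E) =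
   (fun c => (g a (c (sigma a)))%:E * (\prod_(b <- l) g b (c (sigma b)))%:E)%E.
  by apply/funext => c; rewrite big_cons EFinM.
rewrite (expect_factor rp (gP l)); last 2 first.
- by move=> c; exact: g0.
- by move=> j jD c x; rewrite upd_neq//; apply: contraNneq al => ->.
rewrite IH//; apply/funext => c; rewrite /int1 big_cons EFinM fineK//.
set q := \prod_(b <- l) _.
have q0 : 0 <= q by apply: prodr_ge0 => j _; apply: fine_ge0;
  apply: integral_ge0 => x _; rewrite mule_ge0 ?lee_fin ?g0//; exact: expd_ge0.
under eq_integral do rewrite updE muleAC.
rewrite ge0_integralZr//.
- apply: emeasurable_funM; last exact: measurable_expd.
  by apply/measurable_EFinP; exact: mg.
- by move=> x _; rewrite mule_ge0 ?lee_fin ?g0//; exact: expd_ge0.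
Qed.

(** Reduces the expectation of a function of the coordinates in D to D. *)
Lemma expect_sub rate S D : uniq D -> {subset D <= S} -> (forall u, 0 < rate u) -> exists S',
  forall f, integrand f -> expect rate S f = expect rate S' (expect rate D f).
Proof.
move=> uD; elim: D uD S => [|i D IH] /= uD S DS rp; first by exists S.
case/andP: uD => iD uD.
have [S1 [S1m S1E]] := expect_pull rp (DS i (mem_head _ _)).
have DS1 : {subset D <= S1}.
  move=> j jD; apply: S1m; first by apply: DS; rewrite inE jD orbT.
  by apply: contraNneq iD => <-.
have [S2 S2E] := IH uD S1 DS1 rp.
exists S2 => f gf; rewrite S1E// S2E; last exact: integrand_int1.
rewrite -[int1 i (rate i) f]/(expect rate [:: i] f) -[int1 i _ _]/(expect rate [:: i] _).
by congr (expect rate S2 _); rewrite -!expect_cat (expect_catC rp D [:: i] gf).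
Qed.

(** The axes serve as memory: the slot (x + 1, 0) holds the horizontal increment in
column x at the current height, the slot (0, y + 1) the vertical increment in row y
at the current column.  Flipping the cells of a row from left to right moves the
horizontal slots up by one and carries the vertical slot to the right end. *)
Definition flip_cell (x y : nat) : cfg -> cfg := flip (x.+1, 0)%N (0, y.+1)%N (x.+1, y.+1).

Fixpoint flip_row (y x : nat) : cfg -> cfg :=
  match x with 0 => id | x'.+1 => flip_cell x' y \o flip_row y x' end.

Fixpoint flip_rows (m y : nat) : cfg -> cfg :=
  match y with 0 => id | y'.+1 => flip_row y' m \o flip_rows m y' end.

Definition hor_slots m : seq site := [seq (x.+1, 0)%N | x <- iota 0 m].
Definition ver_slots n : seq site := [seq (0, y.+1)%N | y <- iota 0 n].
Definition cells m n : seq site := [seq (x.+1, y.+1) | x <- iota 0 m, y <- iota 0 n].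
Definition grid m n := hor_slots m ++ ver_slots n ++ cells m n.

Definition grid_rate (a b : R) : site -> R :=
  fun u => if u.2 == 0%N then a else if u.1 == 0%N then b else 1.

Lemma grid_rate_gt0 a b u : 0 < a -> 0 < b -> 0 < grid_rate a b u.
Proof. by rewrite /grid_rate; case: ifP => // _; case: ifP. Qed.

Lemma mem_hor_slots m x : (x < m)%N -> (x.+1, 0)%N \in hor_slots m.
Proof. by move=> xm; apply: map_f; rewrite mem_iota. Qed.

Lemma mem_ver_slots n y : (y < n)%N -> (0, y.+1)%N \in ver_slots n.
Proof. by move=> xm; apply: (@map_f _ _ (fun y => (0, y.+1)%N)); rewrite mem_iota. Qed.

Lemma mem_cells m n x y : (x < m)%N -> (y < n)%N -> (x.+1, y.+1) \in cells m n.
Proof. by move=> xm yn; apply/allpairsP; exists (x, y); rewrite !mem_iota. Qed.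

Lemma measurable_flip_cell x y : measurable_fun [set: cfg] (flip_cell x y).
Proof. exact: measurable_flip. Qed.

Lemma flip_cell_upd x y a b c v : (a, b) != (x, y) ->
  flip_cell x y (upd c (a.+1, b.+1) v) = upd (flip_cell x y c) (a.+1, b.+1) v.
Proof.
move=> ab.
have n1 : (x.+1, y.+1) != (a.+1, b.+1).
  by rewrite xpair_eqE !eqSS -xpair_eqE eq_sym.
have n2 : (x.+1, 0)%N != (a.+1, b.+1) by rewrite xpair_eqE andbF.
have n3 : (0, y.+1)%N != (a.+1, b.+1) by [].
rewrite /flip_cell /flip !upd_neq//; apply/funext => u; rewrite /upd.
case: (eqVneq u (a.+1, b.+1)) => [->|//].
by rewrite ![(a.+1, b.+1) == _]eq_sym (negbTE n2) (negbTE n3).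
Qed.

(** After the flip the weight of the cell is correlated with the increments, so f must
not read it again. *)
Lemma expect_flip_cell m n a b x y f : 0 < a -> 0 < b -> a + b = 1 ->
    (x < m)%N -> (y < n)%N -> integrand f -> indep_of f (x.+1, y.+1) ->
  expect (grid_rate a b) (grid m n) (f \o flip_cell x y) = expect (grid_rate a b) (grid m n) f.
Proof.
move=> a0 b0 ab xm yn gf fi.
have rp u := grid_rate_gt0 u a0 b0.
have m1 : (x.+1, y.+1) \in grid m n by rewrite !mem_cat mem_cells// !orbT.
have m2 : (0, y.+1)%N \in grid m n by rewrite !mem_cat mem_ver_slots// !orbT.
have m3 : (x.+1, 0)%N \in grid m n by rewrite !mem_cat mem_hor_slots.
have [s1 [s1m s1E]] := expect_pull rp m1.
have n1 : (x.+1, 0)%N != (x.+1, y.+1) by rewrite xpair_eqE andbF.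
have [s2 [s2m s2E]] := expect_pull rp (s1m _ m2 isT).
have [s3 [s3m s3E]] := expect_pull rp (s2m _ (s1m _ m3 n1) isT).
have e1 : grid_rate a b (x.+1, y.+1) = 1 by [].
have e2 : grid_rate a b (0, y.+1)%N = b by [].
have e3 : grid_rate a b (x.+1, 0)%N = a by [].
rewrite e1 in s1E; rewrite e2 in s2E; rewrite e3 in s3E.
have E g : integrand g -> expect (grid_rate a b) (grid m n) g =
  expect (grid_rate a b) s3 (int1 (x.+1, 0)%N a (int1 (0, y.+1)%N b (int1 (x.+1, y.+1) 1 g))).
  move=> gg; have gg1 := integrand_int1 ltr01 (x.+1, y.+1) gg.
  have gg2 := integrand_int1 b0 (0, y.+1)%N gg1.
  by rewrite (s1E _ gg) (s2E _ gg1) (s3E _ gg2).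
have gF : integrand (f \o flip_cell x y) by apply: integrand_comp => //; exact: measurable_flip_cell.
rewrite (E _ gF) (E _ gf) (int1_indep ltr01 gf fi).
have n2 : (x.+1, 0)%N != (0, y.+1)%N by [].
have n3 : (0, y.+1)%N != (x.+1, y.+1) by [].
by rewrite -(int1_flip a0 b0 ab n2 n1 n3 gf fi).
Qed.

Lemma measurable_flip_row y x : measurable_fun [set: cfg] (flip_row y x).
Proof.
elim: x => [|x IH] /=; first exact: measurable_id.
by apply: measurableT_comp => //; exact: measurable_flip_cell.
Qed.

Lemma flip_row_upd y x a b c v : (b != y) || (x <= a)%N ->
  flip_row y x (upd c (a.+1, b.+1) v) = upd (flip_row y x c) (a.+1, b.+1) v.
Proof.
elim: x => //= x IH h; rewrite IH; last first.
  by case/orP: h => [->//|/ltnW ->]; rewrite orbT.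
rewrite flip_cell_upd// xpair_eqE; case/orP: h => [/negbTE->|xa]; first by rewrite andbF.
by rewrite (gtn_eqF xa).
Qed.

Lemma indep_of_comp f (F : cfg -> cfg) i : indep_of f i ->
  (forall c x, F (upd c i x) = upd (F c) i x) -> indep_of (f \o F) i.
Proof. by move=> fi Fi c x /=; rewrite Fi fi. Qed.

Section burke_grid.
Variables (a b : R).
Hypotheses (a0 : 0 < a) (b0 : 0 < b) (ab : a + b = 1).
Local Notation E m n := (expect (grid_rate a b) (grid m n)).

Lemma expect_flip_row m n y x f : (x <= m)%N -> (y < n)%N -> integrand f ->
    (forall p, (p < x)%N -> indep_of f (p.+1, y.+1)) ->
  E m n (f \o flip_row y x) = E m n f.
Proof.
move=> + yn; elim: x f => [//|x IH] f xm gf fi.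
have gF : integrand (f \o flip_cell x y) by apply: integrand_comp => //; exact: measurable_flip_cell.
rewrite -[f \o flip_row y x.+1]/((f \o flip_cell x y) \o flip_row y x).
rewrite (IH _ (ltnW xm) gF) ?(expect_flip_cell a0 b0 ab xm yn gf)//; first exact: fi.
move=> p px; apply: indep_of_comp; first by apply: fi; rewrite ltnS ltnW.
by move=> c v; rewrite flip_cell_upd// xpair_eqE (ltn_eqF px).
Qed.

(** Burke property of the grid: after all flips the slots hold the increments along the
far sides ([flip_rowsE]), and their law is the one of the axes. *)
Lemma expect_flip_rows m n y f : (y <= n)%N -> integrand f ->
    (forall p q, (q < y)%N -> indep_of f (p.+1, q.+1)) ->
  E m n (f \o flip_rows m y) = E m n f.
Proof.
elim: y f => [//|y IH] f yn gf fi.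
have gF : integrand (f \o flip_row y m) by apply: integrand_comp => //; exact: measurable_flip_row.
rewrite -[f \o flip_rows m y.+1]/((f \o flip_row y m) \o flip_rows m y).
rewrite (IH _ (ltnW yn) gF) ?(expect_flip_row (leqnn m) yn gf)//.
  by move=> p pm; exact: fi.
move=> p q qy; apply: indep_of_comp; first by apply: fi; rewrite ltnS ltnW.
by move=> c v; rewrite flip_row_upd// (ltn_eqF qy).
Qed.

End burke_grid.

(** Loop invariant of the sweep through row y, the x leftmost cells being done. *)
Lemma flip_rowE m (c0 : site -> R) c y x :
  (forall p, (p < m)%N -> c (p.+1, 0)%N = hor (lpp c0) p y) ->
  c (0, y.+1)%N = ver (lpp c0) 0 y ->
  (forall p, c (p.+1, y.+1) = c0 (p.+1, y.+1)) -> (x <= m)%N ->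
  [/\ forall p, (p < m)%N -> flip_row y x c (p.+1, 0)%N =
        hor (lpp c0) p (if (p < x)%N then y.+1 else y),
      flip_row y x c (0, y.+1)%N = ver (lpp c0) x y,
      forall q, q != y -> flip_row y x c (0, q.+1)%N = c (0, q.+1)%N &
      forall p q, flip_row y x c (p.+1, q.+1) = c (p.+1, q.+1)].
Proof.
move=> H1 H2 H3; elim: x => [_|x IH xm] //=.
have [I1 I2 I3 I4] := IH (ltnW xm).
have rL : lpp_rec c0 (lpp c0) by [].
set c' := flip_row y x c in I1 I2 I3 I4 *.
have n1 : (0, y.+1)%N != (x.+1, 0)%N by [].
split.
- move=> p pm; rewrite ltnS /flip_cell /flip upd_neq//.
  rewrite /upd xpair_eqE eqxx andbT eqSS; have [->|px] := eqVneq p x.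
    by rewrite leqnn (hor_rec _ _ rL) I4 I2 H3 I1// ltnn.
  by rewrite leq_eqVlt (negbTE px)/= I1.
- by rewrite /flip_cell /flip updE (ver_rec _ _ rL) I4 I2 H3 I1// ltnn.
- by move=> q qy; rewrite /flip_cell /flip !upd_neq// ?I3// xpair_eqE.
- by move=> p q; rewrite /flip_cell /flip !upd_neq// ?xpair_eqE ?andbF.
Qed.

Lemma flip_rowsE m c y :
  [/\ forall p, (p < m)%N -> flip_rows m y c (p.+1, 0)%N = hor (lpp c) p y,
      forall q, flip_rows m y c (0, q.+1)%N = ver (lpp c) (if (q < y)%N then m else 0) q &
      forall p q, flip_rows m y c (p.+1, q.+1) = c (p.+1, q.+1)].
Proof.
have D (r s : R) : r + s - r = s by rewrite addrC addKr.
elim: y => [|y [I1 I2 I3]] /=.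
  by split=> // *; rewrite /hor /ver ?lppS0 ?lpp0S D.
set c' := flip_rows m y c in I1 I2 I3 *.
have I2y : c' (0, y.+1)%N = ver (lpp c) 0 y by rewrite I2 ltnn.
have [J1 J2 J3 J4] := flip_rowE I1 I2y (fun p => I3 p y) (leqnn m).
split.
- by move=> p pm; rewrite J1// pm.
- move=> q; rewrite ltnS; have [->|qy] := eqVneq q y; first by rewrite leqnn.
  by rewrite J3// I2 [(q <= y)%N]leq_eqVlt (negbTE qy).
- by move=> p q; rewrite J4.
Qed.

Lemma measurable_lpp (p q x y : nat) :
  measurable_fun [set: cfg] (fun c : cfg => lpp (shift p q c) x y : R).
Proof.
have mc u : measurable_fun [set: cfg] (fun c : cfg => shift p q c u : R).
  exact: measurable_coord.
elim: x y => [|x IHx]; elim=> [|y IHy].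
- exact: mc.
- by apply: measurable_funD; [exact: IHy | exact: mc].
- by apply: measurable_funD; [exact: IHx | exact: mc].
- apply: measurable_funD; last exact: mc.
  by apply: measurable_maxr; [exact: IHx | exact: IHy].
Qed.

Lemma shift00 (w : site -> R) : shift 0 0 w = w.
Proof. by apply/funext => -[p q]; rewrite /shift /= !addn0. Qed.

Lemma measurable_lpp0 x y : measurable_fun [set: cfg] (fun c : cfg => lpp c x y : R).
Proof.
have -> : (fun c : cfg => lpp c x y : R) = (fun c => lpp (shift 0 0 c) x y).
  by apply/funext => c; rewrite shift00.
exact: measurable_lpp.
Qed.

Lemma sum_hor_slots (w : site -> R) m n :
  \sum_(i <- hor_slots m) (fun u => hor (lpp w) u.1.-1 n) i = lpp w m n - lpp w 0 n.
Proof.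
rewrite big_map /=; elim: m => [|m IH]; first by rewrite big_nil subrr.
by rewrite -addn1 iotaD big_cat big_seq1 IH /hor /= add0n addn1 addrAC addrCA subrr addr0.
Qed.

Lemma lpp0_ver_slots (w : site -> R) n :
  lpp w 0 n = w (0, 0)%N + \sum_(i <- ver_slots n) w i.
Proof.
rewrite big_map; elim: n => [|n IH]; first by rewrite big_nil addr0.
by rewrite lpp0S IH -addn1 iotaD big_cat big_seq1 addrA add0n addn1.
Qed.

Lemma uniq_hor_slots m : uniq (hor_slots m).
Proof. by rewrite map_inj_uniq ?iota_uniq// => x y []. Qed.

Lemma uniq_ver_slots n : uniq (ver_slots n).
Proof. by rewrite map_inj_uniq ?iota_uniq// => x y []. Qed.

Lemma hor_slotsP m u : u \in hor_slots m -> u.2 = 0%N /\ (0 < u.1)%N.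
Proof. by case/mapP => x _ ->. Qed.

Lemma ver_slotsP n u : u \in ver_slots n -> u.1 = 0%N /\ (0 < u.2)%N.
Proof. by case/mapP => x _ ->. Qed.

Lemma cellsP m n u : u \in cells m n -> (0 < u.1)%N /\ (0 < u.2)%N.
Proof. by case/allpairsP => -[x y] [_ _ ->]. Qed.

Lemma integrand_expR (k : cfg -> R) : measurable_fun [set: cfg] k ->
  integrand (fun c => (expR (k c))%:E).
Proof.
move=> mk; split; last by move=> c; rewrite lee_fin expR_ge0.
by apply/measurable_EFinP; apply: measurableT_comp.
Qed.

Lemma integrand1 : integrand (fun _ : cfg => 1%E).
Proof. by split=> // c; rewrite lee_fin. Qed.

(** Under the rates (z, 1 - z) compute the expectation of exp ((z - v) S) twice, where
S is the sum of the horizontal increments along the north side.  By the Burke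
property these are independent Exp(z), which gives (z / v)^m.  On the other hand
S is the last passage time minus the sum of the vertical axis, and tilting by the
latter changes the vertical rate from 1 - z to 1 - v. *)
Lemma mgf_stationary m n (z v : R) c : 0 < z -> z < 1 -> 0 < v -> v < 1 ->
  expect (grid_rate z (1 - v)) (grid m n)
    (fun c => (expR ((z - v) * (lpp c m n - c (0, 0)%N)))%:E) c =
  ((z / v) ^+ m * ((1 - v) / (1 - z)) ^+ n)%:E.
Proof.
move=> z0 z1 v0 v1.
have z10 : 0 < 1 - z by rewrite subr_gt0.
have v10 : 0 < 1 - v by rewrite subr_gt0.
have rp1 u := grid_rate_gt0 u z0 z10.
have rp2 u := grid_rate_gt0 u z0 v10.
have rp3 u := grid_rate_gt0 u v0 z10.
have mc := @measurable_coord R.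
have msum s : measurable_fun [set: cfg] (fun c : cfg => \sum_(i <- s) c i : R).
  by apply: measurable_sum => u; exact: mc.
pose f c := (expR (- ((v - z) * \sum_(i <- hor_slots m) c i)))%:E.
have gf : integrand f.
  by apply: integrand_expR; apply: measurableT_comp => //; exact: measurable_funM.
pose h (c : cfg) := (expR ((z - v) * (lpp c m n - c (0, 0)%N)))%:E.
have gh : integrand h.
  apply: integrand_expR; apply: measurable_funM => //; apply: measurable_funB => //.
  exact: measurable_lpp0.
have E1 : expect (grid_rate z (1 - z)) (grid m n) f = cst ((z / v) ^+ m)%:E.
  have zv : z + (v - z) = v by rewrite addrC subrK.
  have -> : f = (fun c => (expR (- ((v - z) * \sum_(i <- hor_slots m) c i)))%:E * 1)%E.
    by apply/funext => c'; rewrite mule1.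
  rewrite (@expect_tilt (hor_slots m) (ver_slots n ++ cells m n) z (v - z)
    (grid_rate z (1 - z)) (grid_rate v (1 - z))) ?zv ?uniq_hor_slots//.
  - apply/funext => c'; rewrite (expect_indep _ integrand1)// mule1.
    by rewrite size_map size_iota.
  - move=> i /hor_slotsP[i2 i1]; rewrite mem_cat negb_or; apply/andP; split.
      by apply: contraL i1 => /ver_slotsP[->].
    by apply/negP => /cellsP[_]; rewrite i2.
  - move=> i; rewrite mem_cat /grid_rate => /orP[/ver_slotsP[_]|/cellsP[_]];
      by case: (i.2).
  - by move=> i /hor_slotsP[i2 _]; rewrite /grid_rate i2.
  - by move=> i /hor_slotsP[i2 _]; rewrite /grid_rate i2.
have E2 : expect (grid_rate z (1 - z)) (grid m n) f =
    (fun c => (((1 - z) / (1 - v)) ^+ n)%:E *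
      expect (grid_rate z (1 - v)) (grid m n) h c)%E.
  have zz : z + (1 - z) = 1 by rewrite addrC subrK.
  rewrite -(expect_flip_rows z0 z10 zz m (leqnn n) gf); last first.
    move=> p q _ c' x; rewrite /f; congr (expR (- (_ * _)))%:E.
    apply: eq_big_seq => i /hor_slotsP[i2 _]; rewrite upd_neq//.
    by apply/eqP => e; rewrite e in i2.
  have -> : f \o flip_rows m n =
      (fun c => (expR (- ((z - v) * \sum_(i <- ver_slots n) c i)))%:E * h c)%E.
    apply/funext => c'; rewrite /f /h /= -EFinM -expRD; congr (expR _)%:E.
    have -> : \sum_(i <- hor_slots m) flip_rows m n c' i = lpp c' m n - lpp c' 0 n.
      rewrite -sum_hor_slots; apply: eq_big_seq => i /mapP[x].
      rewrite mem_iota => /andP[_ xm] -> /=.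
      by have [-> //] := flip_rowsE m c' n.
    by rewrite lpp0_ver_slots; ring.
  have zv : 1 - z + (z - v) = 1 - v by ring.
  rewrite /grid; have gP : integrand (fun c => (expR (- ((z - v) * \sum_(i <- ver_slots n) c i)))%:E * h c)%E.
    split; last by move=> c'; rewrite mule_ge0 ?lee_fin ?expR_ge0.
    apply: emeasurable_funM; last exact: gh.1.
    apply: (integrand_expR _).1; apply: measurableT_comp => //; exact: measurable_funM.
  rewrite (expect_catC rp1 _ _ gP) (expect_catC rp2 (hor_slots m) _ gh) -!catA.
  rewrite (@expect_tilt (ver_slots n) (cells m n ++ hor_slots m) (1 - z) (z - v)
    (grid_rate z (1 - z)) (grid_rate z (1 - v))) ?zv ?uniq_ver_slots//.
  - by rewrite size_map size_iota.
  - move=> i /ver_slotsP[i2 i1]; rewrite mem_cat negb_or; apply/andP; split.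
      by apply/negP => /cellsP[]; rewrite i2.
    by apply: contraL i1 => /hor_slotsP[->].
  - move=> i; rewrite mem_cat /grid_rate => /orP[/cellsP[]|/hor_slotsP[-> //]].
    by case: (i.2) => // ?; case: (i.1).
  - by move=> i /ver_slotsP[i1]; rewrite /grid_rate i1; case: (i.2).
  - by move=> i /ver_slotsP[i1]; rewrite /grid_rate i1; case: (i.2).
have := congr1 (fun F => F c) E1; rewrite {1}E2 /= -/h => E3.
set X := expect _ _ _ c in E3 *.
have q0 : ((1 - z) / (1 - v)) ^+ n != 0 by rewrite expf_neq0// mulf_neq0 ?invr_eq0 ?gt_eqF.
have -> : X = ((((1 - z) / (1 - v)) ^+ n)^-1%:E * ((((1 - z) / (1 - v)) ^+ n)%:E * X))%E.
  by rewrite muleA -EFinM mulVf// mul1e.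
by rewrite E3 -EFinM mulrC -exprVn invf_div.
Qed.

End stationary_grid.

(** * Integrals of functions of independent weights *)

Section transfer.
Context {R : realType}.
Local Notation cfg := (@cfg R).
Local Notation mu := (@lebesgue_measure R).

Definition cylinders : set (set (site -> R)) :=
  [set A | exists J : seq site, exists2 B : site -> set R,
     (forall i, measurable (B i)) & A = [set c | forall i, i \in J -> B i (c i)]].

Lemma cylinders_measurable : @measurable _ cfg = <<s cylinders >>.
Proof.
apply/seteqP; split.
  apply: smallest_sub; first exact: smallest_sigma_algebra.
  move=> _ [i [B mB ->]]; apply: sub_sigma_algebra.
  exists [:: i], (fun=> B) => //; apply/seteqP; split=> c /=.
    by move=> Bi j; rewrite inE => /eqP->.
  by apply; rewrite inE.
apply: smallest_sub; first exact: sigma_algebra_measurable.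
move=> _ [J [B mB ->]].
rewrite [X in measurable X](_ : _ = \bigcap_(i in [set` J]) ((fun c : cfg => c i) @^-1` B i)); last first.
  by apply/seteqP; split=> c /= h i iJ; exact: h.
apply: fin_bigcap_measurable => // i _.
by rewrite -[X in measurable X]setTI; exact: measurable_coord.
Qed.

Lemma cylinders_setI : setI_closed cylinders.
Proof.
move=> _ _ [J1 [B1 mB1 ->]] [J2 [B2 mB2 ->]].
exists (J1 ++ J2), (fun i => (if i \in J1 then B1 i else setT) `&`
                             (if i \in J2 then B2 i else setT)).
  by move=> i; apply: measurableI; case: ifP.
apply/seteqP; split=> c /=.
  move=> [h1 h2] i _; split.
    by case: ifPn => // /h1.
  by case: ifPn => // /h2.
move=> h; split=> i iJ.
  by have := (h i); rewrite mem_cat iJ => /(_ isT)[].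
by have := (h i); rewrite mem_cat iJ orbT => /(_ isT)[].
Qed.

Variables (d : measure_display) (T : measurableType d) (P : probability T R).
Variable Y : site -> {RV P >-> R}.

(** Off s the coordinates are frozen, so that only finitely many variables occur. *)
Definition sample (s : seq site) (x : T) : cfg := fun i => if i \in s then Y i x else 0.

Lemma measurable_sample s : measurable_fun [set: T] (sample s).
Proof.
apply: measurable_cfg => i; rewrite /sample; case: (i \in s); last exact: measurable_cst.
exact: measurable_funPT.
Qed.

(** Independence over duplicate-free lists, the form used by an induction on the
sites. *)
Definition independent_on (s : seq site) := forall (J : seq site) (B : site -> set R),
  uniq J -> {subset J <= s} -> (forall i, measurable (B i)) ->
  (P [set x | forall i, i \in J -> B i (Y i x)] = \prod_(i <- J) P (Y i @^-1` B i))%E.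

(** As functions of A both sides are finite measures, and they agree on the cylinders,
which are stable under intersection and generate the sigma-algebra. *)
Lemma sample_indep i s (A : set cfg) (B : set R) : i \notin s ->
    independent_on (i :: s) -> measurable A -> measurable B ->
  P (sample s @^-1` A `&` Y i @^-1` B) = (P (sample s @^-1` A) * P (Y i @^-1` B))%E.
Proof.
move=> is_ ind mA mB.
have mYB : measurable (Y i @^-1` B) by rewrite -[X in measurable X]setTI; exact: measurable_funPT.
pose X : {mfun T >-> cfg} := HB.pack (sample s) (isMeasurableFun.Build _ _ _ _ _ (measurable_sample s)).
have PB : P (Y i @^-1` B) \is a fin_num by rewrite fin_num_measure.
have b0 : 0 <= fine (P (Y i @^-1` B)) by exact: fine_ge0.
pose m1 := pushforward (mrestr P mYB) X.
pose m2 := mscale (NngNum b0) (distribution P X).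
suff -> : P (sample s @^-1` A `&` Y i @^-1` B) = m2 A.
  by rewrite /m2 /mscale /= fineK// muleC.
rewrite -[LHS]/(m1 A).
apply: (@measure_unique _ R cfg cylinders (fun=> setT) cylinders_measurable
  cylinders_setI _ _ (pushforward (mrestr P mYB) X)
  (mscale (NngNum b0) (distribution P X))) => //.
- by move=> _; exists [::], (fun=> setT) => //; apply/seteqP; split.
- by rewrite bigcup_const.
- move=> _ [J [C mC ->]]; set AJ := [set c | _].
  suff H : P (sample s @^-1` AJ `&` Y i @^-1` B) = (P (Y i @^-1` B) * P (sample s @^-1` AJ))%E.
    by apply: (etrans H); rewrite -[in LHS](fineK PB).
  rewrite /AJ => {AJ}; pose J1 := [seq j <- undup J | j \in s].
  have [J0|J0] := pselect (forall j, j \in J -> j \notin s -> C j 0); last first.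
    rewrite (_ : sample s @^-1` _ = set0) ?set0I ?measure0 ?mule0//.
    apply/seteqP; split=> // x /= h; apply: J0 => j jJ js.
    by have := h j jJ; rewrite /sample (negbTE js).
  have E1 : [set x | forall j, j \in J -> C j (sample s x j)] =
            [set x | forall j, j \in J1 -> C j (Y j x)].
    apply/seteqP; split=> x /= h j.
      rewrite mem_filter mem_undup => /andP[js jJ].
      by have := h j jJ; rewrite /sample js.
    move=> jJ; rewrite /sample; case: ifPn => js; last exact: J0.
    by apply: h; rewrite mem_filter mem_undup js.
  have J1s : {subset J1 <= s} by move=> j; rewrite mem_filter => /andP[].
  have iJ1 : i \notin J1 by apply: contra is_; exact: J1s.
  have uJ1 : uniq J1 by rewrite filter_uniq// undup_uniq.
  rewrite -[X in P (X `&` _)]/[set x | forall j, j \in J -> C j (sample s x j)] E1.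
  rewrite -[X in (_ * P X)%E]/[set x | forall j, j \in J -> C j (sample s x j)] E1.
  pose C' j := if j == i then B else C j.
  have C'J j : j \in J1 -> C' j = C j.
    by move=> jJ; rewrite /C' ifN//; apply: contraNneq iJ1 => <-.
  have mC' j : measurable (C' j) by rewrite /C'; case: ifP.
  have -> : [set x | forall j, j \in J1 -> C j (Y j x)] `&` Y i @^-1` B =
            [set x | forall j, j \in i :: J1 -> C' j (Y j x)].
    apply/seteqP; split=> x /=.
      move=> [h Bi] j; rewrite inE => /predU1P[->|jJ]; first by rewrite /C' eqxx.
      by rewrite C'J//; exact: h.
    move=> h; split.
      by move=> j jJ; rewrite -C'J//; apply: h; rewrite inE jJ orbT.
    by have := h i (mem_head _ _); rewrite /C' eqxx.
  rewrite ind//=; last 2 first.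
  + by rewrite iJ1.
  + by move=> j; rewrite !inE => /predU1P[->|/J1s ->]; rewrite ?eqxx ?orbT.
  rewrite ind//; last by move=> j /J1s js; rewrite inE js orbT.
  rewrite big_cons {1}/C' eqxx; congr (_ * _)%E.
  by apply: eq_big_seq => j jJ; rewrite C'J.
- move=> _; apply: (@le_lt_trans _ _ 1%E); last exact: ltry.
  rewrite -[X in (X <= _)%E]/(P (sample s @^-1` setT `&` Y i @^-1` B)).
  by rewrite preimage_setT setTI; exact: probability_le1.
Qed.

Variable rate : site -> R.
Hypothesis rate0 : forall i, 0 < rate i.

(** The law of (sample s, Y i) is a product by [sample_indep], so Tonelli integrates
one variable at a time. *)
Lemma integral_sample s f : uniq s -> independent_on s ->
    (forall i, i \in s -> forall A, measurable A -> P (Y i @^-1` A) = exponential_prob (rate i) A) ->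
    integrand f ->
  (\int[P]_x f (sample s x) = expect rate s f (fun=> 0%R))%E.
Proof.
elim: s f => [|i s IH] f /=.
  move=> _ _ _ gf; rewrite (eq_integral (fun=> f (fun=> 0%R))) ?integral_cst//.
  transitivity (f (fun=> 0%R) * 1)%E; last exact: mule1.
  by congr (_ * _)%E; exact: probability_setT.
case/andP=> is_ us ind law gf.
have ind' : independent_on s.
  by move=> J B uJ Js mB; apply: ind => // j /Js js; rewrite inE js orbT.
have law' j : j \in s -> forall A, measurable A -> P (Y j @^-1` A) = exponential_prob (rate j) A.
  by move=> js; apply: law; rewrite inE js orbT.
pose X : {mfun T >-> cfg} := HB.pack (sample s) (isMeasurableFun.Build _ _ _ _ _ (measurable_sample s)).
have mZ : measurable_fun [set: T] (fun x => (sample s x, Y i x)).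
  by apply: measurable_fun_pair; [exact: measurable_sample | exact: measurable_funPT].
pose Z : {mfun T >-> (cfg * R)%type} := HB.pack (fun x => (sample s x, Y i x))
  (isMeasurableFun.Build _ _ _ _ _ mZ).
pose F (p : cfg * R) := f (upd p.1 i p.2).
have mF : measurable_fun [set: cfg * R] F.
  apply: measurableT_comp; first exact: gf.1.
  by apply: measurable_upd; [exact: measurable_fst | exact: measurable_snd].
have F0 p : (0 <= F p)%E by exact: gf.2.
have lawZ U : measurable U -> (distribution P X \x distribution P (Y i))%E U = distribution P Z U.
  apply: product_measure_unique => A B mA mB.
  rewrite -[LHS]/(P (sample s @^-1` A `&` Y i @^-1` B)).
  exact: (sample_indep is_ ind mA mB).
transitivity (\int[P]_x (F \o Z) x)%E.
  apply: eq_integral => x _; rewrite /F /=; congr f; apply/funext => j.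
  rewrite /sample /upd inE; by have [->|] := eqVneq j i.
rewrite -(@ge0_integral_distribution _ _ _ _ _ P Z F)//.
transitivity (\int[(distribution P X \x distribution P (Y i))%E]_p F p)%E.
  by apply: eq_measure_integral => A mA _; apply/esym/lawZ.
rewrite fubini_tonelli1//.
transitivity (\int[distribution P X]_c (int1 i (rate i) f) c)%E.
  apply: eq_integral => c _; rewrite /fubini_F /F /=.
  apply: (@integral_exponential_prob _ (distribution P (Y i)) (rate i) (fun x => f (upd c i x)) (rate0 i)).
  - by move=> A mA; apply: law; rewrite ?mem_head.
  - exact: measurable_comp_upd gf.1.
  - by move=> x; exact: gf.2.
have g1 : integrand (int1 i (rate i) f) by exact: integrand_int1.
rewrite (@ge0_integral_distribution _ _ _ _ _ P X (int1 i (rate i) f) g1.1 g1.2).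
have := IH _ us ind' law' g1; rewrite /= => ->.
rewrite -[expect rate s (int1 i (rate i) f)]/(expect rate s (expect rate [:: i] f)).
rewrite -expect_cat (expect_catC rate0 s [:: i] gf).
by [].
Qed.

End transfer.

Section weights.
Context {R : realType}.
Variables (d : measure_display) (T : measurableType d) (P : probability T R).
Variable w : site -> {RV P >-> R}.
Hypothesis hw : exponential_weights w.

(** The cell (1, 1) of the reversed grid is the endpoint (m, n) of the paths. *)
Definition reverse_site (m n : nat) (u : site) : site := (m.+1 - u.1, n.+1 - u.2)%N.

Lemma integral_weights (m n : nat) f : @integrand R f ->
  (\int[P]_x f (sample (fun u => w (reverse_site m n u)) (cells m n) x) =
   expect (fun=> 1%R) (cells m n) f (fun=> 0%R))%E.
Proof.
move=> gf; case: hw => ind law.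
have cell u : u \in cells m n -> [/\ (0 < u.1)%N, (u.1 <= m)%N, (0 < u.2)%N & (u.2 <= n)%N].
  by case/allpairsP => -[x y] /=; rewrite !mem_iota /= !add0n => -[xm yn ->].
have rK u : u \in cells m n -> reverse_site m n (reverse_site m n u) = u.
  move=> /cell[u1 um u2 un]; rewrite /reverse_site /= !subKn ?leqW//.
  by rewrite -surjective_pairing.
have rpos u : u \in cells m n -> positive_sites (reverse_site m n u).
  by move=> /cell[u1 um u2 un]; rewrite /positive_sites /= !subn_gt0 !ltnS.
apply: integral_sample => //.
- apply: allpairs_uniq; rewrite ?iota_uniq// => -[x y] [x' y'] _ _ /= [-> ->] //.
- move=> J B uJ Js mB.
  pose B' v := B (reverse_site m n v).
  have uJ' : uniq [seq reverse_site m n i | i <- J].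
    rewrite map_inj_in_uniq// => u v /Js uJ1 /Js vJ1 e.
    by rewrite -(rK u uJ1) e rK.
  have := ind [fset x in [seq reverse_site m n i | i <- J]]%fset B'.
  have -> : [set x | forall i, i \in J -> B i (w (reverse_site m n i) x)] =
    \bigcap_(i in [set` [fset x in [seq reverse_site m n i | i <- J]]%fset]) (w i @^-1` B' i).
    apply/seteqP; split=> x /=.
      move=> h i /=; rewrite !inE => /mapP[j jJ ->].
      by rewrite /B' /= rK ?Js//; exact: h.
    move=> h i iJ; have := h (reverse_site m n i); rewrite /= /B' rK ?Js//; apply.
    by rewrite !inE; exact: map_f.
  move=> ->; last 2 first.
  + by move=> v /=; rewrite !inE => /mapP[j /Js jJ ->]; exact: rpos.
  + by move=> i _; exact: mB.
  rewrite (perm_big [seq reverse_site m n i | i <- J]) /=; last first.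
    apply: uniq_perm => //; first exact: fset_uniq.
    by move=> v; rewrite !inE.
  rewrite big_map; apply: eq_big_seq => i /Js iJ; by rewrite /B' rK.
- move=> i iJ A mA; exact: (law _ (rpos i iJ) A mA).
Qed.

End weights.

(** * Probability of an exit through the wrong axis *)

Section exit_bound.
Context {R : realType}.
Local Notation mu := (@lebesgue_measure R).
Local Notation cfg := (@cfg R).
Implicit Types (f g h : cfg -> \bar R) (c : cfg) (i j u : site) (rate : site -> R) (s : seq site).

Lemma lpp_le (w w' : site -> R) : (forall u, w u <= w' u) -> forall x y, lpp w x y <= lpp w' x y.
Proof.
move=> ww; elim=> [|x IHx]; elim=> [|y IHy].
- exact: ww.
- by rewrite !lpp0S lerD.
- by rewrite !lppS0 lerD.
- by rewrite !lppSS lerD// ge_max !le_max IHx IHy orbT.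
Qed.

Definition nondecreasing_in f i := forall c (x y : R), x <= y -> (f (upd c i x) <= f (upd c i y))%E.

Lemma expect_nondecreasing rate s f i : (forall u, 0 < rate u) -> integrand f ->
  nondecreasing_in f i -> nondecreasing_in (expect rate s f) i.
Proof.
move=> rp gf fi; elim: s => [//|j s IH] c x y xy /=.
have gE := integrand_expect rp s gf.
have [->|ij] := eqVneq i j; first by rewrite !int1_indep_self.
apply: ge0_le_integral => //.
- by move=> v _; exact: int1_pos.
- exact: int1_measurable gE.1.
- exact: int1_measurable gE.1.
- move=> v _; rewrite lee_wpmul2r ?expd_ge0//.
  by rewrite !(updC _ _ _ ij); exact: IH.
Qed.

Lemma expect_le1 rate s f c : (forall u, 0 < rate u) -> integrand f ->
  (forall c, f c <= 1)%E -> (expect rate s f c <= 1)%E.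
Proof.
move=> rp gf f1; apply: (@le_trans _ _ (expect rate s (fun=> 1%E) c)).
  by apply: expect_le => //; exact: integrand1.
by rewrite (expect_indep rp integrand1).
Qed.

Lemma int1_le_rate i (r r' : R) f c : 0 < r' -> r' <= r -> integrand f ->
    (forall c, f c <= 1)%E -> nondecreasing_in f i ->
  (int1 i r f c <= int1 i r' f c)%E.
Proof.
move=> r0 rr gf f1 fi; rewrite /int1.
have ff c' : f c' = (fine (f c'))%:E.
  rewrite fineK// ge0_fin_numE; last exact: gf.2.
  by rewrite (le_lt_trans (f1 _))// ltry.
under eq_integral do rewrite ff.
under [leRHS]eq_integral do rewrite ff.
apply: (@integral_expd_le_rate _ (fun x => fine (f (upd c i x))) r' r r0 rr).
- apply/measurable_EFinP; rewrite [X in measurable_fun _ X](_ : _ = (fun x => f (upd c i x))).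
    exact: measurable_comp_upd gf.1.
  by apply/funext => x /=; rewrite -ff.
- by move=> x; rewrite -lee_fin -ff; exact: gf.2.
- by move=> x y xy; rewrite -lee_fin -!ff; exact: fi.
Qed.

(** Coordinates are treated one by one: lowering the rate increases the expectation of
a nondecreasing function, and the rate of a coordinate on which f does not depend
is arbitrary. *)
Lemma expect_le_rate rate rate' s f c : (forall u, 0 < rate u) -> (forall u, 0 < rate' u) ->
    integrand f -> (forall c, f c <= 1)%E ->
    (forall i, i \in s -> [\/ rate i = rate' i, indep_of f i |
       rate' i <= rate i /\ nondecreasing_in f i]) ->
  (expect rate s f c <= expect rate' s f c)%E.
Proof.
move=> rp rp' gf f1; elim: s c => [//|i s IH] c hs /=.
have gE := integrand_expect rp s gf; have gE' := integrand_expect rp' s gf.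
apply: (@le_trans _ _ (int1 i (rate i) (expect rate' s f) c)).
  apply: (int1_le (rp i) i c gE gE') => c'; apply: IH => j js; apply: hs.
  by rewrite inE js orbT.
have [<-//|fi|[rr fi]] := hs i (mem_head _ _).
  have iE : indep_of (expect rate' s f) i by exact: expect_indep_of.
  by rewrite (int1_indep (rp _) gE' iE) (int1_indep (rp' _) gE' iE).
apply: int1_le_rate => //.
  by move=> c'; exact: expect_le1.
exact: expect_nondecreasing.
Qed.

Definition indicator (b : cfg -> bool) : cfg -> \bar R := fun c => (b c)%:R%:E.

Lemma integrand_indicator (b : cfg -> bool) : measurable_fun [set: cfg] b -> integrand (indicator b).
Proof.
move=> mb; split; last by move=> c; rewrite /indicator lee_fin.
by apply/measurable_EFinP; exact: measurable_indicator.
Qed.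

Lemma indicator_le1 b c : (indicator b c <= 1)%E.
Proof. by rewrite /indicator lee_fin; case: (b c). Qed.

Variables (m n : nat).
Local Notation E a b := (expect (grid_rate a b) (grid m.+1 n.+1)).
Local Notation G := (fun c : cfg => lpp c m.+1 n.+1 - c (0, 0)%N).
Local Notation H := (fun c : cfg => via_hor c m n).
Local Notation V := (fun c : cfg => via_ver c m n).

(** The Laplace transform of [mgf_stationary] on the grid whose bulk has its far corner
at (m, n). *)
Definition mgf_value (a b : R) : R := (a / b) ^+ m.+1 * ((1 - b) / (1 - a)) ^+ n.+1.

Lemma measurable_passage : measurable_fun [set: cfg] (G : cfg -> R).
Proof.
by apply: measurable_funB; [exact: measurable_lpp0 | exact: measurable_coord].
Qed.

(** The exponent a - b is the one at which [mgf_stationary] evaluates the Laplace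
transform under the rates (a, 1 - b). *)
Lemma markov_above (X : cfg -> R) (a b x : R) c : 0 < a -> a < 1 -> 0 < b -> b < 1 -> b <= a ->
    measurable_fun [set: cfg] X -> (forall c, X c <= G c) ->
  (E a (1 - b) (indicator (fun c => (x <= X c)%R)) c <= (expR (- ((a - b) * x)) * mgf_value a b)%:E)%E.
Proof.
move=> a0 a1 b0 b1 ba mX XG.
have b10 : 0 < 1 - b by rewrite subr_gt0.
have rp u := grid_rate_gt0 u a0 b10.
have gG : integrand (fun c => (expR ((a - b) * G c))%:E).
  by apply: integrand_expR; apply: measurable_funM => //; exact: measurable_passage.
rewrite EFinM -(mgf_stationary m.+1 n.+1 c a0 a1 b0 b1).
rewrite -[leRHS](congr1 (fun F => F c) (expectZ rp (grid m.+1 n.+1) gG (expR_ge0 (- ((a - b) * x))))).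
apply: expect_le => //.
- by apply: integrand_indicator; apply: measurable_fun_ler => //; exact: measurable_cst.
- split; last by move=> c'; rewrite mule_ge0 ?lee_fin ?expR_ge0.
  by apply: measurable_funeM; exact: gG.1.
- move=> c'; rewrite /indicator -EFinM -expRD lee_fin.
  have [xX|_] := lerP x (X c'); last exact: expR_ge0.
  rewrite /= -[X in X <= _]expR0 ler_expR addrC -mulrBr mulr_ge0// ?subr_ge0//.
  exact: le_trans xX (XG c').
Qed.

Lemma markov_below (a b x : R) c : 0 < a -> a < 1 -> 0 < b -> b < 1 -> a <= b ->
  (E a (1 - b) (indicator (fun c => (G c <= x)%R)) c <= (expR ((b - a) * x) * mgf_value a b)%:E)%E.
Proof.
move=> a0 a1 b0 b1 ab.
have b10 : 0 < 1 - b by rewrite subr_gt0.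
have rp u := grid_rate_gt0 u a0 b10.
have gG : integrand (fun c => (expR ((a - b) * G c))%:E).
  by apply: integrand_expR; apply: measurable_funM => //; exact: measurable_passage.
rewrite EFinM -(mgf_stationary m.+1 n.+1 c a0 a1 b0 b1).
rewrite -[leRHS](congr1 (fun F => F c) (expectZ rp (grid m.+1 n.+1) gG (expR_ge0 ((b - a) * x)))).
apply: expect_le => //.
- apply: integrand_indicator; apply: measurable_fun_ler; last exact: measurable_cst.
  exact: measurable_passage.
- split; last by move=> c'; rewrite mule_ge0 ?lee_fin ?expR_ge0.
  by apply: measurable_funeM; exact: gG.1.
- move=> c'; rewrite /indicator -EFinM -expRD lee_fin.
  have [xX|_] := lerP (lpp c' m.+1 n.+1 - c' (0, 0)%N) x; last exact: expR_ge0.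
  rewrite /= -[X in X <= _]expR0 ler_expR -(opprB b a) mulNr -mulrBr mulr_ge0// ?subr_ge0//.
Qed.

Lemma measurable_via_hor : measurable_fun [set: cfg] (H : cfg -> R).
Proof. exact: measurable_lpp. Qed.

Lemma measurable_via_ver : measurable_fun [set: cfg] (V : cfg -> R).
Proof. exact: measurable_lpp. Qed.

Lemma passage_exit c : lpp c m.+1 n.+1 - c (0, 0)%N = Num.max (via_hor c m n) (via_ver c m n).
Proof. by rewrite lpp_exit addrC addKr. Qed.

Lemma via_hor_upd_ver c q x : via_hor (upd c (0, q)%N x) m n = via_hor c m n.
Proof.
rewrite /via_hor; congr (lpp _ _ _); apply/funext => u.
by rewrite /shift upd_neq// xpair_eqE addn1.
Qed.

Lemma via_ver_upd_hor c p x : via_ver (upd c (p, 0)%N x) m n = via_ver c m n.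
Proof.
rewrite /via_ver; congr (lpp _ _ _); apply/funext => u.
by rewrite /shift upd_neq// xpair_eqE addn1 andbF.
Qed.

Lemma ler_bool (b1 b2 : bool) : (b1 -> b2) -> b1%:R <= b2%:R :> R.
Proof. by case: b1 => // ->. Qed.

Lemma shift_upd_le p q c i (x y : R) : x <= y ->
  forall u, shift p q (upd c i x) u <= shift p q (upd c i y) u.
Proof. by move=> xy u; rewrite /shift /upd; case: ifP. Qed.

Lemma via_hor_nondecreasing c i x y : x <= y -> H (upd c i x) <= H (upd c i y).
Proof. by move=> xy; apply: lpp_le; exact: shift_upd_le. Qed.

Lemma via_ver_nondecreasing c i x y : x <= y -> V (upd c i x) <= V (upd c i y).
Proof. by move=> xy; apply: lpp_le; exact: shift_upd_le. Qed.

Lemma grid_cases u M N : u \in grid M N ->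
  [\/ exists p, u = (p, 0)%N, exists q, u = (0, q)%N | (u.1 != 0)%N /\ (u.2 != 0)%N].
Proof.
case: u => p q; rewrite !mem_cat => /or3P[/hor_slotsP[/= -> _]|/ver_slotsP[/= -> _]|/cellsP[/= p0 q0]].
- by constructor 1; exists p.
- by constructor 2; exists q.
- by constructor 3; rewrite -!lt0n.
Qed.

(** Lowering the vertical rate from 1 - z to 1 - v1 favours the vertical exit.  If then
H <= V, either V is at least x or G = max(H, V) is at most x.  As V does not depend on
the horizontal axis, the horizontal rate can be raised to v2 in the first case, and
V is at most G.  For x the mean of G under the rates (v1, 1 - v1), these are
deviations of G above and below its mean. *)
Lemma exit_ver_bound (z v1 v2 x : R) c : 0 < z -> z <= v1 -> v1 <= v2 -> v2 < 1 ->
  (E z (1 - z) (indicator (fun c => (H c <= V c)%R)) c <=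
   (expR (- ((v2 - v1) * x)) * mgf_value v2 v1 +
    expR ((v1 - z) * x) * mgf_value z v1)%:E)%E.
Proof.
move=> z0 zv vv v21.
have v10 : 0 < v1 := lt_le_trans z0 zv.
have v20 : 0 < v2 := lt_le_trans v10 vv.
have v11 : v1 < 1 := le_lt_trans vv v21.
have z1 : z < 1 := le_lt_trans zv v11.
have z10 : 0 < 1 - z by rewrite subr_gt0.
have v110 : 0 < 1 - v1 by rewrite subr_gt0.
have gHV : integrand (indicator (fun c => (H c <= V c)%R)).
  apply: integrand_indicator; apply: measurable_fun_ler; [exact: measurable_via_hor|exact: measurable_via_ver].
have gxV : integrand (indicator (fun c => (x <= V c)%R)).
  apply: integrand_indicator; apply: measurable_fun_ler; [exact: measurable_cst|exact: measurable_via_ver].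
have gGx : integrand (indicator (fun c => (G c <= x)%R)).
  apply: integrand_indicator; apply: measurable_fun_ler; [exact: measurable_passage|exact: measurable_cst].
have rzz u := grid_rate_gt0 u z0 z10.
have rzv u := grid_rate_gt0 u z0 v110.
have rvv u := grid_rate_gt0 u v20 v110.
apply: (@le_trans _ _ (E z (1 - v1) (indicator (fun c => (H c <= V c)%R)) c)).
  apply: expect_le_rate => //; first exact: indicator_le1.
  move=> u /grid_cases[[p ->]|[q ->]|[/negbTE u1 /negbTE u2]].
  - by constructor 1.
  - case: q => [|q]; first by constructor 1.
    constructor 3; split; first by rewrite /grid_rate /= lerB.
    move=> c' a b ab; rewrite /indicator lee_fin !via_hor_upd_ver.
    by apply: ler_bool => h; apply: le_trans h _; exact: via_ver_nondecreasing.
  - by constructor 1; rewrite /grid_rate u1 u2.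
apply: (@le_trans _ _ (E z (1 - v1) (fun c => indicator (fun c => (x <= V c)%R) c +
    indicator (fun c => (G c <= x)%R) c)%E c)).
  apply: expect_le => //.
    split; last by move=> c'; rewrite adde_ge0 ?gxV.2 ?gGx.2.
    by apply: emeasurable_funD; [exact: gxV.1 | exact: gGx.1].
  move=> c'; rewrite /indicator -EFinD lee_fin passage_exit.
  have [HV|_] := boolP (via_hor c' m n <= via_ver c' m n); last by rewrite addr_ge0.
  rewrite max_r//; have [xV|xV] := lerP x (via_ver c' m n); first by rewrite lerDl.
  by rewrite (ltW xV) add0r.
rewrite (expectD rzv _ gxV gGx) EFinD; apply: leeD; last exact: markov_below.
apply: (@le_trans _ _ (E v2 (1 - v1) (indicator (fun c => (x <= V c)%R)) c)).
  apply: expect_le_rate => //; first exact: indicator_le1.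
  move=> u /grid_cases[[p ->]|[q ->]|[/negbTE u1 /negbTE u2]].
  - by constructor 2 => c' a; rewrite /indicator via_ver_upd_hor.
  - case: q => [|q]; last by constructor 1.
    by constructor 2 => c' a; rewrite /indicator via_ver_upd_hor.
  - by constructor 1; rewrite /grid_rate u1 u2.
apply: markov_above => //; first exact: measurable_via_ver.
by move=> c'; rewrite passage_exit le_max lexx orbT.
Qed.

Lemma exit_hor_bound (z v1 v2 x : R) c : z < 1 -> v1 <= z -> v2 <= v1 -> 0 < v2 ->
  (E z (1 - z) (indicator (fun c => (V c <= H c)%R)) c <=
   (expR (- ((v1 - v2) * x)) * mgf_value v1 v2 +
    expR ((z - v1) * x) * mgf_value v1 z)%:E)%E.
Proof.
move=> z1 zv vv v20.
have v10 : 0 < v1 := lt_le_trans v20 vv.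
have z0 : 0 < z := lt_le_trans v10 zv.
have v11 : v1 < 1 := le_lt_trans zv z1.
have v21 : v2 < 1 := le_lt_trans vv v11.
have z10 : 0 < 1 - z by rewrite subr_gt0.
have v210 : 0 < 1 - v2 by rewrite subr_gt0.
have gHV : integrand (indicator (fun c => (V c <= H c)%R)).
  apply: integrand_indicator; apply: measurable_fun_ler; [exact: measurable_via_ver|exact: measurable_via_hor].
have gxV : integrand (indicator (fun c => (x <= H c)%R)).
  apply: integrand_indicator; apply: measurable_fun_ler; [exact: measurable_cst|exact: measurable_via_hor].
have gGx : integrand (indicator (fun c => (G c <= x)%R)).
  apply: integrand_indicator; apply: measurable_fun_ler; [exact: measurable_passage|exact: measurable_cst].
have rzz u := grid_rate_gt0 u z0 z10.
have rzv u := grid_rate_gt0 u v10 z10.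
have rvv u := grid_rate_gt0 u v10 v210.
apply: (@le_trans _ _ (E v1 (1 - z) (indicator (fun c => (V c <= H c)%R)) c)).
  apply: expect_le_rate => //; first exact: indicator_le1.
  move=> u /grid_cases[[p ->]|[q ->]|[/negbTE u1 /negbTE u2]].
  - constructor 3; split; first by rewrite /grid_rate.
    move=> c' a b ab; rewrite /indicator lee_fin !via_ver_upd_hor.
    by apply: ler_bool => h; apply: le_trans h _; exact: via_hor_nondecreasing.
  - case: q => [|q]; last by constructor 1.
    constructor 3; split; first by rewrite /grid_rate.
    move=> c' a b ab; rewrite /indicator lee_fin !via_ver_upd_hor.
    by apply: ler_bool => h; apply: le_trans h _; exact: via_hor_nondecreasing.
  - by constructor 1; rewrite /grid_rate u1 u2.
apply: (@le_trans _ _ (E v1 (1 - z) (fun c => indicator (fun c => (x <= H c)%R) c +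
    indicator (fun c => (G c <= x)%R) c)%E c)).
  apply: expect_le => //.
    split; last by move=> c'; rewrite adde_ge0 ?gxV.2 ?gGx.2.
    by apply: emeasurable_funD; [exact: gxV.1 | exact: gGx.1].
  move=> c'; rewrite /indicator -EFinD lee_fin passage_exit.
  have [HV|_] := boolP (via_ver c' m n <= via_hor c' m n); last by rewrite addr_ge0.
  rewrite max_l//; have [xV|xV] := lerP x (via_hor c' m n); first by rewrite lerDl.
  by rewrite (ltW xV) add0r.
rewrite (expectD rzv _ gxV gGx) EFinD; apply: leeD; last exact: markov_below.
apply: (@le_trans _ _ (E v1 (1 - v2) (indicator (fun c => (x <= H c)%R)) c)).
  apply: expect_le_rate => //; first exact: indicator_le1.
  move=> u /grid_cases[[p ->]|[q ->]|[/negbTE u1 /negbTE u2]].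
  - by constructor 1.
  - case: q => [|q]; first by constructor 1.
    by constructor 2 => c' a; rewrite /indicator via_hor_upd_ver.
  - by constructor 1; rewrite /grid_rate u1 u2.
apply: markov_above => //; first exact: measurable_via_hor.
by move=> c'; rewrite passage_exit le_max lexx.
Qed.

End exit_bound.

(** * Exponents of the exit bounds *)

Section exit_numeric.
Context {R : realType}.
Implicit Types (s t u v z x : R).

Definition log_mgf (m n : R) t : R := m * ln t - n * ln (1 - t).
(** The mean of the last passage time under the rates (t, 1 - t): m increments of mean
1 / t along one side and n of mean 1 / (1 - t) along the other. *)
Definition mean_passage (m n : R) t : R := m / t + n / (1 - t).

Lemma is_derive_log_mgf m n t : 0 < t -> t < 1 ->
  is_derive t 1 (log_mgf m n) (mean_passage m n t).
Proof.
move=> t0 t1; have t10 : 0 < 1 - t by rewrite subr_gt0.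
have d1 : is_derive t 1 (@ln R) t^-1 by exact: is_derive1_ln.
have d2 : is_derive t 1 (fun x => 1 - x) (0 - 1 : R).
  by apply: is_deriveB.
have d3 : is_derive (1 - t) 1 (@ln R) (1 - t)^-1 by exact: is_derive1_ln.
have d4 : is_derive t 1 (fun x => ln (1 - x)) ((1 - t)^-1 * (0 - 1)).
  exact: (@is_derive1_comp _ (@ln R) (fun x => 1 - x) t _ _ d3 d2).
have d5 : is_derive t 1 (fun x => m * ln x) (m * t^-1).
  exact: (@is_deriveZ _ _ _ (@ln R) m t 1 _ d1).
have d6 : is_derive t 1 (fun x => n * ln (1 - x)) (n * ((1 - t)^-1 * (0 - 1))).
  exact: (@is_deriveZ _ _ _ (fun x => ln (1 - x)) n t 1 _ d4).
have -> : mean_passage m n t = m * t^-1 - n * ((1 - t)^-1 * (0 - 1)).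
  by rewrite /mean_passage sub0r mulrN1 mulrN opprK.
exact: (is_deriveB d5 d6).
Qed.

Lemma log_mgf_mvt m n s t : 0 < s -> s < t -> t < 1 ->
  exists2 c, s < c < t & log_mgf m n t - log_mgf m n s = mean_passage m n c * (t - s).
Proof.
move=> s0 st t1.
have d x : x \in `]s, t[ -> is_derive x 1 (log_mgf m n) (mean_passage m n x).
  rewrite in_itv /= => /andP[sx xt].
  by apply: is_derive_log_mgf; [exact: lt_trans sx | exact: lt_trans t1].
have [|c] := MVT st d; last by rewrite in_itv /=; exists c.
apply: derivable_within_continuous => x; rewrite in_itv /= => /andP[sx xt].
by have [] : is_derive x 1 (log_mgf m n) (mean_passage m n x)
  by apply: is_derive_log_mgf; [exact: lt_le_trans sx | exact: le_lt_trans t1].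
Qed.

Lemma mgf_valueE m n (a b : R) : 0 < a -> a < 1 -> 0 < b -> b < 1 ->
  mgf_value m n a b = expR (log_mgf m.+1%:R n.+1%:R a - log_mgf m.+1%:R n.+1%:R b).
Proof.
move=> a0 a1 b0 b1; have a10 : 0 < 1 - a by rewrite subr_gt0.
have b10 : 0 < 1 - b by rewrite subr_gt0.
have -> : log_mgf m.+1%:R n.+1%:R a - log_mgf m.+1%:R n.+1%:R b =
   m.+1%:R * ln (a / b) + n.+1%:R * ln ((1 - b) / (1 - a)).
  by rewrite !ln_div ?posrE// /log_mgf; ring.
by rewrite expRD !expRM_natl !lnK ?posrE ?divr_gt0.
Qed.

Lemma mgf_value_swap m n (a b : R) : mgf_value m n a b = mgf_value n m (1 - b) (1 - a).
Proof. by rewrite /mgf_value !opprB !(addrC 1) !subrK [LHS]mulrC. Qed.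

(** The function [log_mgf] has derivative [mean_passage], which decreases at rate at
least k; hence it lies below its tangent at u by a quadratic term.  The mean value
theorem on both halves of the interval gives the constant 1 / 4. *)
Lemma exit_exponents m n (k z u v : R) : 0 <= k -> 0 < z -> z < u -> u < v -> v < 1 ->
    (forall s t, z <= s -> s <= t -> t <= v ->
       k * (t - s) <= mean_passage m n s - mean_passage m n t) ->
  - ((v - u) * mean_passage m n u) + (log_mgf m n v - log_mgf m n u) <= - (k * (v - u) ^+ 2 / 4) /\
  (u - z) * mean_passage m n u + (log_mgf m n z - log_mgf m n u) <= - (k * (u - z) ^+ 2 / 4).
Proof.
move=> k0 z0 zu uv v1 hM.
set L := log_mgf m n; set M := mean_passage m n in hM *.
split.
  pose h := (v - u) / 2; have h0 : 0 < h by rewrite divr_gt0// subr_gt0.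
  have um : u < u + h by rewrite ltrDl.
  have mv : u + h < v by rewrite /h; lra.
  have u0 : 0 < u := lt_trans z0 zu.
  have [c1 /andP[uc1 c1m] E1] := log_mgf_mvt m n u0 um (lt_trans mv v1).
  have [c2 /andP[mc2 c2v] E2] := log_mgf_mvt m n (lt_trans u0 um) mv v1.
  have H1 : k * (c1 - u) <= M u - M c1.
    by apply: hM; [exact: ltW|exact: ltW|rewrite ltW// (lt_trans c1m)].
  have H2 : k * (c2 - u) <= M u - M c2.
    by apply: hM; [exact: ltW|rewrite ltW// (lt_trans um)|exact: ltW].
  have M1 : M c1 <= M u.
    by rewrite -subr_ge0; apply: le_trans H1; rewrite mulr_ge0// subr_ge0 ltW.
  have M2 : M c2 <= M u - k * h.
    rewrite lerBrDr -lerBrDl; apply: le_trans H2; rewrite ler_wpM2l//; lra.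
  have e1 : u + h - u = h by ring.
  have e2 : v - (u + h) = h by rewrite /h; field.
  rewrite e1 in E1; rewrite e2 in E2.
  have P1 : M c1 * h <= M u * h by rewrite ler_pM2r.
  have P2 : M c2 * h <= (M u - k * h) * h by rewrite ler_pM2r.
  have -> : L v - L u = M c2 * h + M c1 * h by rewrite -E1 -E2 /L; ring.
  have -> : v - u = 2 * h by rewrite /h; field.
  have -> : k * (2 * h) ^+ 2 / 4 = k * h * h by field.
  move: P1 P2; rewrite mulrBl; lra.
pose h := (u - z) / 2; have h0 : 0 < h by rewrite divr_gt0// subr_gt0.
have zm : z < z + h by rewrite ltrDl.
have mu : z + h < u by rewrite /h; lra.
have [c1 /andP[zc1 c1m] E1] := log_mgf_mvt m n z0 zm (lt_trans mu (lt_trans uv v1)).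
have [c2 /andP[mc2 c2u] E2] := log_mgf_mvt m n (lt_trans z0 zm) mu (lt_trans uv v1).
have H1 : k * (u - c1) <= M c1 - M u.
  by apply: hM; [exact: ltW|rewrite ltW// (lt_trans c1m)|exact: ltW].
have H2 : k * (u - c2) <= M c2 - M u.
  by apply: hM; [rewrite ltW// (lt_trans zm)|exact: ltW|exact: ltW].
have M1 : M u + k * h <= M c1.
  rewrite -lerBrDl; apply: le_trans H1; rewrite ler_wpM2l//.
  have e : u = z + 2 * h by rewrite /h; field.
  by rewrite e; lra.
have M2 : M u <= M c2.
  by rewrite -subr_ge0; apply: le_trans H2; rewrite mulr_ge0// subr_ge0 ltW.
have e1 : z + h - z = h by ring.
have e2 : u - (z + h) = h by rewrite /h; field.
rewrite e1 in E1; rewrite e2 in E2.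
have P1 : (M u + k * h) * h <= M c1 * h by rewrite ler_pM2r.
have P2 : M u * h <= M c2 * h by rewrite ler_pM2r.
have -> : L z - L u = - (M c2 * h + M c1 * h) by rewrite -E1 -E2 /L; ring.
have -> : u - z = 2 * h by rewrite /h; field.
have -> : k * (2 * h) ^+ 2 / 4 = k * h * h by field.
move: P1 P2; rewrite mulrDl; lra.
Qed.

Lemma zeta_gt0 (m n : R) : 0 < m -> 0 < n -> 0 < zeta m n.
Proof. by move=> m0 n0; rewrite divr_gt0 ?addr_gt0 ?sqrtr_gt0. Qed.

Lemma zeta_swap (m n : R) : 0 < m -> 0 < n -> zeta n m = 1 - zeta m n.
Proof.
move=> m0 n0; rewrite /zeta [Num.sqrt n + _]addrC.
have s0 : 0 < Num.sqrt m + Num.sqrt n by rewrite addr_gt0 ?sqrtr_gt0.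
by field; rewrite gt_eqF.
Qed.

(** With q = zeta m n and S = sqrt m + sqrt n one has m = q^2 S^2 and
n = (1 - q)^2 S^2, so that the derivative n / (1 - t)^2 - m / t^2 of the mean vanishes
at q and is at most - 2 r S^2 at distance r below q.  Replacing m by m - k changes it
by at most (m + n) r, half of this. *)
Lemma mean_passage_decreasing (m n k r s t : R) : 0 < m -> 0 < n -> 0 <= k -> 0 <= r ->
    zeta m n / 2 <= s -> s <= t -> t <= zeta m n - r ->
    4 * k <= (m + n) * r * zeta m n ^+ 2 ->
  (m + n) * r * (t - s) <= mean_passage (m - k) n s - mean_passage (m - k) n t.
Proof.
move=> m0 n0 k0 r0; set q := zeta m n => qs st tq kr.
have q0 : 0 < q by exact: zeta_gt0.
have q1 : q < 1 by rewrite -subr_gt0 -zeta_swap// zeta_gt0.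
set S := Num.sqrt m + Num.sqrt n.
have S0 : 0 < S by rewrite addr_gt0 ?sqrtr_gt0.
have qS : q * S = Num.sqrt m by rewrite /q /zeta divfK// gt_eqF.
have q1S : (1 - q) * S = Num.sqrt n by rewrite mulrBl mul1r qS /S addrC addKr.
have mE : m = q ^+ 2 * S ^+ 2 by rewrite -exprMn qS sqr_sqrtr// ltW.
have nE : n = (1 - q) ^+ 2 * S ^+ 2 by rewrite -exprMn q1S sqr_sqrtr// ltW.
have S2 : m + n <= S ^+ 2.
  by rewrite /S sqrrD !sqr_sqrtr ?(ltW m0) ?(ltW n0)// addrAC lerDl mulrn_wge0// mulr_ge0// sqrtr_ge0.
have s0 : 0 < s by apply: lt_le_trans qs; rewrite divr_gt0.
have t0 : 0 < t := lt_le_trans s0 st.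
have t1 : t < 1 by apply: le_lt_trans tq _; lra.
have s1 : s < 1 := le_lt_trans st t1.
have s10 : 0 < 1 - s by rewrite subr_gt0.
have t10 : 0 < 1 - t by rewrite subr_gt0.
have -> : mean_passage (m - k) n s - mean_passage (m - k) n t =
   (m / (s * t) - n / ((1 - s) * (1 - t)) - k / (s * t)) * (t - s).
  by rewrite /mean_passage; field; rewrite !gt_eqF.
rewrite ler_wpM2r ?subr_ge0//.
have st0 : 0 < s * t by exact: mulr_gt0.
have A1 : S ^+ 2 * (1 + 2 * r) <= m / (s * t).
  rewrite ler_pdivlMr// mE mulrC -mulrA [leLHS]mulrA [leLHS]mulrC.
  rewrite [leRHS]mulrC -[leLHS]mulrA ler_wpM2l ?exprn_ge0 ?(ltW S0)//.
  have B1 : s * t <= (q - r) ^+ 2.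
    by rewrite expr2 ler_pM ?(ltW s0) ?(ltW t0)// (le_trans st).
  have B2 : 0 <= 1 + 2 * r by lra.
  have B3 : 0 <= q - r by lra.
  apply: (@le_trans _ _ ((1 + 2 * r) * (q - r) ^+ 2)); first by rewrite ler_wpM2l.
  have : 0 <= r * (q - r) * (1 - (q - r)) by rewrite !mulr_ge0//; lra.
  have : 0 <= r * r by rewrite mulr_ge0.
  rewrite !expr2; nra.
have A2 : n / ((1 - s) * (1 - t)) <= S ^+ 2.
  rewrite ler_pdivrMr ?mulr_gt0// nE mulrC ler_wpM2l ?exprn_ge0 ?(ltW S0)//.
  rewrite expr2 ler_pM//; lra.
have A3 : k / (s * t) <= (m + n) * r.
  rewrite ler_pdivrMr//.
  have B1 : (q / 2) * (q / 2) <= s * t by rewrite ler_pM ?(le_trans qs) ?divr_ge0 ?(ltW q0).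
  have B2 : 0 <= (m + n) * r by apply: mulr_ge0 => //; lra.
  apply: (@le_trans _ _ ((m + n) * r * (q / 2 * (q / 2)))); last by rewrite ler_wpM2l.
  have -> : q / 2 * (q / 2) = q ^+ 2 / 4 by field.
  by rewrite mulrA ler_pdivlMr// mulrC.
have A4 : (m + n) * r <= S ^+ 2 * r by rewrite ler_wpM2r.
lra.
Qed.

(** The parameters z, u, v and zeta are equally spaced, so that the whole interval
[z, v] stays at distance r below the critical point. *)
Lemma exit_value_le (m n : nat) (M k r z u v x : R) : M - k = m.+1%:R -> 0 <= k -> 0 < r ->
    z = zeta M n.+1%:R - 3 * r -> zeta M n.+1%:R / 2 <= z ->
    4 * k <= (M + n.+1%:R) * r * zeta M n.+1%:R ^+ 2 ->
    u = z + r -> v = z + r + r -> x = mean_passage m.+1%:R n.+1%:R u ->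
  expR (- ((v - u) * x)) * mgf_value m n v u + expR ((u - z) * x) * mgf_value m n z u <=
  2 * expR (- ((M + n.+1%:R) * r ^+ 3 / 4)).
Proof.
move=> Mk k0 r0 zE zz kk uE vE xE.
have M0 : 0 < M.
  have : 0 < M - k by rewrite Mk.
  by rewrite subr_gt0; apply: le_lt_trans.
have n0 : 0 < n.+1%:R :> R by [].
have q0 := zeta_gt0 M0 n0.
have q1 : zeta M n.+1%:R < 1 by rewrite -subr_gt0 -zeta_swap// zeta_gt0.
have z0 : 0 < z by apply: lt_le_trans zz; rewrite divr_gt0.
have zu : z < u by rewrite uE ltrDl.
have uv : u < v by rewrite vE uE ltrDl.
have v1 : v < 1 by rewrite vE zE; lra.
have K0 : 0 <= (M + n.+1%:R) * r by apply: mulr_ge0; lra.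
have [] := @exit_exponents m.+1%:R n.+1%:R _ z u v K0 z0 zu uv v1.
  move=> s t zs st tv; rewrite -Mk; apply: mean_passage_decreasing => //.
  - exact: ltW.
  - exact: le_trans zs.
  - by apply: le_trans tv _; rewrite vE zE; lra.
rewrite -xE => E1 E2.
have u0 : 0 < u := lt_trans z0 zu.
have v0 : 0 < v := lt_trans u0 uv.
have u1 : u < 1 := lt_trans uv v1.
have z1 : z < 1 := lt_trans zu u1.
rewrite !mgf_valueE// -!expRD [2 * _]mulrDl mul1r.
have e1 : v - u = r by rewrite vE uE; ring.
have e2 : u - z = r by rewrite uE; ring.
have e3 : (M + n.+1%:R) * r * r ^+ 2 / 4 = (M + n.+1%:R) * r ^+ 3 / 4 by field.
by apply: lerD; rewrite ler_expR -e3; [rewrite -[X in X ^+ 2]e1|rewrite -[X in X ^+ 2]e2].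
Qed.

End exit_numeric.

(** * Dependence of the limiting distribution on the parameter *)

Section product_comparison.
Context {R : realType}.

Lemma prod_enum_ord (k : nat) (F : 'I_k -> R) :
  \prod_(i <- enum 'I_k) F i = \prod_(i < k) F i.
Proof. by rewrite big_enum. Qed.

(** In the telescoping sum the terms a (1 - p i) come multiplied by products of the
other factors and add up to a (1 - prod p); only b is multiplied by the number of
factors. *)
Lemma prod_sub_le (I : Type) (r : seq I) (p q : I -> R) (a b : R) : 0 <= a -> 0 <= b ->
    (forall i, 0 <= p i) -> (forall i, p i <= q i) -> (forall i, q i <= 1) ->
    (forall i, q i - p i <= a * (1 - p i) + b) ->
  \prod_(i <- r) q i - \prod_(i <- r) p i <= a * (1 - \prod_(i <- r) p i) + b * (size r)%:R.
Proof.
move=> a0 b0 p0 pq q1 d.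
have p1 i : p i <= 1 := le_trans (pq i) (q1 i).
elim: r => [|i r IH]; first by rewrite !big_nil !subrr mulr0 mulr0 addr0.
rewrite !big_cons /= -natr1.
set Q := \prod_(j <- r) q j in IH *; set P := \prod_(j <- r) p j in IH *.
have P0 : 0 <= P by apply: prodr_ge0.
have P1 : P <= 1 by apply: prodr_ile1 => j _; rewrite p0 p1.
have PQ : P <= Q by apply: ler_prod => j _; rewrite p0 pq.
have A1 : q i * (Q - P) <= Q - P by rewrite ler_piMl// subr_ge0.
have A2 : (q i - p i) * P <= (a * (1 - p i) + b) * P by rewrite ler_wpM2r.
have A3 : b * P <= b by rewrite ler_piMr.
have -> : q i * Q - p i * P = q i * (Q - P) + (q i - p i) * P by ring.
have -> : a * (1 - p i * P) + b * ((size r)%:R + 1) =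
  a * (1 - P) + b * (size r)%:R + a * (1 - p i) * P + b by ring.
move: A2; rewrite mulrDl => A2; lra.
Qed.

Lemma mul_expRN_le1 (y : R) : 0 <= y -> y * expR (- y) <= 1.
Proof.
move=> y0; rewrite expRN ler_pdivrMr ?expR_gt0// mul1r.
by apply: le_trans (expR_ge1Dx y); rewrite lerDr.
Qed.

Lemma mul_expRN_le_half (y : R) : 0 <= y -> y * expR (- y) <= expR (- (y / 2)).
Proof.
move=> y0; have -> : - y = - (y / 2) + - (y / 2) by field.
rewrite expRD mulrA ler_piMl ?expR_ge0// expRN ler_pdivrMr ?expR_gt0// mul1r.
have -> : y / 2 = y / 4 + y / 4 by field.
rewrite expRD.
have h : 1 + y / 4 <= expR (y / 4) by exact: expR_ge1Dx.
have h0 : 0 <= 1 + y / 4 by lra.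
apply: (@le_trans _ _ ((1 + y / 4) * (1 + y / 4))); last by rewrite ler_pM.
have := sqr_ge0 (1 - y / 4); rewrite expr2; nra.
Qed.

Lemma pos_part_ge0 (a : R) : 0 <= pos_part a.
Proof. by rewrite /pos_part le_max lexx orbT. Qed.

(** The product depends only on the sum S of the positive parts, and y expR (- y) <= 1
bounds the change uniformly in S, hence in k. *)
Lemma prod_expR_sub_le (k : nat) (s : 'I_k -> R) (z z' : R) : 0 < z -> z <= z' ->
  \prod_(i < k) expR (- pos_part (s i) * z) - \prod_(i < k) expR (- pos_part (s i) * z') <=
  (z' - z) / z.
Proof.
move=> z0 zz.
have E q : \prod_(i < k) expR (- pos_part (s i) * q) = expR (- ((\sum_(i < k) pos_part (s i)) * q)).
  by rewrite -expR_sum; congr expR; rewrite -mulr_suml sumrN mulNr.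
set S := \sum_(i < k) _ in E; rewrite !E.
have S0 : 0 <= S by apply: sumr_ge0 => i _; exact: pos_part_ge0.
have -> : - (S * z') = - (S * z) + - (S * (z' - z)) by ring.
rewrite expRD -[X in X - _]mulr1 -mulrBr.
have h : 1 - expR (- (S * (z' - z))) <= S * (z' - z).
  by have := expR_ge1Dx (- (S * (z' - z))); lra.
apply: (@le_trans _ _ (expR (- (S * z)) * (S * (z' - z)))).
  by rewrite ler_wpM2l// expR_ge0.
rewrite ler_pdivlMr//.
have -> : expR (- (S * z)) * (S * (z' - z)) * z = (S * z * expR (- (S * z))) * (z' - z) by ring.
rewrite ler_piMl ?subr_ge0//; apply: mul_expRN_le1.
by rewrite mulr_ge0// ltW.
Qed.

(** With y the exponent of a factor at b, the factor changes by at most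
(a - b) / b * y expR (- y).  For y <= 2 ln l this is at most 2 ln l * expR (- y), a
multiple of one minus the factor; for y > 2 ln l it is at most expR (- y / 2) <= 1 / l,
and there are l factors.  [prod_sub_le] sums both. *)
Lemma prod_1expR_sub_le (l : nat) (t : 'I_l -> R) (a b : R) : 0 < b -> b <= a ->
  \prod_(j < l) (1 - expR (- pos_part (t j) * a)) -
  \prod_(j < l) (1 - expR (- pos_part (t j) * b)) <=
  (a - b) / b * (1 + 2 * ln (maxn l 1)%:R).
Proof.
move=> b0 ba.
have ln0 : 0 <= ln (maxn l 1)%:R :> R by rewrite ln_ge0// ler1n leq_max orbT.
have eta0 : 0 <= (a - b) / b by rewrite divr_ge0 ?subr_ge0// ltW.
have [l0|l0] := posnP l.
  by subst l; rewrite !big_ord0 subrr mulr_ge0//; lra.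
have lE : maxn l 1 = l by apply/maxn_idPl.
rewrite lE in ln0 *.
have lR : 0 < l%:R :> R by rewrite ltr0n.
have y1 (c x : R) : 0 <= c -> 0 <= 1 - expR (- pos_part x * c) <= 1.
  move=> c0; rewrite lerBlDr lerDl expR_ge0 andbT subr_ge0.
  rewrite -expR0 ler_expR mulNr oppr_le0 mulr_ge0//; exact: pos_part_ge0.
rewrite -!prod_enum_ord.
apply: le_trans (@prod_sub_le _ (enum 'I_l) (fun j => 1 - expR (- pos_part (t j) * b))
  (fun j => 1 - expR (- pos_part (t j) * a)) ((a - b) / b * (2 * ln l%:R)) ((a - b) / b / l%:R)
  _ _ _ _ _ _) _.
- by rewrite mulr_ge0// mulr_ge0.
- by rewrite divr_ge0.
- by move=> j; case/andP: (y1 b (t j) (ltW b0)).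
- move=> j; rewrite lerB// ler_expR !mulNr lerN2 ler_wpM2l//; exact: pos_part_ge0.
- by move=> j; case/andP: (y1 a (t j) (le_trans (ltW b0) ba)).
- move=> j; set tau := pos_part (t j); have tau0 : 0 <= tau := pos_part_ge0 _.
  have -> : 1 - expR (- tau * a) - (1 - expR (- tau * b)) =
            expR (- tau * b) * (1 - expR (- (tau * (a - b)))).
    have -> : - tau * a = - tau * b + - (tau * (a - b)) by ring.
    by rewrite expRD; ring.
  have h : 1 - expR (- (tau * (a - b))) <= tau * (a - b).
    by have := expR_ge1Dx (- (tau * (a - b))); lra.
  apply: (@le_trans _ _ (expR (- tau * b) * (tau * (a - b)))).
    by rewrite ler_wpM2l// expR_ge0.
  have -> : expR (- tau * b) * (tau * (a - b)) =
            (a - b) / b * (tau * b * expR (- (tau * b))).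
    by rewrite mulNr; field; rewrite gt_eqF.
  rewrite [leRHS](_ : _ = (a - b) / b *
    (2 * ln l%:R * (1 - (1 - expR (- tau * b))) + l%:R^-1)); last by rewrite [RHS]mulrDr [X in _ = X + _]mulrA.
  rewrite ler_wpM2l//.
  rewrite [1 - _](_ : _ = expR (- (tau * b))); last by rewrite mulNr; ring.
  have L0 : 0 <= tau * b by rewrite mulr_ge0// ltW.
  have [h1|h1] := leP (tau * b) (2 * ln l%:R).
    apply: (@le_trans _ _ (2 * ln l%:R * expR (- (tau * b)))).
      by rewrite ler_wpM2r// expR_ge0.
    by rewrite lerDl invr_ge0 ltW.
  apply: (@le_trans _ _ (l%:R^-1)); last by rewrite lerDr mulr_ge0 ?expR_ge0// mulr_ge0.
  apply: le_trans (mul_expRN_le_half L0) _.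
  rewrite -[leRHS]lnK ?posrE ?invr_gt0// ler_expR lnV ?posrE//; lra.
- rewrite size_enum_ord divfK ?gt_eqF// [leRHS]mulrDr mulr1 addrC lerD2l.
  apply: ler_piMr; first by rewrite mulr_ge0// mulr_ge0.
  rewrite lerBlDr lerDl prodr_ge0// => j _.
  by case/andP: (y1 b (t j) (ltW b0)).
Qed.

Lemma f_hor_ge0 (k l : nat) (s : 'I_k -> R) (t : 'I_l -> R) (z : R) :
  z < 1 -> 0 <= f_hor z s t.
Proof.
move=> z1; rewrite mulr_ge0//; apply: prodr_ge0 => i _; first exact: expR_ge0.
rewrite subr_ge0 -[leRHS]expR0 ler_expR mulNr oppr_le0 mulr_ge0 ?pos_part_ge0//.
by rewrite subr_ge0 ltW.
Qed.

Lemma f_hor_sub_le (k l : nat) (s : 'I_k -> R) (t : 'I_l -> R) (z z' : R) :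
    0 < z -> z <= z' -> z' < 1 ->
  f_hor z s t - f_hor z' s t <=
  (z' - z) / z + (z' - z) / (1 - z') * (1 + 2 * ln (maxn l 1)%:R).
Proof.
move=> z0 zz z1; rewrite /f_hor.
have z10 : 0 < 1 - z' by rewrite subr_gt0.
have := prod_expR_sub_le s z0 zz; set A := \prod_(i < k) _; set A' := \prod_(i < k) _ => hA.
have ba : 1 - z' <= 1 - z by lra.
have := prod_1expR_sub_le t z10 ba.
set B := \prod_(j < l) _; set B' := \prod_(j < l) _ => hB.
have e : 1 - z - (1 - z') = z' - z by ring.
rewrite e in hB.
have B0 (q : R) : 0 <= q -> 0 <= \prod_(j < l) (1 - expR (- pos_part (t j) * q)) <= 1.
  move=> q0; have y1 (x : R) : 0 <= 1 - expR (- pos_part x * q) <= 1.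
    rewrite lerBlDr lerDl expR_ge0 andbT subr_ge0.
    rewrite -expR0 ler_expR mulNr oppr_le0 mulr_ge0//; exact: pos_part_ge0.
  rewrite prodr_ge0 ?prodr_ile1// => j _; by case/andP: (y1 (t j)).
have /andP[B00 B01] : 0 <= B <= 1 by apply: B0; lra.
have A0 : 0 <= A' by apply: prodr_ge0 => i _; exact: expR_ge0.
have A1 : A' <= 1.
  apply: prodr_ile1 => i _; rewrite expR_ge0 -expR0 ler_expR mulNr oppr_le0.
  by rewrite mulr_ge0 ?pos_part_ge0//; lra.
have AA : A' <= A.
  apply: ler_prod => i _; rewrite expR_ge0 ler_expR !mulNr lerN2.
  by rewrite ler_wpM2l// pos_part_ge0.
have BB : B' <= B.
  apply: ler_prod => j _; apply/andP; split.
    rewrite subr_ge0 -[leRHS]expR0 ler_expR mulNr oppr_le0 mulr_ge0 ?pos_part_ge0//.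
    exact: ltW.
  by rewrite lerB// ler_expR !mulNr lerN2 ler_wpM2l// pos_part_ge0.
have -> : A * B - A' * B' = (A - A') * B + A' * (B - B') by ring.
apply: lerD.
  by apply: le_trans hA; rewrite ler_piMr// subr_ge0.
by apply: le_trans hB; rewrite ler_piMl// subr_ge0.
Qed.

End product_comparison.

(** * Law of the stationary increments and coupling with the bulk *)

Section increments_law.
Context {R : realType}.
Local Notation mu := (@lebesgue_measure R).
Local Notation cfg := (@cfg R).

Lemma integral_expd_head (r t : R) : 0 < r ->
  (\int[mu]_x ((x <= t)%R%:R%:E * (expd r x)%:E) = (1 - expR (- pos_part t * r))%:E)%E.
Proof.
move=> r0; have mexp := measurable_expd r.
have mle : measurable_fun [set: R] (fun x : R => ((x <= t)%R%:R : R)%:E).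
  by apply/measurable_EFinP; apply: measurable_indicator; exact: measurable_fun_ler.
have mlt : measurable_fun [set: R] (fun x : R => ((t < x)%R%:R : R)%:E).
  by apply/measurable_EFinP; apply: measurable_indicator; exact: measurable_fun_ltr.
have : (\int[mu]_x (((x <= t)%R%:R : R)%:E * (expd r x)%:E) +
        \int[mu]_x (((t < x)%R%:R : R)%:E * (expd r x)%:E) = 1)%E.
  rewrite -(integral_expd r0) -ge0_integralD//.
  - apply: eq_integral => x _; rewrite ltNge; case: (_ <= _) => /=.
      by rewrite mul1e mul0e adde0.
    by rewrite mul1e mul0e add0e.
  - by move=> x _; apply: mule_ge0; [rewrite lee_fin | exact: expd_ge0].
  - exact: (emeasurable_funM mle mexp).
  - by move=> x _; apply: mule_ge0; [rewrite lee_fin | exact: expd_ge0].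
  - exact: (emeasurable_funM mlt mexp).
rewrite integral_expd_tail// EFinB => <-.
by rewrite addeK.
Qed.

Lemma prod_bool (I : Type) (r : seq I) (b : I -> bool) :
  \prod_(i <- r) (b i)%:R = (all b r)%:R :> R.
Proof.
by elim: r => [|i r IH]; rewrite ?big_nil// big_cons IH /= -natrM mulnb.
Qed.

Lemma forall_all (k : nat) (b : 'I_k -> bool) : [forall i, b i] = all b (enum 'I_k).
Proof.
apply/forallP/allP => h i; first by move=> _; exact: h.
by apply: h; rewrite mem_enum.
Qed.

Lemma measurable_forall d (T : measurableType d) (k : nat) (b : 'I_k -> T -> bool) :
  (forall i, measurable_fun [set: T] (b i)) -> measurable_fun [set: T] (fun x => [forall i, b i x]).
Proof.
move=> mb; apply: (measurable_fun_bool true); rewrite setTI.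
rewrite [X in measurable X](_ : _ = \bigcap_(i in [set: 'I_k]) (b i @^-1` [set true])).
  apply: fin_bigcap_measurable; first exact: finite_finset.
  move=> i _.
  by rewrite -[X in measurable X]setTI; exact: mb.
apply/seteqP; split=> x /=; first by move/forallP => h i _; exact: h.
by move=> h; apply/forallP => i; exact: h.
Qed.

Variables (M N k l : nat).
Hypotheses (kM : (k <= M)%N) (lN : (l <= N)%N).
Variables (s : 'I_k -> R) (t : 'I_l -> R).
Implicit Types c : cfg.

(** The point (x, y) of the bulk is the point (x + 1, y + 1) of the grid with axes,
whence the shift of indices between this event and [bulk_event]. *)
Definition stationary_event c : bool :=
  [forall i : 'I_k, s i < hor (lpp c) (M - i) N.+1] &&
  [forall j : 'I_l, ver (lpp c) M.+1 (N - j) <= t j].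

Definition bulk_event c : bool :=
  [forall i : 'I_k, s i < hor (bulk c) (M - i.+1) N] &&
  [forall j : 'I_l, ver (bulk c) M (N - j.+1) <= t j].

Lemma measurable_stationary_event : measurable_fun [set: cfg] stationary_event.
Proof.
apply: measurable_and; apply: measurable_forall => i.
- apply: measurable_fun_ltr => //.
  by apply: measurable_funB; exact: measurable_lpp0.
- apply: measurable_fun_ler => //.
  by apply: measurable_funB; exact: measurable_lpp0.
Qed.

Lemma measurable_bulk_event : measurable_fun [set: cfg] bulk_event.
Proof.
apply: measurable_and; apply: measurable_forall => i.
- apply: measurable_fun_ltr => //.
  by apply: measurable_funB; exact: measurable_lpp.
- apply: measurable_fun_ler => //.
  by apply: measurable_funB; exact: measurable_lpp.
Qed.

Let slot (a : 'I_k + 'I_l) : site :=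
  match a with inl i => ((M - i).+1, 0)%N | inr j => (0, (N - j).+1)%N end.

Let test (a : 'I_k + 'I_l) (x : R) : R :=
  match a with inl i => (s i < x)%R%:R | inr j => (x <= t j)%R%:R end.

Let tests : seq ('I_k + 'I_l) := map inl (enum 'I_k) ++ map inr (enum 'I_l).

(** The event is a conjunction of tests on the increments along the far sides, each of
which is read off from its own slot after all flips. *)
Lemma stationary_law (z : R) c : 0 < z -> z < 1 ->
  expect (grid_rate z (1 - z)) (grid M.+1 N.+1) (indicator stationary_event) c =
  (f_hor z s t)%:E.
Proof.
move=> z0 z1; have z10 : 0 < 1 - z by rewrite subr_gt0.
have zz : z + (1 - z) = 1 by rewrite addrC subrK.
have rp u := grid_rate_gt0 u z0 z10.
have mtest a : measurable_fun [set: R] (test a).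
  case: a => i; apply: measurable_indicator; first exact: measurable_fun_ltr.
  exact: measurable_fun_ler.
pose g (c : cfg) := (\prod_(a <- tests) test a (c (slot a)))%:E.
have gg : integrand g.
  split; last first.
    by move=> c'; rewrite lee_fin prodr_ge0// => -[i|j] _; rewrite /test ler0n.
  apply/measurable_EFinP; apply: measurable_prod => a _.
  exact: (measurableT_comp (mtest a) (measurable_coord (slot a))).
have testsE (F : 'I_k + 'I_l -> R) :
    \prod_(a <- tests) F a = (\prod_(i < k) F (inl i)) * (\prod_(j < l) F (inr j)).
  by rewrite /tests big_cat !big_map; congr (_ * _); exact: prod_enum_ord.
have Eg : indicator stationary_event = g \o flip_rows M.+1 N.+1.
  apply/funext => c'; rewrite /indicator -[RHS]/(g (flip_rows M.+1 N.+1 c')) /g testsE /test /slot.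
  have [F1 F2 _] := flip_rowsE M.+1 c' N.+1.
  have -> : \prod_(i < k) (s i < flip_rows M.+1 N.+1 c' ((M - i).+1, 0)%N)%R%:R =
            [forall i : 'I_k, s i < hor (lpp c') (M - i) N.+1]%:R :> R.
    rewrite forall_all -prod_bool prod_enum_ord; apply: eq_bigr => i _.
    by rewrite F1// ltnS leq_subr.
  have -> : \prod_(j < l) (flip_rows M.+1 N.+1 c' (0, (N - j).+1)%N <= t j)%R%:R =
            [forall j : 'I_l, ver (lpp c') M.+1 (N - j) <= t j]%:R :> R.
    rewrite forall_all -prod_bool prod_enum_ord; apply: eq_bigr => j _.
    by rewrite F2 ltnS leq_subr.
  by rewrite -natrM mulnb.
rewrite Eg (expect_flip_rows z0 z10 zz M.+1 (leqnn N.+1) gg); last first.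
  move=> p q _ c' x; rewrite /g; congr (_%:E); apply: eq_bigr => a _.
  by rewrite upd_neq//; case: a => i; rewrite /slot xpair_eqE ?andbF.
have us : uniq (map slot tests).
  rewrite map_inj_in_uniq.
    rewrite cat_uniq; apply/and3P; split.
    - by rewrite map_inj_uniq; [exact: enum_uniq | move=> ? ? []].
    - by apply/hasPn => _ /mapP[j _ ->]; apply/negP => /mapP[].
    - by rewrite map_inj_uniq; [exact: enum_uniq | move=> ? ? []].
  have inj (m : nat) (i j : nat) : (i <= m)%N -> (j <= m)%N -> (m - i = m - j)%N -> i = j.
    by move=> im jm e; rewrite -(subKn im) e subKn.
  have kb (i : 'I_k) : (i <= M)%N by apply: leq_trans kM; exact: ltnW.
  have lb (j : 'I_l) : (j <= N)%N by apply: leq_trans lN; exact: ltnW.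
  move=> [i|j] [i'|j'] _ _ //= [e].
    by congr inl; apply/val_inj; exact: inj e.
  by congr inr; apply/val_inj; exact: inj e.
have sub : {subset map slot tests <= grid M.+1 N.+1}.
  move=> _ /mapP[[i|j] _ ->] /=.
    by rewrite !mem_cat mem_hor_slots// ltnS leq_subr.
  by rewrite !mem_cat mem_ver_slots ?orbT// ltnS leq_subr.
have val a : (\int[mu]_x ((test a x)%:E * (expd (grid_rate z (1 - z) (slot a)) x)%:E) =
    (match a with inl i => expR (- pos_part (s i) * z)
                | inr j => 1 - expR (- pos_part (t j) * (1 - z)) end)%:E)%E.
  case: a => i; first exact: integral_expd_tail.
  exact: integral_expd_head.
have [S' S'E] := expect_sub us sub rp.
rewrite (S'E _ gg) expect_prod//.
- under eq_bigr do rewrite val /=.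
  rewrite testsE -[_ * _]/(f_hor z s t).
  have gq : integrand (cst (f_hor z s t)%:E : cfg -> \bar R).
    by split=> [|c']; [exact: measurable_cst | rewrite lee_fin f_hor_ge0].
  by rewrite (expect_indep rp gq).
- by case=> i x; rewrite /test ler0n.
- by move=> a; rewrite val.
Qed.

(** The corner (M - k, N) lies to the left of the k horizontal increments and above the
vertical ones, so a horizontal exit there makes [exit_hor] applicable to all of
them. *)
Lemma bulk_le_stationary c :
  (indicator bulk_event c <=
   indicator stationary_event c + indicator (fun c => via_hor c (M - k) N <= via_ver c (M - k) N)%R c)%E.
Proof.
rewrite /indicator -EFinD lee_fin.
have [h|h] := lerP (via_hor c (M - k) N) (via_ver c (M - k) N).
  by rewrite addrC; case: (bulk_event c); rewrite /= ?lerDl ?addr_ge0.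
rewrite addr0; apply: ler_bool => /andP[/forallP h1 /forallP h2].
have [e1 e2] := exit_hor (ltW h).
apply/andP; split; apply/forallP => i.
  have iM : (i < M)%N by apply: leq_trans kM.
  rewrite -(subnSK iM); apply: lt_le_trans (h1 i) _.
  by apply: e1 => //; exact: leq_sub2l.
have iN : (i < N)%N by apply: leq_trans lN.
rewrite -(subnSK iN); apply: le_trans (h2 i).
by apply: e2; [exact: leq_subr | rewrite subnSK// leq_subr].
Qed.

Lemma stationary_le_bulk c :
  (indicator stationary_event c <=
   indicator bulk_event c + indicator (fun c => via_ver c M (N - l) <= via_hor c M (N - l))%R c)%E.
Proof.
rewrite /indicator -EFinD lee_fin.
have [h|h] := lerP (via_ver c M (N - l)) (via_hor c M (N - l)).
  by rewrite addrC; case: (stationary_event c); rewrite /= ?lerDl ?addr_ge0.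
rewrite addr0; apply: ler_bool => /andP[/forallP h1 /forallP h2].
have [e1 e2] := exit_ver (ltW h).
apply/andP; split; apply/forallP => i.
  have iM : (i < M)%N by apply: leq_trans kM.
  apply: lt_le_trans (h1 i) _; rewrite -(subnSK iM).
  by apply: e1; [rewrite subnSK// leq_subr | exact: leq_subr].
have iN : (i < N)%N by apply: leq_trans lN.
apply: le_trans (h2 i); rewrite -(subnSK iN).
by apply: e2 => //; exact: leq_sub2l.
Qed.

Lemma uniq_grid m n : uniq (grid m n).
Proof.
rewrite /grid !cat_uniq uniq_hor_slots uniq_ver_slots /=.
have -> : uniq (cells m n).
  by apply: allpairs_uniq; rewrite ?iota_uniq// => -[x y] [x' y'] _ _ /= [-> ->].
rewrite andbT; apply/andP; split.
  apply/hasPn => u; rewrite mem_cat; apply: contraL => /hor_slotsP[u2 u1].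
  rewrite negb_or; apply/andP; split.
    by apply: contraL u1 => /ver_slotsP[->].
  by apply/negP => /cellsP[_]; rewrite u2.
apply/hasPn => u /cellsP[u1 u2]; apply: contraL u1 => /ver_slotsP[->] //.
Qed.

Lemma sub_grid m n m' n' : (m' <= m)%N -> (n' <= n)%N -> {subset grid m' n' <= grid m n}.
Proof.
move=> mm nn u; rewrite !mem_cat => /or3P[/mapP[x]|/mapP[y]|/allpairsP[[x y]] /=].
- rewrite mem_iota => /andP[_ xm] ->; rewrite mem_hor_slots//.
  by apply: leq_trans mm; rewrite add0n in xm.
- rewrite mem_iota => /andP[_ xm] ->; rewrite mem_ver_slots ?orbT//.
  by apply: leq_trans nn; rewrite add0n in xm.
- rewrite !mem_iota !add0n /= => -[xm yn ->]; rewrite mem_cells ?orbT//.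
    exact: leq_trans mm.
  exact: leq_trans nn.
Qed.

Lemma expect_subgrid_le rate m n m' n' (f : cfg -> \bar R) (q : R) c : (m' <= m)%N -> (n' <= n)%N ->
    (forall u, 0 < rate u) -> integrand f -> 0 <= q ->
    (forall c, expect rate (grid m' n') f c <= q%:E)%E ->
  (expect rate (grid m n) f c <= q%:E)%E.
Proof.
move=> mm nn rp gf q0 h.
have [S' S'E] := expect_sub (uniq_grid m' n') (sub_grid mm nn) rp.
rewrite (S'E _ gf).
have gq : integrand (fun _ : cfg => q%:E) by split=> // c'; rewrite lee_fin.
apply: (@le_trans _ _ (expect rate S' (fun=> q%:E) c)).
  by apply: expect_le => //; exact: integrand_expect.
by rewrite (expect_indep rp gq).
Qed.

End increments_law.

(** * The estimate for horizontal tails *)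

Section hor_estimate.
Context {R : realType}.
Local Notation cfg := (@cfg R).

Lemma lpp_local (w w' : site -> R) x y :
  (forall u, (u.1 <= x)%N -> (u.2 <= y)%N -> w u = w' u) -> lpp w x y = lpp w' x y.
Proof.
elim: x y => [|x IHx]; elim=> [|y IHy] h.
- exact: h.
- rewrite !lpp0S IHy ?h// => u u1 u2; apply: h => //; exact: leqW.
- rewrite !lppS0 IHx ?h// => u u1 u2; apply: h => //; exact: leqW.
- rewrite !lppSS IHx; last by move=> u u1 u2; apply: h => //; exact: leqW.
  by rewrite IHy ?h// => u u1 u2; apply: h => //; exact: leqW.
Qed.

Variables (d : measure_display) (T : measurableType d) (P : probability T R).
Variable w : site -> {RV P >-> R}.
Hypothesis hw : exponential_weights w.
Variables (M N k l : nat).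
Hypotheses (kM : (k <= M)%N) (lN : (l <= N)%N).
Variables (s : 'I_k -> R) (t : 'I_l -> R).

Let grid_sample (x : T) : cfg :=
  sample (fun u => w (reverse_site M.+1 N.+1 u)) (cells M.+1 N.+1) x.

Lemma last_passage_bulk x a b : (a <= M)%N -> (b <= N)%N ->
  last_passage (fun u => w u x) (M.+1 - a, N.+1 - b)%N (M.+1, N.+1) = (bulk (grid_sample x) a b)%:E.
Proof.
move=> aM bN; rewrite last_passage_lpp ?leq_subr// !subKn ?leqW//.
congr EFin; apply: lpp_local => u u1 u2.
rewrite /shift /grid_sample /sample !addn1 mem_cells ?ltnS ?(leq_trans u1)// ?(leq_trans u2)//.
Qed.

Lemma F_hor_event x :
  ((forall i : 'I_k, ((s i)%:E < hor_increment (fun u => w u x) i.+1 1 M.+1 N.+1)%E) /\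
   (forall j : 'I_l, (ver_increment (fun u => w u x) 1 j.+1 M.+1 N.+1 <= (t j)%:E)%E)) <->
  bulk_event M N s t (grid_sample x).
Proof.
have hE (i : 'I_k) : hor_increment (fun u => w u x) i.+1 1 M.+1 N.+1 =
    (hor (bulk (grid_sample x)) (M - i.+1) N)%:E.
  have iM : (i < M)%N by apply: leq_trans kM.
  have e1 : i.+1 = (M.+1 - (M - i))%N by rewrite subSn ?leq_subr// subKn// ltnW.
  have e2 : i.+2 = (M.+1 - (M - i.+1))%N by rewrite subSn ?leq_subr// subKn.
  have e3 : 1%N = (N.+1 - N)%N by rewrite subSn// subnn.
  rewrite /hor_increment {1}e1 {1}e2 {1 2}e3 !last_passage_bulk ?leq_subr//.
  by rewrite /hor subnSK.
have vE (j : 'I_l) : ver_increment (fun u => w u x) 1 j.+1 M.+1 N.+1 =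
    (ver (bulk (grid_sample x)) M (N - j.+1))%:E.
  have jN : (j < N)%N by apply: leq_trans lN.
  have e1 : j.+1 = (N.+1 - (N - j))%N by rewrite subSn ?leq_subr// subKn// ltnW.
  have e2 : j.+2 = (N.+1 - (N - j.+1))%N by rewrite subSn ?leq_subr// subKn.
  have e3 : 1%N = (M.+1 - M)%N by rewrite subSn// subnn.
  rewrite /ver_increment {1}e1 {1}e2 {1 2}e3 !last_passage_bulk ?leq_subr//.
  by rewrite /ver subnSK.
split=> [[h1 h2]|/andP[/forallP h1 /forallP h2]].
  apply/andP; split; apply/forallP => i.
    by have := h1 i; rewrite hE lte_fin.
  by have := h2 i; rewrite vE lee_fin.
split=> i; first by rewrite hE lte_fin; exact: h1.
by rewrite vE lee_fin; exact: h2.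
Qed.

Lemma bulk_upd_axis (c : cfg) (u : site) v : (u.1 == 0)%N || (u.2 == 0)%N ->
  bulk (upd c u v) = bulk c.
Proof.
move=> u0; rewrite /bulk; apply/funext => x; apply/funext => y.
congr (lpp _ _ _); apply/funext => u'; rewrite /shift upd_neq//.
apply/eqP => e; move: u0; rewrite -e /= !addn1 //.
Qed.

(** The event does not depend on the axes, so their rates are free. *)
Lemma F_hor_expect (z : R) : 0 < z -> z < 1 ->
  ((F_hor w M.+1 N.+1 s t)%:E =
   expect (grid_rate z (1 - z)) (grid M.+1 N.+1) (indicator (bulk_event M N s t)) (fun=> 0%R))%E.
Proof.
move=> z0 z1; have z10 : 0 < 1 - z by rewrite subr_gt0.
have rp u := grid_rate_gt0 u z0 z10.
have mb := measurable_bulk_event M N s t.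
have gb := integrand_indicator mb.
pose A := [set x | bulk_event M N s t (grid_sample x)].
have mA : measurable A.
  have mX : measurable_fun [set: T] grid_sample by exact: measurable_sample.
  have mtrue : measurable [set true] by [].
  by have := measurableT_comp mb mX measurableT mtrue; rewrite setTI.
have -> : (F_hor w M.+1 N.+1 s t)%:E = P A.
  rewrite /F_hor fineK; last by rewrite (_ : [set x | _] = A) ?fin_num_measure//;
    apply/seteqP; split=> x /=; rewrite F_hor_event.
  by congr (P _); apply/seteqP; split=> x /=; rewrite F_hor_event.
have -> : P A = (\int[P]_x (indicator (bulk_event M N s t) (grid_sample x)))%E.
  rewrite -[A in LHS]setIT -integral_indic//; apply: eq_integral => x _.
  by rewrite /indicator indicE mem_setE.
rewrite (integral_weights hw _ _ gb).
have rc : {in cells M.+1 N.+1, (fun=> 1%R) =1 grid_rate z (1 - z)}.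
  by move=> u /cellsP[u1 u2]; rewrite /grid_rate !gtn_eqF.
rewrite (eq_expect _ rc) /grid (expect_cat _ (hor_slots _)) (expect_cat _ (ver_slots _)).
have gE : integrand (expect (grid_rate z (1 - z)) (cells M.+1 N.+1) (indicator (bulk_event M N s t))).
  exact: integrand_expect.
have axis u : (u.1 == 0)%N || (u.2 == 0)%N ->
    indep_of (expect (grid_rate z (1 - z)) (cells M.+1 N.+1) (indicator (bulk_event M N s t))) u.
  move=> u0; apply: expect_indep_of => _ c v.
  by rewrite /indicator /bulk_event (bulk_upd_axis _ _ u0).
rewrite (expect_indep rp gE (s := ver_slots N.+1)); last first.
  by move=> u c v /ver_slotsP[u1 _]; apply: axis; rewrite u1.
rewrite (expect_indep rp gE (s := hor_slots M.+1))//.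
by move=> u c v /hor_slotsP[u2 _]; apply: axis; rewrite u2 orbT.
Qed.

Lemma F_hor_le (z q : R) : 0 < z -> z < 1 -> 0 <= q ->
    (forall c, expect (grid_rate z (1 - z)) (grid (M - k).+1 N.+1)
      (indicator (fun c => via_hor c (M - k) N <= via_ver c (M - k) N)%R) c <= q%:E)%E ->
  F_hor w M.+1 N.+1 s t <= f_hor z s t + q.
Proof.
move=> z0 z1 q0 h; have z10 : 0 < 1 - z by rewrite subr_gt0.
have rp u := grid_rate_gt0 u z0 z10.
rewrite -lee_fin (F_hor_expect z0 z1) EFinD.
have gb := integrand_indicator (measurable_bulk_event M N s t).
have gs := integrand_indicator (measurable_stationary_event M N s t).
have ge : integrand (indicator (fun c : cfg => via_hor c (M - k) N <= via_ver c (M - k) N)%R).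
  by apply: integrand_indicator; apply: measurable_fun_ler; exact: measurable_lpp.
apply: (@le_trans _ _ (expect (grid_rate z (1 - z)) (grid M.+1 N.+1) (fun c =>
   indicator (stationary_event M N s t) c +
   indicator (fun c => via_hor c (M - k) N <= via_ver c (M - k) N)%R c)%E (fun=> 0%R))).
  apply: expect_le => //; last by move=> c; exact: bulk_le_stationary.
  split; first by apply: emeasurable_funD; [exact: gs.1 | exact: ge.1].
  by move=> c; rewrite adde_ge0 ?gs.2 ?ge.2.
rewrite (expectD rp _ gs ge) (stationary_law kM lN)// leeD2l//.
by apply: (expect_subgrid_le _ _ _ rp ge q0 h); rewrite // ltnS leq_subr.
Qed.

Lemma F_hor_ge (z q : R) : 0 < z -> z < 1 -> 0 <= q ->
    (forall c, expect (grid_rate z (1 - z)) (grid M.+1 (N - l).+1)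
      (indicator (fun c => via_ver c M (N - l) <= via_hor c M (N - l))%R) c <= q%:E)%E ->
  f_hor z s t <= F_hor w M.+1 N.+1 s t + q.
Proof.
move=> z0 z1 q0 h; have z10 : 0 < 1 - z by rewrite subr_gt0.
have rp u := grid_rate_gt0 u z0 z10.
rewrite -lee_fin EFinD (F_hor_expect z0 z1) -(stationary_law kM lN s t (fun=> 0) z0 z1).
have gb := integrand_indicator (measurable_bulk_event M N s t).
have gs := integrand_indicator (measurable_stationary_event M N s t).
have ge : integrand (indicator (fun c : cfg => via_ver c M (N - l) <= via_hor c M (N - l))%R).
  by apply: integrand_indicator; apply: measurable_fun_ler; exact: measurable_lpp.
apply: (@le_trans _ _ (expect (grid_rate z (1 - z)) (grid M.+1 N.+1) (fun c =>
   indicator (bulk_event M N s t) c +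
   indicator (fun c => via_ver c M (N - l) <= via_hor c M (N - l))%R c)%E (fun=> 0%R))).
  apply: expect_le => //; last by move=> c; exact: stationary_le_bulk.
  split; first by apply: emeasurable_funD; [exact: gb.1 | exact: ge.1].
  by move=> c; rewrite adde_ge0 ?gb.2 ?ge.2.
rewrite (expectD rp _ gb ge) leeD2l//.
by apply: (expect_subgrid_le _ _ _ rp ge q0 h); rewrite // ltnS leq_subr.
Qed.

(** The parameters are Z - 6 r for the upper and Z + 6 r for the lower bound, as
[exit_value_le] needs three spacings, here of 2 r.  The horizontal exit reduces to
the vertical one by exchanging the roles of z and 1 - z ([mgf_value_swap]).  The
constant adds 2 r for the exits and (12 r / q) (2 + 2 L) for moving the parameter
by 6 r, since the denominators in [f_hor_sub_le] are at least q / 2. *)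
Lemma F_hor_estimate (q r : R) : 0 < q -> 0 < r ->
    q <= zeta M.+1%:R N.+1%:R -> q <= 1 - zeta M.+1%:R N.+1%:R -> 12 * r <= q ->
    4 * k%:R <= (M.+1%:R + N.+1%:R) * (2 * r) * q ^+ 2 ->
    4 * l%:R <= (M.+1%:R + N.+1%:R) * (2 * r) * q ^+ 2 ->
    expR (- ((M.+1%:R + N.+1%:R) * (2 * r) ^+ 3 / 4)) <= r ->
  `| F_hor w M.+1 N.+1 s t - f_hor (zeta M.+1%:R N.+1%:R) s t | <=
  (2 + 24 / q) * (1 + ln (maxn l 1)%:R) * r.
Proof.
move=> q0 r0 qz q1z rq hk hl hr.
have m0 : 0 < M.+1%:R :> R by [].
have n0 : 0 < N.+1%:R :> R by [].
have zsw := zeta_swap m0 n0.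
set Z := zeta M.+1%:R N.+1%:R in qz q1z zsw *.
have Z0 : 0 < Z := lt_le_trans q0 qz.
have Z1 : Z < 1 by lra.
set L : R := ln (maxn l 1)%:R.
have L0 : 0 <= L by rewrite ln_ge0// ler1n leq_max orbT.
have T0 : 0 <= (M.+1%:R + N.+1%:R) * (2 * r) :> R.
  by apply: mulr_ge0; [apply: addr_ge0 | lra].
have qZ2 : q ^+ 2 <= Z ^+ 2 by rewrite !expr2 ler_pM// ltW.
have q1Z2 : q ^+ 2 <= (1 - Z) ^+ 2 by rewrite !expr2 ler_pM// ltW.
have r20 : 0 < 2 * r by lra.
have rq6 : 6 * r / q <= 1 / 2 by rewrite ler_pdivrMr//; lra.
have up : F_hor w M.+1 N.+1 s t <= f_hor (Z - 6 * r) s t + 2 * r.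
  set z := Z - 6 * r.
  have z0 : 0 < z by rewrite /z; lra.
  have z1 : z < 1 by rewrite /z; lra.
  apply: F_hor_le => //; first by lra.
  move=> c; pose x := mean_passage (M - k).+1%:R N.+1%:R (z + 2 * r).
  apply: le_trans (@exit_ver_bound _ (M - k) N z (z + 2 * r) (z + 2 * r + 2 * r) x c z0 _ _ _) _.
  - by lra.
  - by lra.
  - by rewrite /z; lra.
  rewrite lee_fin; apply: (@le_trans _ _ (2 * expR (- ((M.+1%:R + N.+1%:R) * (2 * r) ^+ 3 / 4)))); last by lra.
  apply: (@exit_value_le _ (M - k) N M.+1%:R k%:R (2 * r) z) => //.
  - by rewrite -natrB ?(leqW kM)// subSn.
  - by rewrite -/Z /z; ring.
  - by rewrite -/Z /z; lra.
  - by apply: le_trans hk _; rewrite ler_wpM2l.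
have low : f_hor (Z + 6 * r) s t <= F_hor w M.+1 N.+1 s t + 2 * r.
  set z := Z + 6 * r.
  have z0 : 0 < z by rewrite /z; lra.
  have z1 : z < 1 by rewrite /z; lra.
  apply: F_hor_ge => //; first by lra.
  move=> c; pose x := mean_passage (N - l).+1%:R M.+1%:R (1 - z + 2 * r).
  apply: le_trans (@exit_hor_bound _ M (N - l) z (z - 2 * r) (z - 2 * r - 2 * r) x c z1 _ _ _) _.
  - by lra.
  - by lra.
  - by rewrite /z; lra.
  rewrite lee_fin; apply: (@le_trans _ _ (2 * expR (- ((N.+1%:R + M.+1%:R) * (2 * r) ^+ 3 / 4)))); last first.
    by rewrite [N.+1%:R + _]addrC; lra.
  rewrite mgf_value_swap [mgf_value M _ _ z]mgf_value_swap.
  rewrite [z - 2 * r - (z - 2 * r - 2 * r)](_ : _ = 1 - (z - 2 * r - 2 * r) - (1 - (z - 2 * r))); last by ring.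
  rewrite [z - (z - 2 * r)](_ : _ = 1 - (z - 2 * r) - (1 - z)); last by ring.
  apply: (@exit_value_le _ (N - l) M N.+1%:R l%:R (2 * r) (1 - z)) => //.
  - by rewrite -natrB ?(leqW lN)// subSn.
  - by rewrite zsw /z; ring.
  - by rewrite zsw /z; lra.
  - by rewrite zsw [N.+1%:R + _]addrC; apply: le_trans hl _; rewrite ler_wpM2l.
  - by ring.
  - by ring.
  - by rewrite /x; congr mean_passage; ring.
have c1 : f_hor (Z - 6 * r) s t - f_hor Z s t <= 12 * r / q + 12 * r / q * (1 + 2 * L).
  apply: le_trans (f_hor_sub_le s t _ _ Z1) _; [by lra | by lra |].
  have e : Z - (Z - 6 * r) = 6 * r by ring.
  rewrite e -/L; apply: lerD.
    rewrite ler_pdivrMr; last by lra.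
    have : 1 / 2 * q <= Z - 6 * r by lra.
    move=> h; apply: (@le_trans _ _ (12 * r / q * (1 / 2 * q))); last by rewrite ler_wpM2l// divr_ge0//; lra.
    by rewrite le_eqVlt; apply/orP; left; apply/eqP; field; rewrite gt_eqF.
  rewrite ler_wpM2r//; first by lra.
  rewrite ler_pdivrMr; last by lra.
  apply: (@le_trans _ _ (12 * r / q * q)); last by rewrite ler_wpM2l// divr_ge0//; lra.
  by rewrite divfK ?gt_eqF//; lra.
have c2 : f_hor Z s t - f_hor (Z + 6 * r) s t <= 12 * r / q + 12 * r / q * (1 + 2 * L).
  apply: le_trans (f_hor_sub_le s t Z0 _ _) _; [by lra | by lra |].
  have e : Z + 6 * r - Z = 6 * r by ring.
  rewrite e -/L; apply: lerD.
    rewrite ler_pdivrMr//.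
    apply: (@le_trans _ _ (12 * r / q * q)); last by rewrite ler_wpM2l// divr_ge0//; lra.
    by rewrite divfK ?gt_eqF//; lra.
  rewrite ler_wpM2r//; first by lra.
  rewrite ler_pdivrMr; last by lra.
  have h : 1 / 2 * q <= 1 - (Z + 6 * r) by lra.
  apply: (@le_trans _ _ (12 * r / q * (1 / 2 * q))); last by rewrite ler_wpM2l// divr_ge0//; lra.
  by rewrite le_eqVlt; apply/orP; left; apply/eqP; field; rewrite gt_eqF.
have fin : 2 * r + (12 * r / q + 12 * r / q * (1 + 2 * L)) <= (2 + 24 / q) * (1 + L) * r.
  rewrite -subr_ge0.
  have -> : (2 + 24 / q) * (1 + L) * r - (2 * r + (12 * r / q + 12 * r / q * (1 + 2 * L))) =
    2 * (r * L) by ring.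
  by rewrite mulr_ge0// mulr_ge0// ltW.
rewrite ler_norml; apply/andP; split; lra.
Qed.

End hor_estimate.

(** * Transposition *)

Section transposition.
Context {R : realType}.

Lemma lpp_transpose (w : site -> R) x y : lpp (fun u => w (u.2, u.1)) x y = lpp w y x.
Proof.
elim: x y => [|x IHx]; elim=> [|y IHy].
- by [].
- by rewrite lpp0S lppS0 IHy.
- by rewrite lppS0 lpp0S IHx.
- by rewrite !lppSS IHx IHy maxC.
Qed.

Lemma last_passage_transpose (w : site -> R) m n i j : (i <= m)%N -> (j <= n)%N ->
  last_passage (fun u => w (u.2, u.1)) (j, i) (n, m) = last_passage w (i, j) (m, n).
Proof.
by move=> im jn; rewrite !last_passage_lpp// -lpp_transpose.
Qed.

Variables (d : measure_display) (T : measurableType d) (P : probability T R).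
Implicit Types w : site -> {RV P >-> R}.

Definition transpose_weights w : site -> {RV P >-> R} := fun u => w (u.2, u.1).

Lemma exponential_weights_transpose w :
  exponential_weights w -> exponential_weights (transpose_weights w).
Proof.
move=> [ind law]; split=> [J A JD mA|u [u1 u2]]; last by apply: law; split.
pose tr (u : site) : site := (u.2, u.1).
have trK u : tr (tr u) = u by case: u.
have := ind [fset x in [seq tr i | i <- J]]%fset (A \o tr).
have -> : \bigcap_(i in [set` J]) (transpose_weights w i @^-1` A i) =
  \bigcap_(i in [set` [fset x in [seq tr i | i <- J]]%fset]) (w i @^-1` (A \o tr) i).
  apply/seteqP; split=> x /= h i /=.
    by rewrite !inE => /mapP[j jJ ->]; rewrite /= trK; exact: h.
  move=> iJ; have := h (tr i); rewrite /= trK; apply.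
  by rewrite !inE; exact: map_f.
move=> ->; last 2 first.
- by move=> v /=; rewrite !inE => /mapP[j jJ ->]; have [] := JD j jJ; split.
- by move=> i; rewrite !inE => /mapP[j jJ ->]; rewrite /= trK; exact: mA.
rewrite (perm_big [seq tr i | i <- J]) /=; last first.
  apply: uniq_perm => //; first exact: fset_uniq.
    by rewrite map_inj_uniq ?fset_uniq//; exact: can_inj trK.
  by move=> v; rewrite !inE.
by rewrite big_map; apply: eq_bigr => i _; rewrite trK.
Qed.

Lemma F_ver_transpose w m n k l (s : 'I_k -> R) (t : 'I_l -> R) :
    (0 < m)%N -> (0 < n)%N -> (k <= m - 1)%N -> (l <= n - 1)%N ->
  F_ver w m n s t = F_hor (transpose_weights w) n m t s.
Proof.
move=> m0 n0 km ln; rewrite /F_ver /F_hor; congr (fine (P _)).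
have hE (i : 'I_k) x : ver_increment (fun u => transpose_weights w u x) 1 i.+1 n m =
    hor_increment (fun u => w u x) i.+1 1 m n.
  have im : (i.+1 < m)%N by have := ltn_ord i; lia.
  rewrite /ver_increment /hor_increment.
  rewrite -(last_passage_transpose (fun u => w u x) (ltnW im) n0).
  by rewrite -(last_passage_transpose (fun u => w u x) im n0).
have vE (j : 'I_l) x : hor_increment (fun u => transpose_weights w u x) j.+1 1 n m =
    ver_increment (fun u => w u x) 1 j.+1 m n.
  have jn : (j.+1 < n)%N by have := ltn_ord j; lia.
  rewrite /ver_increment /hor_increment.
  rewrite -(last_passage_transpose (fun u => w u x) m0 (ltnW jn)).
  by rewrite -(last_passage_transpose (fun u => w u x) m0 jn).
apply/seteqP; split=> x /= -[h1 h2].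
  by split=> i; [rewrite vE; exact: h2 | rewrite hE; exact: h1].
by split=> i; [rewrite -hE; exact: h2 | rewrite -vE; exact: h1].
Qed.

Lemma f_ver_swap (z : R) k l (s : 'I_k -> R) (t : 'I_l -> R) :
  f_ver z s t = f_hor (1 - z) t s.
Proof. by rewrite /f_ver /f_hor mulrC; congr (_ * _); apply: eq_bigr => i _; rewrite opprB addrCA subrr addr0. Qed.

End transposition.

(** * Choice of the scales *)

Section scales.
Context {R : realType}.

Lemma zeta_ge (delta m n : R) : 0 < delta -> 0 < m -> 0 < n -> delta * n <= m ->
  Num.sqrt delta / (1 + Num.sqrt delta) <= zeta m n.
Proof.
move=> d0 m0 n0 dn; rewrite /zeta.
have sd : 0 < Num.sqrt delta by rewrite sqrtr_gt0.
have sm : 0 < Num.sqrt m by rewrite sqrtr_gt0.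
have sn : 0 < Num.sqrt n by rewrite sqrtr_gt0.
have h : Num.sqrt delta * Num.sqrt n <= Num.sqrt m.
  by rewrite -sqrtrM ?(ltW d0)// ler_sqrt// ltW.
rewrite ler_pdivrMr ?addr_gt0// mulrAC ler_pdivlMr ?addr_gt0//.
by rewrite mulrDr mulrDr mulr1 addrC lerD// mulrC.
Qed.

Lemma root_cubed (x : R) : 0 <= x -> (x `^ (1 / 3)) ^+ 3 = x.
Proof.
move=> x0; rewrite -powR_mulrn ?powR_ge0// -powRrM.
by rewrite div1r mulVf ?powRr1// pnatr_eq0.
Qed.

Lemma powR_two_thirds (x : R) : x `^ (2 / 3) = (x `^ (1 / 3)) ^+ 2.
Proof. by rewrite -powR_mulrn ?powR_ge0// -powRrM; congr powR; field. Qed.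

Lemma ler_cube (x y : R) : 0 <= x -> 0 <= y -> (x ^+ 3 <= y ^+ 3) = (x <= y).
Proof. by move=> x0 y0; rewrite ler_pXn2r. Qed.

(** For r^3 = ln T / T: the first term of the threshold makes (r T^(1/3))^3 = ln T
exceed (2 e / q^2)^3, the second makes r small against q in view of
ln T <= 2 sqrt T.  In the last bound the exponent is - 2 ln T, and
T^(-1) <= ln T / T = r^3 <= r. *)
Lemma scale_bounds (q e T : R) : 0 < q -> q <= 1 -> 0 < e ->
    expR (1 + (2 * e / q ^+ 2) ^+ 3) + (2 * (12 / q) ^+ 3) ^+ 2 <= T ->
  let r := (ln T / T) `^ (1 / 3) in
  [/\ 0 < r, 12 * r <= q, 4 * (e * T `^ (2 / 3)) <= T * (2 * r) * q ^+ 2 &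
      expR (- (T * (2 * r) ^+ 3 / 4)) <= r].
Proof.
move=> q0 q1 e0 hT r.
have X0 : 0 <= 2 * e / q ^+ 2 by rewrite divr_ge0 ?exprn_ge0 ?(ltW q0)//; lra.
have Y0 : 0 < 2 * (12 / q) ^+ 3 by rewrite mulr_gt0// exprn_gt0// divr_gt0.
have hT1 : expR (1 + (2 * e / q ^+ 2) ^+ 3) <= T.
  by apply: le_trans hT; rewrite lerDl exprn_ge0// ltW.
have hT2 : (2 * (12 / q) ^+ 3) ^+ 2 <= T.
  by apply: le_trans hT; rewrite lerDr expR_ge0.
have T0 : 0 < T by apply: lt_le_trans hT1; exact: expR_gt0.
have hL : 1 + (2 * e / q ^+ 2) ^+ 3 <= ln T.
  by rewrite -ler_expR lnK.
have L1 : 1 <= ln T by apply: le_trans hL; rewrite lerDl exprn_ge0.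
have L0 : 0 < ln T by lra.
have r0 : 0 < r by rewrite powR_gt0// divr_gt0.
have r3 : r ^+ 3 = ln T / T by rewrite root_cubed// divr_ge0 ?(ltW L0) ?(ltW T0).
have rq : 12 * r <= q.
  rewrite -ler_pdivlMl// -ler_cube ?(ltW r0)//; last by rewrite mulr_ge0 ?invr_ge0// ltW.
  rewrite r3 ler_pdivrMr//.
  pose S := Num.sqrt T.
  have S0 : 0 < S by rewrite sqrtr_gt0.
  have SS : T = S ^+ 2 by rewrite sqr_sqrtr// ltW.
  have S2 : 2 * (12 / q) ^+ 3 <= S by rewrite -ler_sqr ?nnegrE ?(ltW S0) ?(ltW Y0)// -SS.
  have LS : ln T <= 2 * S.
    rewrite SS lnXn// mulr2n; have := ln_sublinear S0; lra.
  apply: le_trans LS _; rewrite SS expr2 mulrA ler_wpM2r ?(ltW S0)//.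
  have -> : 12^-1 * q = (12 / q)^-1 by rewrite invf_div mulrC.
  rewrite exprVn ler_pdivlMl; first by rewrite mulrC.
  by rewrite exprn_gt0// divr_gt0.
split=> //.
  set y := T `^ (1 / 3).
  have y0 : 0 < y by exact: powR_gt0.
  have y3 : y ^+ 3 = T by rewrite root_cubed// ltW.
  rewrite powR_two_thirds -/y.
  have h : 2 * e / q ^+ 2 <= r * y.
    have ry0 : 0 <= r * y by rewrite mulr_ge0// ltW.
    rewrite -(ler_cube X0 ry0).
    have -> : (r * y) ^+ 3 = ln T by rewrite exprMn r3 y3 divfK// gt_eqF.
    lra.
  have h2 : 2 * e <= r * y * q ^+ 2 by rewrite -ler_pdivrMr// exprn_gt0.
  have -> : T * (2 * r) * q ^+ 2 = 2 * y ^+ 2 * (r * y * q ^+ 2) by rewrite -y3; ring.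
  have -> : 4 * (e * y ^+ 2) = 2 * y ^+ 2 * (2 * e) by ring.
  by rewrite ler_wpM2l// mulr_ge0// exprn_ge0// ltW.
have -> : T * (2 * r) ^+ 3 / 4 = 2 * ln T.
  by rewrite exprMn r3; field; rewrite gt_eqF.
have rr : r ^+ 3 <= r.
  have r1 : r <= 1 by lra.
  by rewrite exprS ler_piMr ?(ltW r0)// exprn_ile1// ltW.
apply: le_trans rr; rewrite r3.
apply: (@le_trans _ _ (expR (- ln T))); first by rewrite ler_expR; lra.
by rewrite expRN lnK ?posrE// -[X in X <= _]mul1r ler_wpM2r// invr_ge0 ltW.
Qed.

End scales.

Theorem theorem2p8 (R : realType) (delta : R) (delta_gt0 : 0 < delta) :
  exists2 c0 : R, 0 < c0 &
  forall eps0 : R, 0 < eps0 ->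
  exists2 N0 : R, 0 < N0 &
  forall (d : measure_display) (T : measurableType d) (P : probability T R)
    (w : site -> {RV P >-> R}), exponential_weights w ->
  forall m n : nat,
    cone delta (m%:R, n%:R) -> N0 <= m%:R -> N0 <= n%:R ->
  forall k l : nat,
    (k <= m - 1)%N -> (l <= n - 1)%N ->
    k%:R <= eps0 * (m + n)%:R `^ (2 / 3) ->
    l%:R <= eps0 * (m + n)%:R `^ (2 / 3) ->
  forall (s : 'I_k -> R) (t : 'I_l -> R),
    `| F_hor w m n s t - f_hor (zeta m%:R n%:R) s t |
      <= c0 * (1 + ln (maxn l 1)%:R)
         * (ln (m + n)%:R / (m + n)%:R) `^ (1 / 3)
    /\
    `| F_ver w m n s t - f_ver (zeta m%:R n%:R) s t |
      <= c0 * (1 + ln (maxn k 1)%:R)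
         * (ln (m + n)%:R / (m + n)%:R) `^ (1 / 3).
Proof.
have sd : 0 < Num.sqrt delta by rewrite sqrtr_gt0.
(* lower bound for both zeta and 1 - zeta on the cone *)
pose q := Num.sqrt delta / (1 + Num.sqrt delta).
have q0 : 0 < q by rewrite divr_gt0// addr_gt0.
have q1 : q <= 1 by rewrite ler_pdivrMr ?addr_gt0// mul1r lerDr.
exists (2 + 24 / q); first by rewrite addr_gt0// divr_gt0.
move=> e e0; pose N0 := expR (1 + (2 * e / q ^+ 2) ^+ 3) + (2 * (12 / q) ^+ 3) ^+ 2.
have N00 : 0 < N0 by rewrite ltr_pwDl ?expR_gt0// exprn_ge0// mulr_ge0// exprn_ge0// divr_ge0// ltW.
exists N0 => // d T P w hw m n [/= m0 n0 dm dn] Nm Nn k l.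
case: m m0 dm dn Nm => [|M] m0 dm dn Nm; first by rewrite ltxx in m0.
case: n n0 dm dn Nn => [|N] n0 dm dn Nn; first by rewrite ltxx in n0.
rewrite !subn1 /= => kM lN hk hl s t.
have hT : N0 <= (M.+1 + N.+1)%:R by rewrite natrD; apply: le_trans Nm _; rewrite lerDl ltW.
have [] := scale_bounds q0 q1 e0 hT.
set r := (_ / _) `^ _ => r0 rq hkr hr.
have scale (j : nat) : j%:R <= e * (M.+1 + N.+1)%:R `^ (2 / 3) ->
    4 * j%:R <= (M.+1%:R + N.+1%:R) * (2 * r) * q ^+ 2.
  by move=> h; rewrite -natrD; apply: le_trans hkr; rewrite ler_wpM2l.
have qz := zeta_ge delta_gt0 m0 n0 dm.
have qz' := zeta_ge delta_gt0 n0 m0 dn.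
have zs := zeta_swap m0 n0.
rewrite natrD in hr; split.
  apply: F_hor_estimate => //; [by rewrite -zs | exact: scale | exact: scale].
rewrite F_ver_transpose ?subn1// f_ver_swap -zs.
apply: F_hor_estimate => //.
- exact: exponential_weights_transpose.
- by rewrite -(zeta_swap n0 m0).
- by rewrite addrC; exact: scale.
- by rewrite addrC; exact: scale.
- by rewrite addrC.
Qed.
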